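(* Let $g\ge 2$ be an integer. Consider the Diophantine equation $$L_k=d_1\frac{g^\ell-1}{g-1}\cdot d_2\frac{g^m-1}{g-1}\cdot d_3\frac{g^n-1}{g-1}$$ in positive integers $k,d_1,d_2,d_3,\ell,m,n$ with $1\le d_1,d_2,d_3\le g-1$, $n\ge 1$ and $\ell\le m\le n$. This equation has only finitely many solutions. Namely, every solution satisfies $$\ell\le m\le n<7.73\times 10^{47}\log^9 g\quad\text{and}\quad k<7.73\times 10^{48}\log^{10} g.$$
   Context: $(L_n)_{n\ge 0}$ is the Lucas sequence: $L_0=2$, $L_1=1$, $L_{n+2}=L_{n+1}+L_n$. $\log$ denotes the natural logarithm. A repdigit in base $g$ is a number of the form $d\,\frac{g^m-1}{g-1}$ with $m\ge1$ and $1\le d\le g-1$. *)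

(* Defs.v *)
From Stdlib Require Import Reals Arith.

Fixpoint lucas (n : nat) : nat :=
  match n with
  | 0 => 2
  | S n' => match n' with
            | 0 => 1
            | S n'' => lucas n' + lucas n''
            end
  end.

(* d * (g^m - 1)/(g - 1): the repdigit with m copies of digit d in base g.
   The nat division is exact since (g - 1) divides (g^m - 1). *)
Definition repdigit (g d m : nat) : nat := d * ((g ^ m - 1) / (g - 1)).

(* Main.v *)
(* Put A = ln phi, G = ln g and D = d1 d2 d3. Since L_k is close to phi ^ k, the equation
   makes three linear forms Lam = k A - N G - ln (p / q) small:
     N = l + m + n,  p / q = D / (g-1)^3,                      |Lam| <= 8 g^-l;
     N = m + n,      p / q = D (g^l - 1) / (g-1)^3,            |Lam| <= 8 g^-m;
     N = n,          p / q = D (g^l - 1) (g^m - 1) / (g-1)^3,  |Lam| <= 8 g^-n.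
   A lower bound |Lam| > exp (- B G H) with H >= ln p, ln q and B of order (ln n)^3 bounds
   l, then m, then n, and n <= 3.01 B^3 G^3 fails for n >= 7.73e47 G^9. Finally
   k A <= 3 n G gives the bound on k.

   The lower bound uses interpolation determinants in real variables. To a point (r, s, t)
   of a box attach u1 = r + k t, u2 = s - N t, y0 = u1 A + u2 G and
   Y = phi^r g^s (p/q)^t = exp (y0 - t Lam). If the functions u1^a u2^b Y^c, a + b < K and
   c < L, are linearly independent on the box, some square matrix of their values is
   invertible; its determinant is small, because Y is almost an exponential of y0, which is
   a linear combination of u1 and u2, and it is not small by Liouville's inequality in
   Z[phi]. A linear relation between the functions is impossible as well: a Casoratian
   eliminates Y and leaves a polynomial in (u1, y0) vanishing on a box, and the zero
   estimate then finds many collinear points in a smaller box. There y0 is affine in u1 or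
   in u2, and the argument is repeated with powers of this one coordinate. *)

(* Nothing guarantees that [phi], [g] and [p / q] are multiplicatively independent, and [p / q]
   changes from one stage to the next, so degenerate forms cannot be set aside beforehand. Only the
   independence of [phi] and [g] is available, and the proof is shaped to use no other: [(u1, u2)]
   still separates the points of a box once k exceeds its first side. This is why the lower bound
   leaves the alternative of a small k, which bounds the number of digits directly. The gain comes
   from counting dimensions. There are about K^2 L / 2 functions, but the products of the monomials
   with powers of y0 up to the m-th span only about K^2 / 2 + K m dimensions. So the determinant
   vanishes to an order of about K L / 4 per row. Against this stand, per row, a height cost of
   order L lam, where lam bounds the logarithmic sides of the box, and a cost of order Q K for the
   size exp Q of u1 and u2. With lam proportional to K this makes L a multiple of Q. The zero
   estimate then makes K a multiple of L^2 G H, and the exponent B G H is of order K L, hence B of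
   order Q^3. *)
Require Import Defs.
From HB Require structures.
From mathcomp Require all_boot all_order all_algebra fingroup perm.
From mathcomp Require ring lra zify.
From mathcomp Require boolp classical_sets reals topology normedtype sequences exp.
From mathcomp Require Rstruct Rstruct_topology.

(* The module confines the MathComp notations: in the theorem [<=], [^], [/] and [ln] are
   those of the standard library. *)
Module LucasRepdigits.
Import HB.structures all_boot all_order all_algebra fingroup perm.
Import ring lra zify.
Import boolp classical_sets reals topology normedtype sequences exp.
Set Implicit Arguments.
Unset Strict Implicit.
Unset Printing Implicit Defensive.
Import Order.TTheory GRing.Theory Num.Theory.
Local Open Scope ring_scope.

(** * Bivariate polynomials and Casoratians *)

Section DetCoef.
Variable R : comNzRingType.

Lemma coef_prod_top (I : Type) (s : seq I) (f : I -> {poly R}) (d : I -> nat) :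
  (forall i, (size (f i) <= (d i).+1)%N) ->
  (size (\prod_(i <- s) f i)%R <= (\sum_(i <- s) d i).+1)%N /\
  (\prod_(i <- s) f i)`_(\sum_(i <- s) d i)%N = \prod_(i <- s) (f i)`_(d i).
Proof.
move=> hf; elim: s => [|x s [IH1 IH2]].
  by rewrite !big_nil size_poly1 coefC.
rewrite !big_cons; split.
  apply: leq_trans (size_polyMleq _ _) _.
  have := hf x; move: IH1; set a := size _; set b := size _; lia.
rewrite coefM.
have hx : (d x < (d x + \sum_(j <- s) d j).+1)%N by lia.
rewrite (bigD1 (Ordinal hx)) //= addKn IH2 [X in _ + X]big1 ?addr0 // => i ni.
have [lt|ge] := ltnP (d x) i.
  by rewrite nth_default ?mul0r //; apply: leq_trans (hf x) _.
rewrite [X in _ * X]nth_default ?mulr0 //; apply: leq_trans IH1 _.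
have : (i != d x :> nat) by apply: contra ni => /eqP e; apply/eqP/val_inj.
move: (ltn_ord i) ge; lia.
Qed.

(** In the expansion of the determinant every term takes one entry from each column, so the column
    degrees [d j] add up to the same total in all terms. *)
Lemma det_coef_top n (M : 'M[{poly R}]_n) (d : 'I_n -> nat) :
  (forall i j, (size (M i j) <= (d j).+1)%N) ->
  (size (\det M) <= (\sum_j d j).+1)%N /\
  (\det M)`_(\sum_j d j)%N = \det (\matrix_(i, j) (M i j)`_(d j)).
Proof.
move=> hM.
have E (s : 'S_n) : (\sum_j d j = \sum_i d (s i))%N by apply: reindex_inj; apply: perm_inj.
have H (s : 'S_n) := coef_prod_top (index_enum 'I_n) (fun i => hM i (s i)).
split.
  apply: (leq_trans (size_sum _ _ _)); apply/bigmax_leqP => s _.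
  by rewrite mulr_sign; case: (odd_perm s); rewrite ?size_polyN (E s); case: (H s).
rewrite coef_sum; apply: eq_bigr => s _.
rewrite !mulr_sign; case: (odd_perm s); rewrite ?coefN (E s) (H s).2; [congr (- _)|];
  by apply: eq_bigr => i _; rewrite mxE.
Qed.
End DetCoef.

Section Bivariate.
Variable F : realFieldType.
Local Notation biv := {poly {poly F}}.

Definition ev (x z : F) : biv -> F := horner_eval z \o horner_eval x%:P.
HB.instance Definition _ x z :=
  GRing.RMorphism.copy (ev x z) (horner_eval z \o horner_eval x%:P).

Definition shiftp (w : F * F) : biv -> biv :=
  comp_poly ('X + w.1%:P%:P) \o map_poly (comp_poly ('X + w.2%:P)).
HB.instance Definition _ w := GRing.RMorphism.copy (shiftp w)
  (comp_poly ('X + w.1%:P%:P) \o map_poly (comp_poly ('X + w.2%:P))).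

Lemma evC x z (c : {poly F}) : ev x z c%:P = c.[z].
Proof. by rewrite /ev /= /horner_eval hornerC. Qed.

Lemma evX x z : ev x z 'X = x.
Proof. by rewrite /ev /= /horner_eval hornerX hornerC. Qed.

Lemma ev_shift x z w P : ev x z (shiftp w P) = ev (x + w.1) (z + w.2) P.
Proof.
rewrite /ev /shiftp /= /horner_eval horner_comp !hornerE -polyCD.
rewrite -[(x + w.1)%:P](comp_polyC _ ('X + w.2%:P)) horner_map /=.
by rewrite horner_comp hornerD hornerX hornerC comp_polyC.
Qed.

Lemma comp_XD_inj (R : idomainType) (c : R) : injective (comp_poly ('X + c%:P)).
Proof.
move=> p q /= /(congr1 (comp_poly ('X - c%:P))).
by rewrite -!comp_polyA comp_polyD comp_polyX comp_polyC addrNK !comp_polyXr.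
Qed.

Lemma size_shift w P : size (shiftp w P) = size P.
Proof.
rewrite /shiftp /= size_comp_poly2 ?size_XaddC //.
by rewrite size_map_inj_poly ?comp_poly0 //; exact: comp_XD_inj.
Qed.

Lemma shift_eq0 w P : (shiftp w P == 0) = (P == 0).
Proof. by rewrite -!size_poly_eq0 size_shift. Qed.

Lemma lead_coef_shift w P :
  lead_coef (shiftp w P) = lead_coef P \Po ('X + w.2%:P).
Proof.
rewrite /shiftp /= lead_coef_comp ?size_XaddC // lead_coefXaddC expr1n mulr1.
by rewrite lead_coef_map_inj // ?comp_poly0 //; exact: comp_XD_inj.
Qed.

(* In [ev x z P] the outer variable of [P] takes the value [x] and the inner one [z];
   [bz n P] bounds the degree of [P] in [z]. *)
Definition bz n (P : biv) := forall i, (size (P`_i)%R <= n.+1)%N.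

Lemma bzW n m P : (n <= m)%N -> bz n P -> bz m P.
Proof. by move=> nm h i; apply: leq_trans (h i) _. Qed.

Lemma bz0 n : bz n 0.
Proof. by move=> i; rewrite coef0 size_poly0. Qed.

Lemma bzD n P Q : bz n P -> bz n Q -> bz n (P + Q).
Proof.
move=> hP hQ i; rewrite coefD; apply: leq_trans (size_polyD _ _) _.
by rewrite geq_max hP hQ.
Qed.

Lemma bz_sum n (I : Type) (s : seq I) (p : pred I) (f : I -> biv) :
  (forall i, p i -> bz n (f i)) -> bz n (\sum_(i <- s | p i) f i).
Proof. by move=> h; elim/big_ind: _ => //; [apply: bz0 | apply: bzD]. Qed.

Lemma bzM n m P Q : bz n P -> bz m Q -> bz (n + m) (P * Q).
Proof.
move=> hP hQ i; rewrite coefM; apply: leq_trans (size_sum _ _ _) _.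
apply/bigmax_leqP => j _; apply: leq_trans (size_polyMleq _ _) _.
by have := hP j; have := hQ (i - j)%N; set a := size _; set b := size _; lia.
Qed.

Lemma bzC n (c : {poly F}) : (size c <= n.+1)%N -> bz n c%:P.
Proof. by move=> h i; rewrite coefC; case: ifP => // _; rewrite size_poly0. Qed.

Lemma bzX : bz 0 'X.
Proof. by move=> i; rewrite coefX; case: (_ == _); rewrite ?size_poly1 ?size_poly0. Qed.

Lemma bzXn n P m : bz n P -> bz (n * m) (P ^+ m).
Proof.
move=> h; elim: m => [|m IH]; first by rewrite expr0 muln0; apply: bzC; rewrite size_poly1.
by rewrite exprS mulnS; apply: bzM.
Qed.

Lemma bz_det n m (M : 'M[biv]_m) : (forall i j, bz n (M i j)) -> bz (n * m) (\det M).
Proof.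
move=> hM; apply: bz_sum => s _.
have : bz (n * m) (\prod_i M i (s i)).
  rewrite -[X in (_ * X)%N]card_ord -sum1_card big_distrr /=.
  elim/big_ind2: _ => //= [|P a Q b|i _]; [by apply: bzC; rewrite size_poly1|exact: bzM|by rewrite muln1].
by rewrite mulr_sign; case: ifP => // _ h i; rewrite coefN size_polyN.
Qed.

Lemma bz_shift n w P : bz n P -> bz n (shiftp w P).
Proof.
move=> hP; rewrite /shiftp /= comp_polyE; apply: bz_sum => i _.
rewrite -mul_polyC -[n]addn0; apply: bzM.
  apply: bzC; rewrite coef_map /= size_comp_poly2 ?size_XaddC //.
by rewrite -[X in bz X](mul0n i); apply: bzXn; apply: bzD; [exact: bzX|apply: bzC; rewrite size_polyC; case: (_ == _)].
Qed.

Lemma det_vandermonde_cols (R : comNzRingType) n (a : 'I_n -> R) :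
  \det (\matrix_(i < n, j < n) a i ^+ j) = \prod_(i < n) \prod_(j < n | (i < j)%N) (a j - a i).
Proof.
rewrite -det_tr; have := det_Vandermonde (\row_i a i).
rewrite (_ : Vandermonde _ _ = (\matrix_(i < n, j < n) a i ^+ j)^T); last first.
  by apply/matrixP => i j; rewrite !mxE.
by move=> ->; apply: eq_bigr => i _; apply: eq_bigr => j _; rewrite !mxE.
Qed.

(* [D] is the determinant with entries [P_l(x + w_i) eta_i ^ l], a vanishing [P_l] being
   replaced by [1]; its leading coefficient in both variables is a Vandermonde determinant
   times a nonzero constant. *)
Lemma casoratian K L (P : 'I_L -> biv) (eta : 'I_L -> F) (w : 'I_L -> F * F) :
  injective eta -> (forall l, size (P l) <= K.+1)%N -> (forall l, bz K (P l)) ->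
  (exists l, P l != 0) ->
  exists2 D : biv, D != 0 & [/\ (size D <= (K * L).+1)%N, bz (K * L) D &
    forall x z y, y != 0 ->
      (forall i, \sum_l ev (x + (w i).1) (z + (w i).2) (P l) * (eta i * y) ^+ l = 0) ->
      ev x z D = 0].
Proof.
move=> inj_eta hsz hbz [l0 nz].
pose P' l := if P l == 0 then 1 else P l.
have P'nz l : P' l != 0 by rewrite /P'; case: ifP => // [_|->//]; rewrite oner_neq0.
have szP' l : (size (P' l) <= K.+1)%N by rewrite /P'; case: ifP => // _; rewrite size_poly1.
have bzP' l : bz K (P' l).
  by rewrite /P'; case: ifP => // _; apply: bzC; rewrite size_poly1.
pose M := \matrix_(i < L, l < L) (shiftp (w i) (P' l) * (eta i ^+ l)%:P%:P).
pose d l := (size (P' l)).-1.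
have szM i l : (size (M i l) <= (d l).+1)%N.
  rewrite mxE mulrC mul_polyC; apply: leq_trans (size_scale_leq _ _) _.
  by rewrite size_shift /d; case: (size _).
have [szD cD] := det_coef_top szM.
pose e l := (size (lead_coef (P' l))).-1.
pose M1 : 'M_L := \matrix_(i, j) (M i j)`_(d j).
have M1E i l : M1 i l = (lead_coef (P' l) \Po ('X + (w i).2%:P)) * (eta i ^+ l)%:P.
  by rewrite !mxE coefMC -lead_coef_shift lead_coefE size_shift.
have szM1 i l : (size (M1 i l) <= (e l).+1)%N.
  rewrite M1E mulrC mul_polyC; apply: leq_trans (size_scale_leq _ _) _.
  by rewrite size_comp_poly2 ?size_XaddC // /e; case: (size _).
have [_ cD1] := det_coef_top szM1.
have nzD1 : \det M1 != 0.
  apply: contra_eqN cD1 => /eqP ->; rewrite coef0 eq_sym.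
  have -> : \det (\matrix_(i, j) (M1 i j)`_(e j)) =
      \det (\matrix_(i < L, j < L) eta i ^+ j) * \prod_l lead_coef (lead_coef (P' l)).
    rewrite -[X in _ * X](_ : \det (diag_mx (\row_l lead_coef (lead_coef (P' l)))) = _); last first.
      by rewrite det_diag; apply: eq_bigr => l _; rewrite mxE.
    rewrite -det_mulmx; congr (\det _); apply/matrixP => i l.
    rewrite mul_mx_diag mxE M1E coefMC; apply/esym; rewrite !mxE mulrC; congr (_ * _).
    have := lead_coef_comp (lead_coef (P' l)) (q := 'X + (w i).2%:P).
    by rewrite size_XaddC lead_coefXaddC expr1n mulr1 => <- //; rewrite lead_coefE size_comp_poly2 ?size_XaddC.
  rewrite mulf_neq0 //; last by apply/prodf_neq0 => l _; rewrite !lead_coef_eq0.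
  rewrite det_vandermonde_cols; apply/prodf_neq0 => i _; apply/prodf_neq0 => j ij.
  by rewrite subr_eq0; apply: contraTneq ij => /inj_eta ->; rewrite ltnn.
exists (\det M).
  by apply: contraNneq nzD1 => h; rewrite -cD h coef0.
split.
- apply: leq_trans szD _; rewrite ltnS.
  rewrite -[X in (_ * X)%N]card_ord -sum1_card big_distrr /= leq_sum // => l _.
  by rewrite muln1 /d -ltnS; apply: leq_trans (szP' l); rewrite prednK // size_poly_gt0.
- apply: bz_det => i l; rewrite mxE -[K]addn0; apply: bzM; first exact: bz_shift.
  by apply: bzC; rewrite size_polyC; case: (_ == _).
move=> x z y y0 h; rewrite -det_map_mx; apply/eqP.
rewrite -det_tr; apply/det0P.
(* This kernel vector gives weight 0 to the substitutes 1 of the vanishing [P l]; it is nonzero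
   because [P l0] is. *)
exists (\row_l (if P l == 0 then 0 else y ^+ l)).
  apply/negP => /eqP/rowP/(_ l0); rewrite !mxE (negPf nz) => /eqP.
  by rewrite expf_eq0 (negPf y0) andbF.
apply/rowP => i; rewrite !mxE -[RHS](h i); apply: eq_bigr => l _.
rewrite !mxE rmorphM /= evC hornerC ev_shift exprMn /P'.
by case: eqP => [->|_]; rewrite ?rmorph0 ?mul0r //; ring.
Qed.
End Bivariate.

(** * Zero estimate *)

Lemma size_XaddC_exp (R : idomainType) (c : R) m : size (('X + c%:P) ^+ m) = m.+1.
Proof. by rewrite -[c]opprK polyCN size_exp_XsubC. Qed.

Lemma coef_XaddC_exp (R : idomainType) (c : R) m :
  (('X + c%:P) ^+ m)`_m = 1 /\ (('X + c%:P) ^+ m.+1)`_m = c *+ m.+1.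
Proof.
elim: m => [|m [IH1 IH2]]; first by rewrite expr0 expr1 coefC coefD coefX coefC /= add0r.
have E : (('X + c%:P) ^+ m.+1)`_m.+1 = 1.
  by rewrite exprS mulrDl coefD coefXM /= IH1 coefCM nth_default ?mulr0 ?addr0 // size_XaddC_exp.
by split=> //; rewrite exprS mulrDl coefD coefXM /= IH2 coefCM E mulr1 -mulrSr.
Qed.

Lemma idomain_nat_nonroot (R : idomainType) (p : {poly R}) :
  injective (fun i : nat => i%:R : R) -> p != 0 -> exists j : nat, p.[j%:R] != 0.
Proof.
move=> inj nz; have : ~~ all (root p) (mkseq (fun i => i%:R) (size p)).
  apply/negP => h; have := max_poly_roots nz h.
  by rewrite size_mkseq ltnn => H; suff /H : uniq (mkseq (fun i : nat => i%:R : R) (size p)) by []; apply: mkseq_uniq.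
by case/allPn => x /mapP[j _ ->] hx; exists j.
Qed.

Lemma poly_nat_nonroot (F : realFieldType) (p : {poly F}) :
  p != 0 -> exists j : nat, p.[j%:R] != 0.
Proof. by apply: idomain_nat_nonroot => i j /eqP; rewrite eqr_nat => /eqP. Qed.

Lemma poly_nat_eq0 (F : realFieldType) (p : {poly F}) :
  (forall j : nat, p.[j%:R] = 0) -> p = 0.
Proof.
by move=> h; apply/eqP/negP => /negP/poly_nat_nonroot[j]; rewrite h eqxx.
Qed.

(** * Translations that stabilise a bivariate polynomial *)

Section Stab.
Variable F : realFieldType.
Local Notation biv := {poly {poly F}}.

Lemma coef_shift_sub w (Q : biv) m : size Q = m.+2 ->
  (shiftp w Q)`_m = (Q`_m \Po ('X + w.2%:P)) +
     (m.+1%:R * w.1) *: (Q`_m.+1 \Po ('X + w.2%:P)).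
Proof.
move=> sQ; rewrite /shiftp /= coef_comp_poly size_map_inj_poly ?comp_poly0 ?sQ; [|exact: comp_XD_inj|by []].
rewrite 2!big_ord_recr /= big1 ?add0r => [|i _]; last first.
  by rewrite [X in _ * X]nth_default ?mulr0 // size_XaddC_exp.
rewrite !coef_map /= (coef_XaddC_exp _ m).1 (coef_XaddC_exp _ m).2 mulr1; congr (_ + _).
by rewrite mulrC -[in RHS]mul_polyC polyCM rmorph_nat mulr_natl.
Qed.

(* If a translation by [w] stabilises [Q] up to a constant, it shifts the quotient of the
   two top coefficients of [Q] by a multiple of [w.1]; iterating and interpolating makes
   this an identity in a continuous parameter [t]. *)
Lemma stab_slope (Q : biv) : (1 < size Q)%N ->
  exists z f : F, (lead_coef Q).[z] != 0 /\ forall w, shiftp w Q %= Q ->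
   forall t : F, (f - t * ((size Q).-1%:R * w.1) * (lead_coef Q).[z]) * (lead_coef Q).[z + t * w.2] =
      (lead_coef Q).[z] * (Q`_(size Q).-2).[z + t * w.2].
Proof.
move=> sQ; have [m sm] : exists m, size Q = m.+2 by exists (size Q).-2; lia.
have nzq : lead_coef Q != 0 by rewrite lead_coef_eq0 -size_poly_gt0 sm.
have [j0 hz] := poly_nat_nonroot nzq; set z := j0%:R in hz.
exists z, (Q`_m).[z]; split=> // w /Pdiv.CommonIdomain.eqpP [[c1 c2] /= /andP[n1 n2] E] t.
rewrite sm /=; set nu := m.+1%:R * w.1.
set f := Q`_m; set g := lead_coef Q.
have E1 : c1 * (g \Po ('X + w.2%:P)) = c2 * g.
  move/(congr1 (fun p : biv => p`_m.+1)): E; rewrite !coefZ.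
  by have := lead_coef_shift w Q; rewrite /g !lead_coefE size_shift sm /= => ->.
have E2 : c1 * ((f \Po ('X + w.2%:P)) + nu *: (g \Po ('X + w.2%:P))) = c2 * f.
  move/(congr1 (fun p : biv => p`_m)): E; rewrite !coefZ coef_shift_sub //.
  by rewrite /g lead_coefE sm.
have E3 : g * ((f \Po ('X + w.2%:P)) + nu *: (g \Po ('X + w.2%:P))) = f * (g \Po ('X + w.2%:P)).
  by apply: (mulfI n1); rewrite mulrCA E2 [RHS]mulrCA E1; ring.
pose sh j : {poly F} := 'X + (j%:R * w.2)%:P.
have E4 j : (f - (j%:R * nu) *: g) * (g \Po sh j) = g * (f \Po sh j).
  elim: j => [|j IH].
    by rewrite /sh !mul0r scale0r subr0 addr0 !comp_polyXr mulrC.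
  have shS p : p \Po ('X + w.2%:P) \Po sh j = p \Po sh j.+1.
    by rewrite -comp_polyA comp_polyD comp_polyX comp_polyC /sh -natr1 mulrDl mul1r polyCD addrA.
  have := congr1 (comp_poly (sh j)) E3.
  rewrite /= !comp_polyM comp_polyD comp_polyZ !shS => E5.
  have nzj : g \Po sh j != 0 by rewrite -size_poly_eq0 size_comp_poly2 ?size_XaddC // size_poly_eq0.
  apply: (mulfI nzj).
  rewrite mulrCA mulrA; transitivity (g * (f \Po sh j) * (g \Po sh j.+1) - (nu *: g) * (g \Po sh j) * (g \Po sh j.+1)).
    have -> : j.+1%:R * nu = j%:R * nu + nu by rewrite -natr1; ring.
    by rewrite -IH scalerDl; ring.
  rewrite -[g * _ * _]mulrA -E5 -!mul_polyC; ring.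
pose p : {poly F} := (f.[z]%:P - ((nu * g.[z])%:P * 'X)) * (g \Po (z%:P + w.2%:P * 'X)) - g.[z]%:P * (f \Po (z%:P + w.2%:P * 'X)).
have : p = 0.
  apply: poly_nat_eq0 => j; have := congr1 (horner^~ z) (E4 j).
  rewrite /p /= !(hornerM, hornerD, horner_comp, hornerX, hornerC, hornerZ, hornerN).
  rewrite [j%:R * w.2]mulrC [j%:R * nu]mulrC => <-; ring.
move/(congr1 (horner^~ t)).
rewrite /p /= !(hornerM, hornerD, horner_comp, hornerX, hornerC, hornerZ, hornerN) ?horner0.
move/eqP; rewrite subr_eq0 => /eqP; rewrite [w.2 * t]mulrC => <-; congr (_ * _); ring.
Qed.

(** [stab_slope] is applied to both vectors at parameters [t] for which [z + t * w.2] is the same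
    point. The right-hand sides then agree, which forces equal slopes [w.1 / w.2]; a stabilising
    vector with [w.2 = 0] is zero by comparing [t = 0] and [t = 1]. *)
Lemma stab_collinear (Q : biv) w w' : (1 < size Q)%N ->
  shiftp w Q %= Q -> shiftp w' Q %= Q -> w.1 * w'.2 = w'.1 * w.2.
Proof.
move=> sQ hw hw'; have [z [f [hz H]]] := stab_slope sQ.
have nn : (size Q).-1%:R != 0 :> F by rewrite pnatr_eq0; lia.
have V v : shiftp v Q %= Q -> v.2 = 0 -> v.1 = 0.
  move=> hv v0; have := H v hv 1; have := H v hv 0.
  rewrite v0 !mulr0 !mul0r subr0 addr0 mul1r => <- /(mulIf hz)/eqP.
  rewrite -subr_eq0 addrAC subrr add0r oppr_eq0 !mulf_eq0 (negPf hz) (negPf nn) orbF /=.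
  by move/eqP.
have [w0|w0] := eqVneq w.2 0; first by rewrite w0 (V w) // mul0r mulr0.
have [w0'|w0'] := eqVneq w'.2 0; first by rewrite w0' (V w') // mul0r mulr0.
have nzp : (lead_coef Q \Po ('X + z%:P)) * 'X != 0.
  rewrite mulf_neq0 ?polyX_eq0 // -size_poly_eq0 size_comp_poly2 ?size_XaddC //.
  by rewrite size_poly_eq0 lead_coef_eq0 -size_poly_gt0 ltnW.
have [j hj] := poly_nat_nonroot nzp; set s := j%:R in hj.
move: hj; rewrite hornerM horner_comp hornerD !hornerX hornerC mulf_eq0 negb_or addrC => /andP[hs s0].
have := H w hw (s / w.2); have := H w' hw' (s / w'.2).
rewrite !divfK // => <- /(mulIf hs) /(addrI f)/oppr_inj/(mulIf hz).
have E a b : b != 0 -> s / b * ((size Q).-1%:R * a) = (s * (size Q).-1%:R) * (a / b) by move=> ?; field.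
rewrite !E // => /(mulfI (mulf_neq0 s0 nn)) /eqP; rewrite eqr_div // => /eqP.
by move=> ->; rewrite mulrC.
Qed.
End Stab.

(** * Irreducible factors up to constants *)

Section Irreducible.
Variable R : idomainType.
Implicit Types p q Q : {poly R}.

(** Divisibility over a domain is pseudo-divisibility, up to a nonzero constant factor. For
    bivariate polynomials the constants are the polynomials in the inner variable, so irreducibility
    here is that over their fraction field. *)
Lemma irr_div p : (1 < size p)%N -> exists2 Q, irreducible_poly Q & Q %| p.
Proof.
move=> sp; pose P n := `[< exists q, [/\ q %| p, size q = n & (1 < n)%N] >].
have exP : exists n, P n by exists (size p); apply/asboolP; exists p; rewrite dvdpp.
case: (ex_minnP exP) => n /asboolP[Q [Qp sQ n1]] hmin.
exists Q => //; split; first by rewrite sQ.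
move=> q sq qQ; rewrite -dvdp_size_eqp // eqn_leq.
have nzQ : Q != 0 by rewrite -size_poly_gt0 sQ ltnW.
rewrite dvdp_leq //= sQ; apply: hmin; apply/asboolP; exists q; split=> //.
  exact: dvdp_trans qQ Qp.
have : q != 0 by apply: contraTneq qQ => ->; rewrite dvd0p.
by rewrite -size_poly_gt0; move: sq; case: (size q) => [|[]].
Qed.

Lemma irr_prime Q p : irreducible_poly Q -> ~~ (Q %| p) -> coprimep Q p.
Proof.
move=> iQ nQ; have [h|h] := irredp_XsubCP iQ (dvdp_gcdl Q p).
  by rewrite -gcdp_eqp1.
by case/negP: nQ; rewrite -(eqp_dvdl _ h) dvdp_gcdr.
Qed.

Lemma irr_dvd_eqp Q Q' : irreducible_poly Q -> irreducible_poly Q' ->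
  Q %| Q' -> Q %= Q'.
Proof. by move=> iQ iQ' h; apply: iQ' => //; have := iQ.1; case: (size Q) => [|[]]. Qed.

Definition irr_family p (s : seq {poly R}) :=
  (forall Q, Q \in s -> irreducible_poly Q /\ Q %| p) /\ pairwise (fun a b => ~~ (a %= b)) s.

(** Inequivalent irreducibles are coprime, so their product divides [p], and each of them has
    positive degree. *)
Lemma irr_family_size p s : p != 0 -> irr_family p s -> (size s < size p)%N.
Proof.
move=> nzp [h1 h2].
suff [h3 h4] : (size s < size (\prod_(Q <- s) Q)%R)%N /\ \prod_(Q <- s) Q %| p.
  by apply: leq_trans h3 _; apply: dvdp_leq.
elim: s h1 h2 => [|Q s IH] h1 /=.
  by rewrite big_nil size_poly1 dvd1p.
case/andP => hQ hs; have [IH1 IH2] := IH (fun q hq => h1 q (mem_behead (s := Q :: s) hq)) hs.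
have [iQ Qp] := h1 Q (mem_head _ _).
rewrite big_cons; split.
  have nz : \prod_(q <- s) q != 0 by rewrite -size_poly_gt0 (leq_ltn_trans _ IH1).
  rewrite size_mul ?(irredp_neq0 iQ) //.
  by have := iQ.1; move: IH1; set a := size _; set b := size _; lia.
rewrite Gauss_dvdp ?Qp //; rewrite big_seq.
elim/big_ind: _ => [|a b ha hb|q qs]; [exact: coprimep1|by rewrite coprimepMr ha|].
have [iq _] := h1 q (mem_behead (s := Q :: s) qs).
apply: irr_prime => //; apply/negP => /(irr_dvd_eqp iQ iq).
by apply/negP; apply: (allP hQ).
Qed.

Lemma irr_list p : p != 0 -> exists s, irr_family p s /\
  forall Q, irreducible_poly Q -> Q %| p -> exists2 Q', Q' \in s & Q %= Q'.
Proof.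
move=> nzp; pose P n := `[< exists s, irr_family p s /\ size s = n >].
have exP : exists n, P n by exists 0%N; apply/asboolP; exists [::].
have ubP n : P n -> (n <= size p)%N by case/asboolP => s [/(irr_family_size nzp)/ltnW hs <-].
case: (ex_maxnP exP ubP) => n /asboolP[s [fs sn]] hmax; exists s; split=> // Q iQ Qp.
have [/hasP[Q' Q's e]|/hasPn hn] := boolP (has (fun q => Q %= q) s); first by exists Q'.
have : P n.+1.
  apply/asboolP; exists (Q :: s); rewrite /= sn; split=> //; split; last first.
    by rewrite /= fs.2 andbT; apply/allP.
  by move=> q; rewrite inE => /orP[/eqP ->|/fs.1].
by move/hmax; rewrite ltnn.
Qed.
End Irreducible.

(** The class of the first element is split off; what remains has one class less, and the larger of
    the two candidate classes wins. *)
Lemma pigeonhole_class (T : eqType) (e : rel T) m (W : seq T) :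
  (forall x y z, e x y -> e x z -> e y z) -> (forall x, e x x) ->
  (forall s, subseq s W -> pairwise (fun a b => ~~ e a b) s -> (size s <= m)%N) ->
  W != [::] -> exists2 x, x \in W & (size W <= m * count (e x) W)%N.
Proof.
move=> etr erefl; elim: m W => [|m IH] [//|x W] hs _.
  by have := hs [:: x]; rewrite /= eqxx sub0seq => /(_ isT isT).
set W' := seq.filter (predC (e x)) W.
have sz : (size (x :: W) = count (e x) (x :: W) + size W')%N.
  by rewrite /= erefl /W' size_filter; have := count_predC (e x) W; lia.
have [W'0|W'n] := eqVneq W' [::].
  exists x; first exact: mem_head.
  by rewrite sz W'0 /= addn0 leq_pmull.
have [] := IH W' _ W'n.
  move=> s sW' ps; have := hs (x :: s); rewrite /= eqxx ltnS; apply.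
    exact: subseq_trans sW' (filter_subseq _ _).
  rewrite ps andbT; apply/allP => y ys; have := mem_subseq sW' ys.
  by rewrite mem_filter => /andP[].
move=> y yW' hy; have yW : y \in W by move: yW'; rewrite mem_filter => /andP[].
have le : (count (e y) W' <= count (e y) (x :: W))%N.
  by apply: leq_trans (leq_addl _ _); apply: leq_count_subseq (filter_subseq _ _).
have [lexy|] := leqP (count (e x) (x :: W)) (count (e y) (x :: W)).
  exists y; first by rewrite inE yW orbT.
  rewrite sz mulSn leq_add // (leq_trans hy) // leq_mul2l le orbT //.
move/ltnW => le2; exists x; first exact: mem_head.
by rewrite sz mulSn leq_add // (leq_trans hy) // leq_mul2l (leq_trans le) ?orbT.
Qed.

Section ZeroEstimate.
Variable F : realFieldType.
Local Notation biv := {poly {poly F}}.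

Lemma dvdp_natmul (Q D : biv) n : (0 < n)%N -> (Q %| D *+ n) = (Q %| D).
Proof.
move=> n0; rewrite -scaler_nat dvdpZr // -polyC_natr polyC_eq0 pnatr_eq0; lia.
Qed.

(** Factors are avoided one at a time by adding a multiple of some [D w]. A [q] that does not divide
    [Th] divides [Th + D w *+ n] for at most one [n]: two of them would make it divide [D w], hence
    [Th]. So a large multiple spoils nothing gained before. *)
Lemma avoid_irr (S : biv -> Prop) (T : eqType) (W : seq T) (D : T -> biv) (s : seq biv) :
  S 0 -> (forall a b n, S a -> S b -> S (a + b *+ n)) -> (forall w, w \in W -> S (D w)) ->
  (forall Q, Q \in s -> exists2 w, w \in W & ~~ (Q %| D w)) ->
  exists2 Th, S Th & forall Q, Q \in s -> ~~ (Q %| Th).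
Proof.
move=> S0 SD SW; elim: s => [|Q s IH] hs; first by exists 0.
have [Th STh hTh] := IH (fun q hq => hs q (mem_behead (s := Q :: s) hq)).
have [QT|QT] := boolP (Q %| Th); last first.
  by exists Th => // q; rewrite inE => /orP[/eqP ->|/hTh].
have [w wW Qw] := hs Q (mem_head _ _).
suff [N HN] : exists N, forall n q, (N <= n)%N -> q \in s -> ~~ (q %| Th + D w *+ n).
  exists (Th + D w *+ N.+1); first by apply: SD => //; apply: SW.
  move=> q; rewrite inE => /orP[/eqP ->|/HN]; last exact.
  by rewrite dvdp_addr // dvdp_natmul.
elim: s hTh {IH hs} => [|q s IHs] hTh; first by exists 0%N.
have [N HN] := IHs (fun a ha => hTh a (mem_behead (s := q :: s) ha)).
have [[n [Nn qn]]|hq] := EM (exists n, (N <= n)%N /\ q %| Th + D w *+ n); last first.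
  exists N => n a Nn; rewrite inE => /orP[/eqP ->|]; last exact: HN.
  by apply/negP => h; apply: hq; exists n.
exists n.+1 => k a nk; rewrite inE => /orP[/eqP ->|]; last by apply: HN; lia.
apply/negP => qk; have := dvdp_sub qk qn.
rewrite opprD addrACA subrr add0r -mulrnBr ?(ltnW nk) // dvdp_natmul ?subn_gt0 // => qD.
move: qn; rewrite dvdp_addl; last by case: (n) => [|n']; rewrite ?mulr0n ?dvdp0 ?dvdp_natmul.
by apply/negP; apply: hTh; rewrite mem_head.
Qed.

(** The Sylvester matrix has at most [2 * d] columns, and its entries have degree at most [d] in the
    inner variable. *)
Lemma size_resultant d (p q : biv) : (size p <= d.+1)%N -> (size q <= d.+1)%N ->
  bz d p -> bz d q -> (size (resultant p q) <= (2 * d * d).+1)%N.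
Proof.
move=> sp sq bp bq; have [] := @det_coef_top _ _ (Sylvester_mx p q) (fun=> d).
  move=> i j; rewrite Sylvester_mxE; case: (split i) => k /=; case: (k <= j)%N;
    rewrite ?mulr1n ?mulr0n ?size_poly0 //; (apply: bp || apply: bq).
move=> h _; apply: leq_trans h _; rewrite sum_nat_const card_ord ltnS.
by rewrite leq_mul // mul2n -addnn leq_add // -subn1 leq_subLR add1n.
Qed.

Lemma ev_eq0 (P : biv) : (forall x z, ev x z P = 0) -> P = 0.
Proof.
move=> h; apply/eqP/negP => /negP nz.
have inj : injective (fun i : nat => i%:R : {poly F}).
  by move=> i j; rewrite -!polyC_natr => /polyC_inj/eqP; rewrite eqr_nat => /eqP.
have [j] := idomain_nat_nonroot inj nz.
rewrite -polyC_natr => /poly_nat_nonroot[i].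
by have := h j%:R i%:R; rewrite /ev /= /horner_eval => ->; rewrite eqxx.
Qed.

Lemma ev_inj (P Q : biv) : (forall x z, ev x z P = ev x z Q) -> P = Q.
Proof.
move=> h; apply/eqP; rewrite -subr_eq0; apply/eqP/ev_eq0 => x z.
by have := h x z; rewrite /ev /= /horner_eval !(hornerD, hornerN) => ->; rewrite subrr.
Qed.

Lemma shiftpD w w' (P : biv) : shiftp w (shiftp w' P) = shiftp (w + w') P.
Proof. by apply: ev_inj => x z; rewrite !ev_shift /= !addrA. Qed.

Lemma shiftp0 (P : biv) : shiftp 0 P = P.
Proof. by apply: ev_inj => x z; rewrite !ev_shift /= !addr0. Qed.

Lemma dvdp_shift w (P Q : biv) : P %| Q -> shiftp w P %| shiftp w Q.
Proof.
case/Pdiv.WeakIdomain.dvdpP => -[c R] /= nzc E; apply/Pdiv.WeakIdomain.dvdpP.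
exists (c \Po ('X + w.2%:P), shiftp w R) => /=.
  by rewrite -size_poly_eq0 size_comp_poly2 ?size_XaddC // size_poly_eq0.
rewrite (_ : shiftp w R * shiftp w P = shiftp w (R * P)); last by rewrite rmorphM.
rewrite -E.
rewrite -!mul_polyC rmorphM; congr (_ * _).
by apply: ev_inj => x z; rewrite ev_shift !evC horner_comp hornerD hornerX hornerC.
Qed.

Lemma eqp_shift w (P Q : biv) : P %= Q -> shiftp w P %= shiftp w Q.
Proof. by case/andP => h1 h2; apply/andP; split; apply: dvdp_shift. Qed.

Lemma irr_shift w (Q : biv) : irreducible_poly Q -> irreducible_poly (shiftp w Q).
Proof.
move=> iQ; split; first by rewrite size_shift; exact: iQ.1.
move=> q sq /(dvdp_shift (- w)); rewrite shiftpD addNr shiftp0 => h.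
have := iQ.2 _ _ h; rewrite size_shift => /(_ sq)/(eqp_shift w).
by rewrite shiftpD subrr shiftp0.
Qed.

Lemma roots_le d (c : {poly F}) (U : seq (F * F)) : c != 0 -> (size c <= d.+1)%N ->
  uniq (map snd U) -> (forall u, u \in U -> c.[u.2] = 0) -> (size U <= d)%N.
Proof.
move=> nz sc un h; rewrite -ltnS; apply: leq_trans sc.
rewrite -(size_map snd); apply: max_poly_roots => //.
by apply/allP => _ /mapP[u uU ->]; apply/rootP/h.
Qed.

(* If all translates of [D] by [W] share an irreducible factor [Q], the translates of [Q]
   by [-W] divide [D], so [W] meets few classes modulo the stabiliser of [Q], which is
   collinear. Otherwise a combination of the translates is coprime to one of them, and the
   second coordinates of [U] are roots of the resultant. *)
Lemma zero_estimate d (D : biv) (W U : seq (F * F)) :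
  D != 0 -> (size D <= d.+1)%N -> bz d D -> uniq W -> uniq (map snd U) ->
  (forall w u, w \in W -> u \in U -> ev (u.1 + w.1) (u.2 + w.2) D = 0) ->
  (2 * d * d < size U)%N ->
  exists E : seq (F * F), [/\ subseq E W, (size W <= d * size E)%N &
    exists ab : F * F, ab != 0 /\ forall e e', e \in E -> e' \in E ->
      ab.1 * (e.1 - e'.1) + ab.2 * (e.2 - e'.2) = 0].
Proof.
move=> nzD sD bD uW uU van hU.
have [W0|Wn] := eqVneq W [::].
  exists [::]; rewrite W0; split=> //; exists (1, 0); split=> //.
  by rewrite xpair_eqE negb_and oner_neq0.
have [w0 w0W] : exists w0, w0 \in W by case: (W) Wn => // w ?; exists w; rewrite mem_head.
pose S (P : biv) : Prop := [/\ (size P <= d.+1)%N, bz d P & forall u, u \in U -> ev u.1 u.2 P = 0].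
have SW w : w \in W -> S (shiftp w D).
  move=> wW; split; rewrite ?size_shift //; first exact: bz_shift.
  by move=> u uU'; rewrite ev_shift van.
have dlt : (d < size U)%N by move: hU; case: (d) => // d'; lia.
have noconst (c : {poly F}) : c != 0 -> S c%:P -> False.
  move=> nzc [_ hc h]; suff : (size U <= d)%N by rewrite leqNgt dlt.
  apply: (roots_le nzc) => //; first by have := hc 0%N; rewrite coefC.
  by move=> u /h; rewrite evC.
have big P : P != 0 -> S P -> (1 < size P)%N.
  move=> nzP SP; rewrite ltnNge; apply/negP => /size1_polyC E; move: nzP SP; rewrite E polyC_eq0.
  exact: noconst.
set D1 := shiftp w0 D; have nzD1 : D1 != 0 by rewrite shift_eq0.
have SD1 := SW _ w0W; have sD1 := big _ nzD1 SD1.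
have [[Q [iQ hQ]]|none] := EM (exists Q, irreducible_poly Q /\ forall w, w \in W -> Q %| shiftp w D).
  have hQ' w : w \in W -> shiftp (- w) Q %| D.
    by move=> /hQ/(dvdp_shift (- w)); rewrite shiftpD addNr shiftp0.
  pose e w w' := shiftp (- w) Q %= shiftp (- w') Q.
  have [] := @pigeonhole_class _ e d W _ _ _ Wn.
  - by move=> x y z exy exz; apply: eqp_trans exz; rewrite eqp_sym.
  - by move=> x; apply: eqpxx.
  - move=> s sW ps; rewrite -(size_map (fun w => shiftp (- w) Q)) -ltnS.
    apply: leq_trans sD; apply: irr_family_size => //; split; last by rewrite pairwise_map.
    move=> _ /mapP[w ws ->]; split; first exact: irr_shift.
    by apply: hQ'; apply: (mem_subseq sW).
  move=> x xW hx; exists (seq.filter (e x) W); split; first exact: filter_subseq.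
    by rewrite size_filter.
  have sQ := iQ.1.
  (* Two points of one class give the same translate of [Q], so their difference stabilises [Q]. *)
  have st y : y \in seq.filter (e x) W -> shiftp (y - x) Q %= Q.
    rewrite mem_filter => /andP[/(eqp_shift y)]; rewrite !shiftpD subrr shiftp0 //.
  have [[y [yE nyx]]|all_x] := EM (exists y, y \in seq.filter (e x) W /\ y != x).
    exists ((y - x).2, - (y - x).1); split.
      apply: contra nyx; rewrite xpair_eqE oppr_eq0 /= !subr_eq0 => /andP[h2 h1].
      by rewrite [y]surjective_pairing [x]surjective_pairing xpair_eqE h1 h2.
    suff K a : a \in seq.filter (e x) W -> (y - x).2 * (a.1 - x.1) = (y - x).1 * (a.2 - x.2).
      by move=> a b /K ha /K hb /=; move: ha hb => /=; lra.
    by move=> /st ha; have := stab_collinear sQ ha (st _ yE) => /=; lra.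
  (* The class consists of [x] alone, and any line through [x] will do. *)
  exists (1, 0); split; first by rewrite xpair_eqE negb_and oner_neq0.
  have K a : a \in seq.filter (e x) W -> a = x.
    by move=> aE; apply/eqP/negP => /negP n; apply: all_x; exists a.
  by move=> a b /K -> /K ->; rewrite !subrr !mulr0 addr0.
have [s [[fs _] ls]] := irr_list nzD1.
have [] := @avoid_irr S _ W (fun w => shiftp w D) s.
- by split; [rewrite size_poly0|exact: bz0|move=> u _; rewrite rmorph0].
- move=> a b n [a1 a2 a3] [b1 b2 b3]; split.
  + apply: leq_trans (size_polyD _ _) _; rewrite geq_max a1 /=.
    by rewrite -scaler_nat; apply: leq_trans (size_scale_leq _ _) b1.
  + apply: bzD => //; elim: n => [|n IH]; first by rewrite mulr0n; exact: bz0.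
    by rewrite mulrS; apply: bzD.
  + by move=> u uU'; rewrite rmorphD rmorphMn /= a3 // b3 // mul0rn addr0.
- exact: SW.
- move=> Q Qs; apply: contrapT => h; apply: none; exists Q; split; first by case: (fs _ Qs).
  by move=> w wW; apply/negP => /negP hw; apply: h; exists w.
move=> Th STh hTh.
have nzTh : Th != 0.
  have [Q iQ QD1] := irr_div sD1; have [Q' Q's _] := ls _ iQ QD1.
  by apply: contraNneq (hTh _ Q's) => ->; rewrite dvdp0.
have sTh := big _ nzTh STh.
(* A common factor of positive degree would contain an irreducible factor of [D1], and [Th] avoids
   all of these. *)
have res0 : resultant D1 Th != 0.
  rewrite resultant_eq0 -leqNgt leqNgt; apply/negP => /irr_div[Q iQ].
  rewrite dvdp_gcd => /andP[/(ls _ iQ)[Q' Q's QQ']]; rewrite (eqp_dvdl _ QQ').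
  exact/negP/hTh.
have [uv _ Er] := resultant_in_ideal sD1 sTh.
case: SD1 STh => [a1 a2 a3] [b1 b2 b3].
have := roots_le res0 (size_resultant a1 b1 a2 b2) uU; rewrite leqNgt hU => H; exfalso.
suff : false by []; apply: H => u uU'.
by have := congr1 (ev u.1 u.2) Er; rewrite evC rmorphD !rmorphM /= a3 // b3 // !mulr0 addr0.
Qed.

End ZeroEstimate.

(** * Upper bound for interpolation determinants *)

Lemma rowsub_unit_free (F : fieldType) J q (M : 'M[F]_J) (f : 'I_q -> 'I_J) :
  M \in unitmx -> injective f -> \rank (rowsub f M) = q.
Proof.
move=> uM inj_f; have -> : rowsub f M = rowsub f 1%:M *m M.
  by apply/matrixP => i j; rewrite -[in LHS](mul1mx M) !mxE; apply: eq_bigr => k _; rewrite !mxE.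
rewrite mxrankMfree ?row_free_unit //; apply/eqP/row_freeP.
exists (rowsub f 1%:M)^T; apply/matrixP => i j; rewrite !mxE (bigD1 (f i)) //= !mxE eqxx mul1r.
rewrite big1 ?addr0 ?(inj_eq inj_f) 1?eq_sym // => k nk; rewrite !mxE eq_sym (negPf nk) mul0r //.
Qed.

Lemma sum_ltn_le J n : (\sum_(m < J) (m < n) <= n)%N.
Proof.
suff -> : (\sum_(m < J) (m < n) = minn J n)%N by apply: geq_minr.
by elim: J => [|J IH]; rewrite ?big_ord0 ?big_ord_recr /= ?IH; lia.
Qed.

Section Vanishing.
Variables (F : fieldType) (J D0 D1 : nat) (phi : 'M[F]_J) (y : 'I_J -> F).
Hypothesis dims : forall m, exists B : 'M[F]_(D0 + D1 * m, J),
  forall j n, (n <= m)%N -> ((\row_i (phi j i * y i ^+ n))%R <= B)%MS.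

(* At most [D0 + D1 * m] independent rows [phi_j y ^ n_j] have [n_j <= m], so [a]
   independent ones have total exponent at least [vanish_order a]. *)
Definition vanish_order a := (\sum_(m < J) (a - (D0 + D1 * m)))%N.

Lemma det_low_order (I : {set 'I_J}) (nn : 'I_J -> nat) (th : 'M[F]_J) :
  (\sum_(j in I) nn j < vanish_order #|I|)%N ->
  \det (\matrix_(j, i) (if j \in I then phi j i * y i ^+ nn j else th j i)) = 0.
Proof.
set M := \matrix_(j, i) _ => h; apply/eqP; apply: contraTT h => nz.
have uM : M \in unitmx by rewrite unitmxE unitfE.
have count m : (#|[set j in I | nn j <= m]| <= D0 + D1 * m)%N.
  set A := [set j in I | _]; have [B hB] := dims m.
  rewrite -(rowsub_unit_free uM (@enum_val_inj _ (mem A))).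
  apply: leq_trans (rank_leq_row B); apply: mxrankS; apply/row_subP => i.
  have := enum_valP i; rewrite inE => /andP[iI im].
  suff -> : row i (rowsub enum_val M) = \row_k (phi (enum_val i) k * y k ^+ nn (enum_val i)) by exact: hB.
  by apply/rowP => k; rewrite !mxE iI.
rewrite -leqNgt /vanish_order.
(* The exponents are summed by layers: at height [m], all but at most [D0 + D1 * m] indices of [I]
   have an exponent exceeding [m]. *)
apply: (@leq_trans (\sum_(j in I) \sum_(m < J) (m < nn j))%N); last first.
  by apply: leq_sum => j _; apply: sum_ltn_le.
rewrite exchange_big /=; apply: leq_sum => m _.
rewrite leq_subLR -sum1_card (bigID (fun j => nn j <= m)%N) /=; apply: leq_add.
  by apply: leq_trans (count m); rewrite -sum1_card; apply: eq_leq; apply: eq_bigl => j; rewrite inE.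
by rewrite big_mkcondr /=; apply: leq_sum => j _; rewrite -ltnNge; case: (m < _)%N.
Qed.

(** Expanding the power gives a sum over maps from [n] factors to rows. For a fixed map, the
    alternating sum over [s] is a determinant of the type in [det_low_order], whose row exponents
    are the sizes of the fibres and add up to at most [n]. *)
Lemma moments (l : 'I_J -> F) (I : {set 'I_J}) (th : 'M[F]_J) n : (n < vanish_order #|I|)%N ->
  \sum_(s : 'S_J) (-1) ^+ s * (\prod_j (phi j (s j) * (if j \in I then 1 else th j (s j)))) *
     (\sum_j l j * y (s j)) ^+ n = 0.
Proof.
move=> hn.
have E (s : 'S_J) : (\sum_j l j * y (s j)) ^+ n =
    \sum_(f : {ffun 'I_n -> 'I_J}) (\prod_k l (f k)) * \prod_j y (s j) ^+ #|[pred k | f k == j]|.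
  rewrite -[in LHS](card_ord n) -prodr_const bigA_distr_bigA /=; apply: eq_bigr => f _.
  rewrite big_split /=; congr (_ * _).
  rewrite (partition_big f predT) //=; apply: eq_bigr => j _.
  by rewrite -prodr_const; apply: eq_bigr => k /eqP ->.
under eq_bigr => s _ do rewrite E mulr_sumr.
rewrite exchange_big big1 //= => f _.
have := @det_low_order I (fun j => #|[pred k | f k == j]|)
  (\matrix_(j, i) (phi j i * th j i * y i ^+ #|[pred k | f k == j]|)).
have -> : (\sum_(j in I) #|[pred k | f k == j]| < vanish_order #|I|)%N.
  apply: leq_ltn_trans hn; apply: (@leq_trans (\sum_j #|[pred k | f k == j]|)%N).
    by rewrite [leqRHS](bigID (mem I)) /= leq_addr.
  rewrite -[leqRHS](card_ord n) -sum1_card (partition_big f predT) //=.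
  by apply: leq_sum => j _; rewrite sum1_card.
move=> /(_ isT) h; apply: etrans (mulr0 (\prod_k l (f k))); rewrite -[in RHS]h /determinant mulr_sumr.
apply: eq_bigr => s _; rewrite mulrCA mulrA -!mulrA; congr (_ * (_ * _)).
rewrite -big_split /=; apply: eq_bigr => j _; rewrite !mxE.
by case: (j \in I); ring.
Qed.
End Vanishing.

(** * Exponential sums with vanishing moments *)

Section ExpSums.
Import numFieldNormedType.Exports.
Local Open Scope classical_set_scope.
Local Open Scope ring_scope.
Variable R : realType.

(** From index [N] on, each term of the series is at most [rho ^- N] times the corresponding term of
    the series of [expR (rho * B)]. Combined with vanishing moments, this does the work of Schwarz's
    lemma without complex variables. *)
Lemma expR_tail (b B rho : R) N : 1 <= rho -> `|b| <= B ->
  `|expR b - \sum_(n < N) b ^+ n / n`!%:R| <= rho ^- N * expR (rho * B).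
Proof.
move=> r1 hb; have r0 : 0 < rho by lra.
have B0 : 0 <= B by apply: le_trans hb.
have Q M : `|series (exp_coeff b) (M + N)%N - \sum_(n < N) b ^+ n / n`!%:R| <= rho ^- N * expR (rho * B).
  rewrite /series /= (big_cat_nat (n := N)) //= ?leq_addl // big_mkord [_ + _ - _]addrAC subrr add0r.
  apply: le_trans (ler_norm_sum _ _ _) _.
  apply: (@le_trans _ _ (rho ^- N * \sum_(N <= i < M + N) exp_coeff (rho * B) i)).
    rewrite mulr_sumr !big_nat; apply: ler_sum => i /andP[Ni _].
    rewrite /exp_coeff /= normrM normfV [`|_%:R|]ger0_norm // exprMn normrX mulrA mulrA.
    rewrite ler_wpM2r ?invr_ge0 // -[leLHS]mul1r ler_pM // ?exprn_ge0 ?lerXn2r ?nnegrE //.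
    by rewrite -(subnK Ni) exprD mulrCA mulVf ?mulr1 ?expf_neq0 ?gt_eqF // exprn_ege1.
  rewrite ler_wpM2l ?invr_ge0 ?exprn_ge0 ?(ltW r0) //.
  apply: (@le_trans _ _ (series (exp_coeff (rho * B)) (M + N)%N)).
    rewrite /series /= [leRHS](big_cat_nat (n := N)) ?leq_addl //= lerDr sumr_ge0 // => i _.
    by apply: exp_coeff_ge0; apply: mulr_ge0 => //; apply: ltW.
  apply: nondecreasing_cvgn_le; last exact: is_cvg_series_exp_coeff.
  by apply: nondecreasing_series => i _ _; apply: exp_coeff_ge0; apply: mulr_ge0 => //; apply: ltW.

have C : (fun M => `|series (exp_coeff b) (M + N)%N - \sum_(n < N) b ^+ n / n`!%:R|) @ \oo
    --> `|expR b - \sum_(n < N) b ^+ n / n`!%:R|.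
  apply: cvg_norm; apply: cvgB; last exact: cvg_cst.
  by rewrite (cvg_shiftn N); apply: is_cvg_series_exp_coeff.
rewrite -(cvg_lim _ C) //; apply: limr_le; first by apply/cvg_ex; eexists; exact: C.
by apply: nearW => M; apply: Q.
Qed.

Lemma exp_sum_small (S : finType) (c b : S -> R) (B rho : R) N : 1 <= rho ->
  (forall s, `|b s| <= B) ->
  (forall n, (n < N)%N -> \sum_s c s * b s ^+ n = 0) ->
  `|\sum_s c s * expR (b s)| <= rho ^- N * expR (rho * B) * \sum_s `|c s|.
Proof.
move=> r1 hb hm.
have -> : \sum_s c s * expR (b s) = \sum_s c s * (expR (b s) - \sum_(n < N) b s ^+ n / n`!%:R).
  under [RHS]eq_bigr do rewrite mulrBr.
  rewrite sumrB [X in _ = _ - X](_ : _ = 0) ?subr0 //.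
  under eq_bigr do rewrite mulr_sumr.
  rewrite exchange_big big1 //= => n _.
  by under eq_bigr do rewrite mulrA; rewrite -mulr_suml hm ?mul0r.
apply: le_trans (ler_norm_sum _ _ _) _; rewrite mulr_sumr; apply: ler_sum => s _.
by rewrite normrM mulrC ler_wpM2r //; apply: expR_tail.
Qed.

End ExpSums.

(** Only the layers [m < n] contribute, so each row taken out of the set lowers the order by at most
    [n]. A factor [eta <= rho ^- n] from that row compensates for exactly this loss. *)
Lemma vanish_order_lip J D0 D1 n a : (J <= D0 + D1 * n)%N -> (a <= J)%N ->
  (vanish_order J D0 D1 J <= vanish_order J D0 D1 a + (J - a) * n)%N.
Proof.
move=> hn aJ; rewrite /vanish_order.
apply: (@leq_trans (\sum_(m < J) (a - (D0 + D1 * m)) + \sum_(m < J) (J - a) * (m < n))%N).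
  rewrite -big_split /=; apply: leq_sum => m _.
  have [mn|nm] := ltnP m n; first by rewrite muln1; lia.
  have : (D1 * n <= D1 * m)%N by rewrite leq_mul2l nm orbT.
  by rewrite muln0 addn0; lia.
by rewrite leq_add2l -big_distrr /= leq_mul2l sum_ltn_le orbT.
Qed.

(** The summands fall from [J - D0] to 0 in steps of [D1], and they cover a triangle of area
    [(J - D0) ^ 2 / (2 * D1)]. *)
Lemma vanish_order_ge J D0 D1 : (0 < D0)%N -> (0 < D1)%N -> ((J - D0) ^ 2 <= 2 * D1 * vanish_order J D0 D1 J)%N.
Proof.
move=> D00 D10; rewrite /vanish_order; set a := (J - D0)%N.
have S q : (D1 * q <= a + D1)%N -> (2 * \sum_(m < q) (a - D1 * m) + D1 * q * q >= 2 * a * q + D1 * q)%N.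
  elim: q => [|q IH] hq; first by rewrite big_ord0 !muln0.
  have hq' : (D1 * q <= a)%N by move: hq; rewrite mulnS addnC leq_add2r.
  rewrite big_ord_recr /= mulnDr; have := IH (leq_trans hq' (leq_addr _ _)).
  rewrite !mulnSr; move: hq'; set u := \sum_(m < q) _; set t := (D1 * q)%N => hq'.
  by rewrite mulnDl -/t; nia.
have [a0|a0] := posnP a; first by rewrite a0.
pose q := (a %/ D1).+1.
have qa : (D1 * (a %/ D1) <= a)%N by rewrite mulnC leq_trunc_div.
have qa2 : (a < D1 * q)%N by rewrite mulnC /q ltn_ceil.
have qJ : (q <= J)%N.
  by rewrite /q; apply: leq_ltn_trans (leq_div a D1) _; rewrite /a; lia.
have le : (\sum_(m < q) (a - D1 * m) <= \sum_(m < J) (J - (D0 + D1 * m)))%N.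
  rewrite -(big_mkord xpredT (fun m => (a - D1 * m)%N)) -(big_mkord xpredT (fun m => (J - (D0 + D1 * m))%N)).
  rewrite [leqRHS](big_cat_nat (n := q)) //=; apply: leq_trans (leq_addr _ _).
  by apply: leq_sum => m _; rewrite /a subnDA.
have hq : (D1 * q <= a + D1)%N by rewrite /q mulnS addnC leq_add2r.
have := S q hq; move: qa2 hq le; clear; clearbody a q; set u := \sum_(m < q) _; set v := \sum_(m < J) _ => h1 h2 h3 h4.
nia.
Qed.

Section DetBound.
Variables (R : realType) (J D0 D1 : nat) (phi : 'M[R]_J) (y l : 'I_J -> R).
Hypothesis dims : forall m, exists B : 'M[R]_(D0 + D1 * m, J),
  forall j n, (n <= m)%N -> ((\row_i (phi j i * y i ^+ n))%R <= B)%MS.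

(* Expand the product of the factors [1 + z] over the set [I] of rows where [1] is taken:
   the exponential sum attached to [I] vanishes to order [vanish_order #|I|], and each
   remaining row contributes a factor [eta]. *)
Lemma det_bound (z : 'M[R]_J) (Phi : 'I_J -> R) (rho eta B : R) (n : nat) :
  1 <= rho -> 0 <= eta -> eta <= rho ^- n -> (J <= D0 + D1 * n)%N ->
  (forall j i, `|phi j i| <= Phi j) ->
  (forall j i, `|z j i| <= eta) ->
  (forall s : 'S_J, `|\sum_j l j * y (s j)| <= B) ->
  `|\det (\matrix_(j, i) (phi j i * expR (l j * y i) * (1 + z j i)))| <=
    2 ^+ J * (J`!)%:R * (\prod_j Phi j) * rho ^- (vanish_order J D0 D1 J) * expR (rho * B).
Proof.
move=> r1 e0 en hJ hphi hz hB; have r0 : 0 < rho by lra.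
have Phi0 j : 0 <= Phi j by apply: le_trans (hphi j j).
pose c (I : {set 'I_J}) (s : 'S_J) : R :=
  (-1) ^+ s * \prod_j (phi j (s j) * (if j \in I then 1 else z j (s j))).
have -> : \det (\matrix_(j, i) (phi j i * expR (l j * y i) * (1 + z j i))) =
  \sum_(I : {set 'I_J}) \sum_(s : 'S_J) c I s * expR (\sum_j l j * y (s j)).
  rewrite exchange_big /=; apply: eq_bigr => s _.
  rewrite -mulr_suml -mulr_sumr -mulrA; congr (_ * _).
  under eq_bigr do rewrite mxE -mulrA mulrC -mulrA.
  rewrite expR_sum -[RHS]mulrC; rewrite big_split /=; congr (_ * _).
  under [RHS]eq_bigr do rewrite big_split /=.
  rewrite -mulr_sumr -bigA_distr -big_split /=.
  by apply: eq_bigr => j _; rewrite mulrC.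
apply: le_trans (ler_norm_sum _ _ _) _.
pose K := (J`!)%:R * (\prod_j Phi j) * rho ^- (vanish_order J D0 D1 J) * expR (rho * B).
apply: (@le_trans _ _ (\sum_(I : {set 'I_J}) K)); last first.
  have cS : #|{set 'I_J}| = (2 ^ J)%N by rewrite -cardsT -powersetT card_powerset cardsT card_ord.
  by rewrite sumr_const cS -[leLHS]mulr_natl natrX /K !mulrA.
apply: ler_sum => I _.
apply: le_trans (exp_sum_small (N := vanish_order J D0 D1 #|I|) r1 hB _) _.
  move=> m hm; rewrite -[RHS](moments dims l z hm).
  by apply: eq_bigr => s _; rewrite /c.
have hc s : `|c I s| <= (\prod_j Phi j) * eta ^+ (J - #|I|).
  rewrite /c normrM normr_sign mul1r normr_prod.
  apply: (@le_trans _ _ (\prod_j (Phi j * (if j \in I then 1 else eta)))).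
    apply: ler_prod => j _; rewrite normr_ge0 normrM /= ler_pM //.
    by case: (j \in I); rewrite ?normr1.
  rewrite big_split /= ler_wpM2l ?prodr_ge0 //.
  rewrite (bigID (mem I)) /= big1 ?mul1r => [|j -> //].
  rewrite (eq_bigr (fun=> eta)) => [|j /negPf -> //].
  have E : (J - #|I| = #|[predC I]|)%N.
    by apply/eqP; rewrite -(eqn_add2l #|I|) cardC card_ord subnKC // -[leqRHS](card_ord J) max_card.
  by rewrite prodr_const E.
have IJ : (#|I| <= J)%N by rewrite -[leqRHS](card_ord J) max_card.
apply: (@le_trans _ _ (rho ^- vanish_order J D0 D1 #|I| * expR (rho * B) *
     ((J`!)%:R * ((\prod_j Phi j) * eta ^+ (J - #|I|))))).
  rewrite ler_wpM2l ?mulr_ge0 ?invr_ge0 ?exprn_ge0 ?expR_ge0 ?(ltW r0) //.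
  apply: (@le_trans _ _ (\sum_(s : 'S_J) (\prod_j Phi j) * eta ^+ (J - #|I|))); first exact: ler_sum.
  by rewrite sumr_const -[X in _ *+ X]/#|'S_J| card_Sn mulr_natl.
have : rho ^- vanish_order J D0 D1 #|I| * eta ^+ (J - #|I|) <= rho ^- vanish_order J D0 D1 J.
  apply: (@le_trans _ _ (rho ^- vanish_order J D0 D1 #|I| * (rho ^- n) ^+ (J - #|I|))).
    by rewrite ler_wpM2l ?invr_ge0 ?exprn_ge0 ?(ltW r0) // lerXn2r ?nnegrE ?invr_ge0 ?exprn_ge0 ?(ltW r0).
  rewrite exprVn -exprM -invfM -exprD lef_pV2 ?posrE ?exprn_gt0 //.
  by rewrite ler_weXn2l // mulnC; apply: vanish_order_lip.
have P0 : 0 <= (J`!)%:R * (\prod_j Phi j) * expR (rho * B).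
  by rewrite !mulr_ge0 ?prodr_ge0 ?expR_ge0.
move/(ler_wpM2l P0); rewrite /K.
set a := rho ^- _; set b := rho ^- _; set e := eta ^+ _; set p := \prod_j _; set x := expR _.
move=> h; have -> : a * x * ((J`!)%:R * (p * e)) = (J`!)%:R * p * x * (a * e) by ring.
by apply: le_trans h _; rewrite [leLHS]mulrAC.
Qed.
End DetBound.

(** * The golden ratio and Liouville's inequality *)

Section Golden.
Variable R : realType.

Definition phi : R := (1 + Num.sqrt 5) / 2.
Definition psi : R := (1 - Num.sqrt 5) / 2.

Let s5 : Num.sqrt 5 ^+ 2 = 5 :> R. Proof. by rewrite sqr_sqrtr. Qed.

Lemma sqrt5_bounds : 2236 / 10 ^+ 3 <= Num.sqrt (5 : R) <= 2237 / 10 ^+ 3.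
Proof.
have s0 : 0 <= Num.sqrt 5 :> R by apply: sqrtr_ge0.
by move: s5; set s := Num.sqrt 5 in s0 *; rewrite expr2 => h; apply/andP; split; nra.
Qed.

Lemma phi_sqr : phi ^+ 2 = phi + 1.
Proof. by rewrite /phi; move: s5; set s := Num.sqrt 5; nra. Qed.

Lemma psi_sqr : psi ^+ 2 = psi + 1.
Proof. by rewrite /psi; move: s5; set s := Num.sqrt 5; nra. Qed.

Lemma phiMpsi : phi * psi = -1.
Proof. by rewrite /phi /psi; move: s5; set s := Num.sqrt 5; nra. Qed.

Lemma phiDpsi : phi + psi = 1.
Proof. by rewrite /phi /psi; lra. Qed.

Lemma phi_bounds : 1618 / 10 ^+ 3 <= phi <= 1619 / 10 ^+ 3.
Proof. by have := sqrt5_bounds; rewrite /phi; lra. Qed.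

Lemma phi_gt1 : 1 < phi.
Proof. by have := phi_bounds; lra. Qed.

Lemma psi_bounds : - (619 / 10 ^+ 3) <= psi <= - (618 / 10 ^+ 3).
Proof. by have := sqrt5_bounds; rewrite /psi; lra. Qed.

(** If [b] were nonzero, the 5-adic valuation would be even on the left and odd on the right. *)
Lemma sqr5_int (a b : int) : a ^+ 2 = 5 * b ^+ 2 -> b = 0.
Proof.
move=> h; apply/eqP; rewrite -absz_eq0; apply/eqP.
have {h} : (`|a| ^ 2 = 5 * `|b| ^ 2)%N by rewrite -!abszX h abszM.
have [->//|b0] := posnP `|b|%N => h.
have a0 : (0 < `|a|)%N by case: `|a|%N h => //; lia.
have := congr1 (logn 5) h; rewrite lognX lognM ?expn_gt0 ?b0 // lognX.
have -> : logn 5 5 = 1%N by [].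
lia.
Qed.

Definition evz (x : R) (P : {poly int}) : R := (map_poly intr P).[x].

Lemma evz_linear (P : {poly int}) : exists a b : int,
  evz phi P = a%:~R + b%:~R * phi /\ evz psi P = a%:~R + b%:~R * psi.
Proof.
rewrite /evz; elim/poly_ind: P => [|P c [a [b [h1 h2]]]].
  by exists 0, 0; rewrite rmorph0 !horner0; split; ring.
exists (b + c), (a + b).
have E (x a' b' c' : R) : x ^+ 2 = x + 1 -> (a' + b' * x) * x + c' = b' + c' + (a' + b') * x.
  move=> h; have -> : (a' + b' * x) * x + c' = a' * x + b' * x ^+ 2 + c' by ring.
  by rewrite h; ring.
rewrite rmorphD rmorphM /= map_polyX map_polyC /= !hornerMXaddC h1 h2 !intrD.
by split; apply: E; [exact: phi_sqr|exact: psi_sqr].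
Qed.

(** The product of the two conjugates is the norm a^2 + a b - b^2, an integer, which vanishes only
    for a = b = 0 because 5 is not a square. *)
Lemma liouville (P : {poly int}) : evz phi P != 0 -> 1 <= `|evz phi P| * `|evz psi P|.
Proof.
have [a [b [h1 h2]]] := evz_linear P; rewrite h1 h2 -normrM => nz.
have -> : (a%:~R + b%:~R * phi) * (a%:~R + b%:~R * psi) = (a ^+ 2 + a * b - b ^+ 2)%:~R :> R.
  rewrite intrB intrD intrM !rmorphXn /=; set a' := a%:~R; set b' := b%:~R.
  have -> : (a' + b' * phi) * (a' + b' * psi) = a' ^+ 2 + a' * b' * (phi + psi) + b' ^+ 2 * (phi * psi) by ring.
  by rewrite phiDpsi phiMpsi; ring.
rewrite -intr_norm -[1](_ : 1%:~R = 1) // ler_int.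
suff : a ^+ 2 + a * b - b ^+ 2 != 0 by rewrite -normr_gt0; lia.
apply: contraNneq nz => h.
have b0 : b = 0 by apply: (@sqr5_int (2 * a + b)); move: h; rewrite !expr2; lia.
have : a ^+ 2 = 0 by rewrite -h b0; ring.
move/eqP; rewrite sqrf_eq0 => /eqP a0.
by rewrite a0 b0 mul0r addr0.
Qed.
End Golden.

Section DetLe.
Variables (R : realFieldType) (J : nat).

Lemma det_le (M : 'M[R]_J) (B : 'I_J -> R) : (forall j i, `|M j i| <= B j) ->
  `|\det M| <= J`!%:R * \prod_j B j.
Proof.
move=> h; apply: le_trans (ler_norm_sum _ _ _) _.
apply: (@le_trans _ _ (\sum_(s : 'S_J) \prod_j B j)).
  apply: ler_sum => s _; rewrite normrM normr_sign mul1r normr_prod.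
  by apply: ler_prod => j _; rewrite normr_ge0 h.
by rewrite sumr_const -[X in _ *+ X]/#|'S_J| card_Sn mulr_natl.
Qed.

Lemma det_scale (M : 'M[R]_J) (a b : 'I_J -> R) :
  \det (\matrix_(j, i) (a j * b i * M j i)) = (\prod_j a j) * (\prod_i b i) * \det M.
Proof.
rewrite mulr_sumr; apply: eq_bigr => s _; rewrite mulrCA; congr (_ * _).
rewrite [X in _ * X * _](reindex_inj (@perm_inj _ s)) -!big_split /=.
by apply: eq_bigr => j _; rewrite mxE.
Qed.
End DetLe.

(** * The interpolation system of a linear form in three logarithms *)

Lemma fact_leX n : (n`! <= n ^ n)%N.
Proof.
elim: n => [|n IH] //; rewrite factS expnS leq_mul2l /=.
by apply: leq_trans IH _; case: n => // n; rewrite leq_exp2r.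
Qed.

Lemma ln_natr_ge0 (R : realType) n : 0 <= ln (n%:R : R).
Proof. by case: n => [|n]; [rewrite ln0|apply: ln_ge0; rewrite ler1n]. Qed.

Lemma select_unit (F : fieldType) (X : finType) (pt : eqType) (f : X -> pt -> F) (pts : seq pt) :
  (forall v : X -> F, (forall a, a \in pts -> \sum_x v x * f x a = 0) -> forall x, v x = 0) ->
  exists P : 'I_#|X| -> pt, (forall i, P i \in pts) /\
    \det (\matrix_(j, i) f (enum_val j) (P i)) != 0.
Proof.
move=> free; pose M := \matrix_(j < #|X|, i < size pts) f (enum_val j) (tnth (in_tuple pts) i).
have fM : row_full M^T.
  rewrite /row_full mxrank_tr; apply/inj_row_free => v vM.
  apply/rowP => j; rewrite mxE.
  have := free (fun x => v 0 (enum_rank x)) _ (enum_val j); rewrite enum_valK; apply.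
  move=> a /(nthP a)[i hi <-]; have := congr1 (fun w : 'rV_ _ => w 0 (Ordinal hi)) vM.
  rewrite !mxE => h; rewrite -[RHS]h (reindex (@enum_val X (mem X))) /=; last first.
    by apply: onW_bij; exact: enum_val_bij.
  by apply: eq_bigr => l _; rewrite !mxE enum_valK (tnth_nth a).
exists (fun i => tnth (in_tuple pts) (fullrankfun fM i)); split=> [i|]; first exact: mem_tnth.
have := fullrowsub_unit fM; rewrite unitmxE unitfE -det_tr.
apply: contraNN => /eqP h; apply/eqP; rewrite -[RHS]h; congr (\det _).
by apply/matrixP => i j; rewrite !mxE.
Qed.

(** The bookkeeping of the final contradiction. The three summands are the logarithms of the column
    factors with the denominator, of the bound for the centred determinant, and of the bound for its
    conjugate; [j] is the number of rows, [r] stands for L and [V] for the vanishing order. *)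
Lemma exponent_sum_lt0 (F : realFieldType) (j r c lam a0 lu D s V e : F) :
  0 <= j -> 0 <= c -> 0 <= lam -> c <= r / 2 -> lu * D = lu * (r * s) ->
  j * (1 + 2 * a0 + r / 2 * (5 * lam + 1) + e * (r / 8) * (3 * lam + 1)) + 2 * lu * r * s < 5 / 2 * V ->
  j * c * (3 * lam + 1 / 2) +
   (j + j * a0 + lu * D + - (5 / 2 * V) + e * (j * r / 4 * ((3 * lam + 1) / 2))) +
   (j * a0 + (lu * D + 2 * lam * (j * c))) < 0.
Proof.
move=> j0 c0 l0 cr sd num.
have h5 : j * c * (5 * lam + 1 / 2) <= j * (r / 2) * (5 * lam + 1).
  by apply: ler_pM; [rewrite mulr_ge0|lra|rewrite ler_wpM2l|lra].
lra.
Qed.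

Section Core.
Variables (R : realType) (g p q k N : nat).

Definition point := (nat * nat * nat)%type.
Definition u1 (a : point) : int := (a.1.1 + k * a.2)%N%:Z.
Definition u2 (a : point) : int := a.1.2%:Z - (N * a.2)%N%:Z.
Definition Yv (a : point) : R := phi R ^+ a.1.1 * g%:R ^+ a.1.2 * (p%:R / q%:R) ^+ a.2.
Definition y0 (a : point) : R := (u1 a)%:~R * ln (phi R) + (u2 a)%:~R * ln g%:R.
Definition Lam : R := k%:R * ln (phi R) - N%:R * ln g%:R - ln (p%:R / q%:R).

Lemma u1E a : (u1 a)%:~R = a.1.1%:R + k%:R * a.2%:R :> R.
Proof. by rewrite /u1 PoszD PoszM intrD intrM -!pmulrn. Qed.

Lemma u2E a : (u2 a)%:~R = a.1.2%:R - N%:R * a.2%:R :> R.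
Proof. by rewrite /u2 intrB PoszM intrM -!pmulrn. Qed.

Hypotheses (g0 : (0 < g)%N) (p0 : (0 < p)%N) (q0 : (0 < q)%N).

Lemma phi_gt0 : 0 < phi R. Proof. by have := phi_bounds R; lra. Qed.

Lemma ln_pq : ln (p%:R / q%:R) = ln p%:R - ln q%:R :> R.
Proof. by rewrite lnM ?posrE ?invr_gt0 ?ltr0n // lnV ?posrE ?ltr0n. Qed.

Lemma YvE a : Yv a = expR (y0 a - a.2%:R * Lam).
Proof.
have c0 : 0 < p%:R / q%:R :> R by rewrite divr_gt0 ?ltr0n.
have -> : y0 a - a.2%:R * Lam = ln (phi R) *+ a.1.1 + ln g%:R *+ a.1.2 + ln (p%:R / q%:R) *+ a.2.
  by rewrite /y0 u1E u2E /Lam -[ln (phi R) *+ _]mulr_natl -[ln g%:R *+ _]mulr_natl -[ln (p%:R / q%:R) *+ _]mulr_natl; ring.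
by rewrite -!lnXn ?ltr0n ?phi_gt0 // !expRD !lnK ?posrE ?exprn_gt0 ?ltr0n ?phi_gt0.
Qed.

Variables (L Rr S T : nat) (T0 : finType) (e1 e2 : T0 -> nat) (pts : seq point).
Variables (D1 n : nat) (lam lu a0 H : R).

(** The exponents stay abstract because the system is used twice: with all monomials of degree below
    K in [u1] and [u2], and with the powers of a single coordinate. *)
Definition mono (x : T0) (a : point) : R := (u1 a)%:~R ^+ e1 x * (u2 a)%:~R ^+ e2 x.

Hypothesis box : forall a, a \in pts -> [/\ a.1.1 <= Rr, a.1.2 <= S & a.2 <= T]%N.
Hypothesis dims : forall (yc : R) m, exists h : 'I_(#|T0| + D1 * m) -> point -> R,
  forall x i, (i <= m)%N -> exists c : 'I_(#|T0| + D1 * m) -> R,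
  forall a, a \in pts -> mono x a * (y0 a - yc) ^+ i = \sum_j c j * h j a.
Hypothesis free : forall v : T0 * 'I_L -> R,
  (forall a, a \in pts -> \sum_x v x * (mono x.1 a * Yv a ^+ x.2) = 0) -> forall x, v x = 0.

Hypotheses (hR : Rr%:R * ln (phi R) <= lam) (hS : S%:R * ln g%:R <= lam) (hT : T%:R * H <= lam).
Hypotheses (hp : ln p%:R <= H) (hq : ln q%:R <= H).
Hypothesis hu : forall a, a \in pts -> `|(u1 a)%:~R| <= expR lu /\ `|(u2 a)%:~R| <= expR lu.
Hypotheses (ha0 : (#|T0| * L)%:R <= expR a0) (D10 : (0 < D1)%N) (T00 : (0 < #|T0|)%N) (L0 : (0 < L)%N).
Hypotheses (hn : (#|T0| * L <= #|T0| + D1 * n)%N) (n0 : (0 < n)%N).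
Hypothesis hLam : 2 * L%:R * T%:R * `|Lam| <= expR (5 / 2) ^- n.
Hypothesis num : (#|T0| * L)%:R * (1 + 2 * a0 + L%:R / 2 * (5 * lam + 1) +
    expR (5 / 2) * (L%:R / 8) * (3 * lam + 1)) + 2 * lu * L%:R * (\sum_x (e1 x + e2 x))%:R <
  5 / 2 * (vanish_order (#|T0| * L) #|T0| D1 (#|T0| * L))%:R.

Let X := (T0 * 'I_L)%type.
Let J := #|{: X}|.
(** [lc] and [yc] are the centres of the exponents of Y and of the values of [y0] on the box, the
    latter rewritten by means of k A - N G = ln (p / q) + [Lam]. Centring halves both ranges, and
    since centred exponents add up to zero, [yc] cancels in the determinant. *)
Let lc : R := (L%:R - 1) / 2.
Let yc : R := (Rr%:R * ln (phi R) + S%:R * ln g%:R + T%:R * (ln (p%:R / q%:R) + Lam)) / 2.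

Lemma JE : J = (#|T0| * L)%N.
Proof. by rewrite /J card_prod card_ord. Qed.

Lemma TLam : T%:R * `|Lam| <= 1 / 2.
Proof.
have L1 : 1 <= L%:R :> R by rewrite ler1n.
have e1' : expR (5 / 2) ^- n <= 1 :> R.
  rewrite invf_le1 ?exprn_gt0 ?expR_gt0 // exprn_ege1 //.
  by apply: le_trans (expR_ge1Dx _); lra.
have : 0 <= T%:R * `|Lam| by rewrite mulr_ge0.
by have := le_trans hLam e1'; nra.
Qed.

Lemma y0_centered a : a \in pts -> `|y0 a - yc| <= (3 * lam + 1) / 2.
Proof.
case/box => h1 h2 h3.
have -> : y0 a - yc = (a.1.1%:R - Rr%:R / 2) * ln (phi R) + (a.1.2%:R - S%:R / 2) * ln g%:R
    + (a.2%:R - T%:R / 2) * (ln (p%:R / q%:R) + Lam).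
  by rewrite /y0 u1E u2E /yc /Lam; field.
have B (x : nat) (m : nat) : (x <= m)%N -> `|x%:R - m%:R / 2| <= m%:R / 2 :> R.
  by move=> h; rewrite ler_norml; have : x%:R <= m%:R :> R by [rewrite ler_nat]; have : 0 <= x%:R :> R by []; lra.
have A0 : 0 <= ln (phi R) by apply: ln_ge0; have := phi_bounds R; lra.
have G0 := ln_natr_ge0 R g; have P0 := ln_natr_ge0 R p; have Q0 := ln_natr_ge0 R q.
have c1 : `|ln (p%:R / q%:R) + Lam| <= H + `|Lam|.
  apply: le_trans (ler_normD _ _) _; rewrite lerD2r ln_pq.
  by rewrite ler_norml; move: hp hq P0 Q0 => *; apply/andP; split; lra.
have := TLam; have t0 : 0 <= T%:R :> R by [].
have := B _ _ h1; have := B _ _ h2; have := B _ _ h3.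
move=> b3 b2 b1 tl.
apply: le_trans (ler_normD _ _) _; apply: (@le_trans _ _ (Rr%:R / 2 * ln (phi R) + S%:R / 2 * ln g%:R + T%:R / 2 * (H + `|Lam|))); last by move: hR hS hT tl => *; lra.
apply: lerD; last by rewrite normrM ler_pM.
apply: le_trans (ler_normD _ _) _; apply: lerD; rewrite normrM [`|ln _|]ger0_norm // ler_wpM2r //.
Qed.

(** The induction goes in steps of two: without its two extreme terms, a centred range of length
    [m.+2] is the centred range of length [m]. *)
Lemma sum_centered_abs m : \sum_(l < m) `|l%:R - (m%:R - 1) / 2| <= m%:R ^+ 2 / 4 :> R.
Proof.
suff : \sum_(l < m) `|l%:R - (m%:R - 1) / 2| <= m%:R ^+ 2 / 4 :> R /\
   \sum_(l < m.+1) `|l%:R - (m.+1%:R - 1) / 2| <= m.+1%:R ^+ 2 / 4 :> R by case.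
elim: m => [|m [IH1 IH2]].
  by rewrite big_ord0 big_ord_recl big_ord0 /= !(expr0n, mul0r, expr1n) subrr mul0r subrr normr0; split; lra.
have S2 : m.+2%:R = m%:R + 2 :> R by rewrite -!natr1; ring.
split=> //; rewrite big_ord_recl big_ord_recr [nat_of_ord ord0]/=.
have E : \sum_(i < m) `|(lift ord0 i)%:R - (m.+2%:R - 1) / 2| = \sum_(l < m) `|l%:R - (m%:R - 1) / 2| :> R.
  by apply: eq_bigr => i _; rewrite lift0 S2 -natr1; congr (`|_|); field.
rewrite E lift0 S2 -[(nat_of_ord ord_max).+1%:R]natr1 /=.
have m0 : 0 <= m%:R :> R by [].
rewrite ler0_norm ?ger0_norm; [move: IH1; rewrite !expr2; nra|lra|lra].
Qed.

Lemma sum_centered0 m : \sum_(l < m) (l%:R - (m%:R - 1) / 2) = 0 :> R.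
Proof.
rewrite sumrB sumr_const card_ord -mulr_natl; apply/eqP; rewrite subr_eq0; apply/eqP.
elim: m => [|m IH]; first by rewrite big_ord0 mul0r.
by rewrite big_ord_recr /= IH -natr1; field.
Qed.

Lemma expR_sub1 (x : R) : `|x| <= 1 / 2 -> `|expR x - 1| <= 2 * `|x|.
Proof.
move=> hx; have h1 := expR_ge1Dx x; have h2 := expR_ge1Dx (- x); have h3 := expRxMexpNx_1 x.
have [x0|x0] := leP 0 x; last first.
  have h4 : expR x <= 1 by rewrite expR_le1 ltW.
  by rewrite (ltr0_norm x0) ler0_norm; lra.
move: hx; rewrite (ger0_norm x0) ger0_norm; last lra.
move=> hx; have := expR_gt0 x; move: h1 h2 h3; set e := expR x; set f := expR (- x); nra.
Qed.

Let ll (j : 'I_J) : R := ((enum_val j).2 : nat)%:R - lc.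
Let deg (j : 'I_J) : nat := (e1 (enum_val j).1 + e2 (enum_val j).1)%N.

Lemma sum_enum (V : zmodType) (F : X -> V) : \sum_(j < J) F (enum_val j) = \sum_x \sum_l F (x, l).
Proof. by rewrite pair_bigA /= -(big_enum_val F) /=; apply: eq_big => [x|[] //]; rewrite ?inE. Qed.

Lemma sum_ll : \sum_j ll j = 0.
Proof.
rewrite (sum_enum (fun x : X => (x.2 : nat)%:R - lc)) big1 //= => x _.
exact: sum_centered0.
Qed.

Lemma sum_l : \sum_(j < J) ((enum_val j).2 : nat)%:R = J%:R * lc :> R.
Proof.
have := sum_ll; rewrite sumrB sumr_const card_ord mulr_natl => /eqP.
by rewrite subr_eq0 => /eqP.
Qed.

Lemma sum_abs_ll : \sum_j `|ll j| <= J%:R * L%:R / 4.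
Proof.
rewrite (sum_enum (fun x : X => `|(x.2 : nat)%:R - lc|)) /=.
apply: (@le_trans _ _ (\sum_(x : T0) L%:R ^+ 2 / 4)).
  by apply: ler_sum => x _; exact: sum_centered_abs.
by rewrite sumr_const -mulr_natl JE natrM; lra.
Qed.

Lemma sum_deg : (\sum_j deg j)%:R = L%:R * (\sum_x (e1 x + e2 x))%:R :> R.
Proof.
rewrite /deg natr_sum (sum_enum (fun x : X => (e1 x.1 + e2 x.1)%:R)) /=.
rewrite natr_sum mulr_sumr; apply: eq_bigr => x _.
by rewrite sumr_const card_ord mulr_natl.
Qed.

Lemma mono_le a j : a \in pts -> `|mono (enum_val j : X).1 a| <= expR (lu * (deg j)%:R).
Proof.
move=> /hu[h1 h2]; rewrite normrM !normrX /deg expRM_natr exprD.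
by rewrite ler_pM ?exprn_ge0 // lerXn2r ?nnegrE ?expR_ge0.
Qed.

Lemma lam_ge0 : 0 <= lam. Proof. by apply: le_trans hS; rewrite mulr_ge0 ?ln_natr_ge0. Qed.

Lemma base_le a : a \in pts ->
  (g ^ a.1.2 * p ^ a.2 * q ^ (T - a.2))%:R <= expR (2 * lam).
Proof.
case/box => h1 h2 h3; have l0 := lam_ge0.
have ->: 2 * lam = lam + lam by ring.
rewrite -mulnA natrM expRD ler_pM //.
  rewrite natrX -[g%:R]lnK ?posrE ?ltr0n // -expRM_natl ler_expR.
  by apply: le_trans hS; rewrite ler_wpM2r ?ln_natr_ge0 ?ler_nat.
rewrite natrM !natrX -[p%:R]lnK ?posrE ?ltr0n // -[q%:R]lnK ?posrE ?ltr0n //.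
rewrite -!expRM_natl -expRD ler_expR; apply: le_trans hT.
rewrite -(subnK h3) natrD addnK mulrDl addrC.
by apply: lerD; apply: ler_wpM2l.
Qed.

(** With l = [ll] + [lc], the power Y^l splits into a row factor [expR (ll * yc)], a column factor
    [expR (lc * y0)], the centred exponential and a factor near 1 coming from [Lam]. The row factors
    multiply to 1, the column factors are kept for later, and [det_bound] treats the rest. *)
Lemma upper (P : 'I_J -> point) : (forall i, P i \in pts) ->
  `|\det (\matrix_(j, i) (mono (enum_val j : X).1 (P i) * Yv (P i) ^+ (enum_val j : X).2))| <=
  (\prod_i expR (lc * y0 (P i))) * (2 ^+ J * (J`!)%:R * expR (lu * (\sum_j deg j)%:R) *
    expR (5 / 2) ^- (vanish_order J #|T0| D1 J) * expR (expR (5 / 2) * (J%:R * L%:R / 4 * ((3 * lam + 1) / 2)))).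
Proof.
move=> Ppts.
pose z : 'M[R]_J := \matrix_(j, i) (expR (- (((enum_val j : X).2 : nat)%:R * (P i).2%:R * Lam)) - 1).
pose ph : 'M[R]_J := \matrix_(j, i) mono (enum_val j : X).1 (P i).
pose yy i := y0 (P i) - yc.
have -> : \matrix_(j, i) (mono (enum_val j : X).1 (P i) * Yv (P i) ^+ (enum_val j : X).2) =
  \matrix_(j, i) (expR (ll j * yc) * expR (lc * y0 (P i)) *
     (\matrix_(j, i) (ph j i * expR (ll j * yy i) * (1 + z j i))) j i).
  apply/matrixP => j i; rewrite !mxE [1 + _]addrC subrK YvE -expRM_natl.
  set m := mono _ _; rewrite [RHS](_ : _ = m * (expR (ll j * yc) * expR (lc * y0 (P i)) * expR (ll j * yy i) *
     expR (- (((enum_val j : X).2 : nat)%:R * (P i).2%:R * Lam)))); last by ring.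
  by rewrite -!expRD; congr (_ * expR _); rewrite /ll /yy; ring.
rewrite det_scale !normrM.
have -> : \prod_j expR (ll j * yc) = 1 :> R.
  by rewrite -expR_sum -mulr_suml sum_ll mul0r expR0.
rewrite normr1 mul1r ger0_norm; last by apply: prodr_ge0 => i _; apply: expR_ge0.
apply: ler_wpM2l; first by apply: prodr_ge0 => i _; apply: expR_ge0.
have dims' m : exists B : 'M[R]_(#|T0| + D1 * m, J),
  forall j i, (i <= m)%N -> ((\row_a (ph j a * yy a ^+ i))%R <= B)%MS.
  have [h hh] := dims yc m; exists (\matrix_(b, i) h b (P i)) => j i im.
  have [c hc] := hh (enum_val j : X).1 i im.
  apply/submxP; exists (\row_b c b); apply/rowP => a; rewrite !mxE hc //.
  by apply: eq_bigr => b _; rewrite !mxE.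
have -> : lu * (\sum_j deg j)%:R = \sum_j lu * (deg j)%:R by rewrite natr_sum mulr_sumr.
rewrite expR_sum.
have rho1 : 1 <= expR (5 / 2) :> R by apply: le_trans (expR_ge1Dx _); lra.
have LT0 : 0 <= 2 * L%:R * T%:R * `|Lam| by rewrite !mulr_ge0.
apply: (det_bound dims' (z := z) (eta := 2 * L%:R * T%:R * `|Lam|) (n := n)) => //.
- by rewrite JE.
- by move=> j i; rewrite mxE; apply: mono_le.
- move=> j i; rewrite mxE.
  have e1' : expR (5 / 2) ^- n <= 1 :> R by rewrite invf_le1 ?exprn_gt0 ?expR_gt0 // exprn_ege1.
  have hx : `|- (((enum_val j : X).2 : nat)%:R * (P i).2%:R * Lam)| <= L%:R * T%:R * `|Lam|.
    rewrite normrN !normrM !normr_nat ler_wpM2r // ler_pM // ler_nat; first exact: ltnW.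
    by case: (box (Ppts i)).
  apply: le_trans (expR_sub1 _) _; first by have := le_trans hLam e1'; lra.
  lra.
- move=> s; apply: le_trans (ler_norm_sum _ _ _) _.
  apply: (@le_trans _ _ (\sum_j `|ll j| * ((3 * lam + 1) / 2))).
    by apply: ler_sum => j _; rewrite normrM ler_wpM2l //; apply: y0_centered.
  rewrite -mulr_suml ler_wpM2r ?sum_abs_ll //.
  by have := lam_ge0; lra.
Qed.

(* Multiplying the rows of [Y ^ l] by [q ^ (T * l)] turns the determinant into the value at [phi] of
   a polynomial with integer coefficients. *)
Lemma lower (P : 'I_J -> point) : (forall i, P i \in pts) ->
  \det (\matrix_(j, i) (mono (enum_val j : X).1 (P i) * Yv (P i) ^+ (enum_val j : X).2)) != 0 ->
  1 <= expR (T%:R * ln q%:R * (J%:R * lc)) *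
   `|\det (\matrix_(j, i) (mono (enum_val j : X).1 (P i) * Yv (P i) ^+ (enum_val j : X).2))| *
   ((J`!)%:R * expR (lu * (\sum_j deg j)%:R + 2 * lam * (J%:R * lc))).
Proof.
move=> Ppts nz.
pose ent (j i : 'I_J) : int * nat :=
  ((u1 (P i)) ^+ e1 (enum_val j : X).1 * (u2 (P i)) ^+ e2 (enum_val j : X).1 *
   ((g ^ (P i).1.2 * p ^ (P i).2 * q ^ (T - (P i).2)) ^ (enum_val j : X).2)%N%:Z,
   ((P i).1.1 * (enum_val j : X).2)%N).
pose PM := \matrix_(j, i) ((ent j i).1%:P * 'X^((ent j i).2)).
have ev x : evz x (\det PM) = \det (\matrix_(j, i) ((ent j i).1%:~R * x ^+ (ent j i).2)) :> R.
  rewrite /evz -[(map_poly _ _).[x]]/((horner_eval x \o map_poly intr) _) -det_map_mx; congr (\det _).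
  apply/matrixP => j i; rewrite !mxE /= /horner_eval rmorphM /= map_polyC map_polyXn /=.
  by rewrite hornerM hornerC hornerXn.
have E : \det (\matrix_(j, i) ((ent j i).1%:~R * phi R ^+ (ent j i).2)) =
  expR (T%:R * ln q%:R * (J%:R * lc)) *
   \det (\matrix_(j, i) (mono (enum_val j : X).1 (P i) * Yv (P i) ^+ (enum_val j : X).2)).
  have -> : expR (T%:R * ln q%:R * (J%:R * lc)) =
      (\prod_(j < J) expR (T%:R * ln q%:R * ((enum_val j : X).2 : nat)%:R)) * \prod_(i < J) 1.
    by rewrite big1_eq mulr1 -sum_l mulr_sumr expR_sum.
  rewrite -det_scale.
  congr (\det _); apply/matrixP => j i; rewrite !mxE mulr1 /ent /= !intrM !rmorphXn /= /mono.
  rewrite -pmulrn expRM_natr expRM_natl lnK ?posrE ?ltr0n //.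
  rewrite [RHS]mulrCA -mulrA; congr (_ * _).
  rewrite exprM -!exprMn; congr (_ ^+ _).
  have q0' : q%:R != 0 :> R by rewrite pnatr_eq0 -lt0n.
  have [_ _ tT] := box (Ppts i).
  rewrite -[in RHS](subnK tT) exprD /Yv [(p%:R / q%:R) ^+ _]expr_div_n !natrM !natrX.
  have := expf_neq0 (P i).2 q0'.
  set Q1 := q%:R ^+ (T - _); set Q2 := q%:R ^+ _; set P2 := p%:R ^+ _; set G2 := g%:R ^+ _.
  by set F2 := phi R ^+ _ => Q20; field.
have nzE : evz (phi R) (\det PM) != 0 by rewrite ev E mulf_neq0 ?expR_eq0 // gt_eqF ?expR_gt0.
have := liouville nzE; rewrite ev E normrM [`|expR _|]ger0_norm ?expR_ge0 // => h.
apply: le_trans h _; apply: ler_wpM2l; first by rewrite mulr_ge0 ?expR_ge0.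
have -> : lu * (\sum_j deg j)%:R + 2 * lam * (J%:R * lc) =
    \sum_(j < J) (lu * (deg j)%:R + 2 * lam * ((enum_val j : X).2 : nat)%:R).
  by rewrite [RHS]big_split /=; congr (_ + _); [rewrite natr_sum mulr_sumr|rewrite -sum_l mulr_sumr].
rewrite ev expR_sum.
(* Conjugation only replaces [phi] by [psi], of absolute value at most 1, so the integer
   coefficients alone bound the entries of the conjugate matrix. *)
apply: det_le => j i; rewrite mxE /ent /= normrM -[leRHS]mulr1; apply: ler_pM => //; last first.
  rewrite normrX exprn_ile1 // ler_norml; have := psi_bounds R; lra.
rewrite expRD intrM normrM; apply: ler_pM => //.
  by rewrite intrM !rmorphXn; apply: mono_le.
by rewrite -pmulrn ger0_norm // natrX expRM_natr lerXn2r ?nnegrE ?expR_ge0 //; apply: base_le.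
Qed.

Lemma lc_le : lc <= L%:R / 2. Proof. by rewrite /lc; lra. Qed.

Theorem no_interpolation_system : False.
Proof.
have [P [Ppts nz]] := select_unit free.
have lc0 : 0 <= lc by rewrite /lc divr_ge0 // subr_ge0 ler1n.
have := lower Ppts nz; have := upper Ppts.
set W := `|_|; have hW : 0 <= W by apply: normr_ge0.
set E0 := \prod_i _.
(* The column factors are paired with the denominators: T ln q + y0 = r A + s G + t ln p + (T - t)
   ln q + t [Lam], where the first two terms are at most [lam], the next two together as well, and
   the last is at most 1/2. *)
have hE0 : expR (T%:R * ln q%:R * (J%:R * lc)) * E0 <= expR (J%:R * lc * (3 * lam + 1 / 2)).
  rewrite /E0 -expR_sum -expRD ler_expR.
  apply: (@le_trans _ _ (\sum_(i < J) lc * (T%:R * ln q%:R + y0 (P i)))).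
    by rewrite -!mulr_sumr [X in _ <= lc * X]big_split /= sumr_const card_ord -[_ *+ J]mulr_natl; lra.
  apply: (@le_trans _ _ (\sum_(i < J) lc * (3 * lam + 1 / 2))); last first.
    by rewrite sumr_const card_ord -[leLHS]mulr_natl mulrA.
  apply: ler_sum => i _; apply: ler_wpM2l => //; have [h1 h2 h3] := box (Ppts i).
  have -> : y0 (P i) = (P i).1.1%:R * ln (phi R) + (P i).1.2%:R * ln g%:R + (P i).2%:R * (ln p%:R - ln q%:R) + (P i).2%:R * Lam.
    by rewrite /y0 u1E u2E /Lam ln_pq; ring.
  have A0 : 0 <= ln (phi R) by apply: ln_ge0; have := phi_bounds R; lra.
  have b1 : (P i).1.1%:R * ln (phi R) <= lam by apply: le_trans hR; rewrite ler_wpM2r ?ler_nat.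
  have b2 : (P i).1.2%:R * ln g%:R <= lam by apply: le_trans hS; rewrite ler_wpM2r ?ler_nat // ln_natr_ge0.
  have b3 : (P i).2%:R * Lam <= 1 / 2.
    apply: le_trans TLam; apply: le_trans (ler_norm _) _; rewrite normrM ger0_norm // ler_wpM2r ?ler_nat //.
  have t0 : 0 <= (P i).2%:R :> R by []; have tT : (P i).2%:R <= T%:R :> R by rewrite ler_nat.
  have := hT; move: b1 b2 b3; have := hp; have := hq; nra.
move=> up low.
have J0 : 0 <= J%:R :> R by [].
have hJ : (J`!)%:R <= expR (J%:R * a0).
  apply: (@le_trans _ _ ((J ^ J)%N%:R)); first by rewrite ler_nat fact_leX.
  by rewrite natrX expRM_natl lerXn2r ?nnegrE ?expR_ge0 // {1}JE.
have h2 : (2 : R) ^+ J <= expR (J%:R : R).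
  rewrite (_ : expR (J%:R : R) = expR 1 ^+ J); last by rewrite -expRM_natr mul1r.
  by rewrite lerXn2r ?nnegrE ?expR_ge0 //; apply: le_trans (expR_ge1Dx _); rewrite -natr1.
have h3 : expR (5 / 2 : R) ^- vanish_order J #|T0| D1 J = expR (- (5 / 2 * (vanish_order J #|T0| D1 J)%:R)).
  by rewrite expRN expRM_natr.
have num' := num; have sd : lu * (\sum_j deg j)%:R = lu * (L%:R * (\sum_x (e1 x + e2 x))%:R) by rewrite sum_deg.
rewrite -JE in num'; rewrite h3 in up.
set V := (vanish_order _ _ _ _)%:R in num' up; set D := (\sum_j deg j)%:R in sd low up.
set Q := T%:R * ln q%:R * (J%:R * lc) in hE0 low.
suff : expR Q * W * (J`!%:R * expR (lu * D + 2 * lam * (J%:R * lc))) < 1 by rewrite ltNge low.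
apply: le_lt_trans (_ : _ <= expR (J%:R * lc * (3 * lam + 1 / 2)) * (expR (J%:R : R) * expR (J%:R * a0) * expR (lu * D) *
     expR (- (5 / 2 * V)) * expR (expR (5 / 2) * (J%:R * L%:R / 4 * ((3 * lam + 1) / 2)))) *
     (expR (J%:R * a0) * expR (lu * D + 2 * lam * (J%:R * lc)))) _.
  apply: ler_pM; rewrite ?mulr_ge0 ?expR_ge0 //; last by rewrite ler_wpM2r ?expR_ge0.
  apply: le_trans (ler_wpM2l (expR_ge0 _) up) _.
  rewrite (mulrA (expR Q)); apply: ler_pM => //; rewrite ?mulr_ge0 ?expR_ge0 ?exprn_ge0 //.
    by apply: prodr_ge0 => i _; apply: expR_ge0.
  do 3! (rewrite ler_wpM2r ?expR_ge0 //).
  by rewrite ler_pM ?exprn_ge0.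
rewrite -!expRD expR_lt1; exact: exponent_sum_lt0 (lam_ge0) lc_le sd num'.
Qed.
End Core.

(** * Multiplicative independence of [phi] and [g] *)

Section Independence.
Variable R : realType.

(** Writing the power as c + d [phi], rationality forces d = 0 since the square root of 5 is
    irrational. Then [psi ^+ n] equals [phi ^+ n], although one is at most 1 in absolute value and
    the other exceeds 1 when n > 0. *)
Lemma phi_rational_pow n (a b : nat) : (0 < b)%N -> phi R ^+ n * b%:R = a%:R -> n = 0%N.
Proof.
move=> b0 h; have [c [d [h1 h2]]] := evz_linear R 'X^n.
have E x : evz x 'X^n = x ^+ n :> R by rewrite /evz map_polyXn hornerXn.
rewrite !E in h1 h2.
have h3 : (b%:Z * d)%:~R * Num.sqrt 5 = (2 * (a%:Z - b%:Z * c) - b%:Z * d)%:~R :> R.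
  by rewrite !(intrB, intrM) -!pmulrn -h h1 /phi; field.
have : (2 * (a%:Z - b%:Z * c) - b%:Z * d) ^+ 2 = 5 * (b%:Z * d) ^+ 2.
  apply/eqP; rewrite -(eqr_int R) rmorphXn /= -h3 exprMn sqr_sqrtr // mulrC.
  by rewrite [in X in _ == X]intrM rmorphXn.
move/sqr5_int/eqP; rewrite mulf_eq0 => /orP[/eqP|/eqP d0]; first by lia.
apply/eqP; apply: contraT; rewrite -lt0n => n0.
have phi1 := phi_gt1 R.
have : 1 < phi R ^+ n by rewrite exprn_egt1 -?lt0n.
have : `|psi R ^+ n| <= 1.
  by rewrite normrX exprn_ile1 // ler_norml; have := psi_bounds R; clear; lra.
by rewrite h1 h2 d0 !mul0r !addr0 ler_norml; clear; lra.
Qed.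

Lemma ln_phi_gt0 : 0 < ln (phi R).
Proof. by apply: ln_gt0; have := phi_bounds R; lra. Qed.

Lemma phi_g_indep g (x z : int) : (1 < g)%N ->
  x%:~R * ln (phi R) + z%:~R * ln g%:R = 0 -> x = 0 /\ z = 0.
Proof.
move=> g1 h; have A0 := ln_phi_gt0.
have G0 : 0 < ln g%:R :> R by rewrite ln_gt0 // ltr1n.
have h' : `|x|%N%:R * ln (phi R) = `|z|%N%:R * ln g%:R :> R.
  move/eqP: h; rewrite addr_eq0 => /eqP /(congr1 Num.norm).
  by rewrite normrN !normrM (gtr0_norm A0) (gtr0_norm G0) -!intr_norm -!abszE -!pmulrn.
have x0 : `|x|%N = 0%N.
  apply: (@phi_rational_pow _ (g ^ `|z|)%N 1) => //.
  rewrite mulr1 natrX -[phi R]lnK ?posrE ?phi_gt0 // -[g%:R]lnK ?posrE ?ltr0n ?(ltnW g1) //.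
  by rewrite -!expRM_natl h'.
move: h'; rewrite x0 mul0r => /esym/eqP; rewrite mulf_eq0 (gt_eqF G0) orbF pnatr_eq0 => z0.
by split; [apply/eqP; rewrite -absz_eq0 x0|apply/eqP; rewrite -absz_eq0].
Qed.
End Independence.

(** * Boxes of points and the arithmetic of the parameters *)

Definition padd (a b : point) : point := ((a.1.1 + b.1.1, a.1.2 + b.1.2), a.2 + b.2)%N.
Definition inbox r s t (a : point) := [&& (a.1.1 < r)%N, (a.1.2 < s)%N & (a.2 < t)%N].
Definition boxl r s t : seq point :=
  [seq (xy, z) | xy <- [seq (x, y) | x <- iota 0 r, y <- iota 0 s], z <- iota 0 t].

Lemma mem_boxl r s t a : (a \in boxl r s t) = inbox r s t a.
Proof.
apply/allpairsP/idP => [[[xy z] /= [/allpairsP[[x y] /= [hx hy ->]] hz ->]]|].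
  by move: hx hy hz; rewrite !mem_iota /inbox /= => -> -> ->.
case/and3P => h1 h2 h3; exists (a.1, a.2); rewrite mem_iota h3; split=> //; last by case: a {h1 h2 h3}.
by apply/allpairsP; exists (a.1.1, a.1.2); rewrite !mem_iota h1 h2; split=> //; case: (a.1).
Qed.

Lemma uniq_boxl r s t : uniq (boxl r s t).
Proof.
apply: allpairs_uniq; rewrite ?iota_uniq //; last by move=> [a b] [c d] _ _ [-> ->].
by apply: allpairs_uniq; rewrite ?iota_uniq // => -[a b] [c d] _ _ [-> ->].
Qed.

Lemma size_boxl r s t : size (boxl r s t) = (r * s * t)%N.
Proof. by rewrite !size_allpairs !size_iota. Qed.

(** Dividing by [D0] leaves a condition free of [D0], [D1], [E] and [V]. The hypotheses on [D1] and
    [E] hold for the monomials of degree below K, with [D0] about K^2 / 2 and [D1 = K], and for the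
    powers of one coordinate, with [D0 = K] and [D1 = 1]; so both systems share one numerical
    condition. *)
Lemma vanish_order_balance (F : realFieldType) (D0 D1 K L E V : nat) (lu a0 lam e : F) :
  (K * D1 <= 2 * D0)%N -> (3 * E <= 2 * K * D0)%N -> (0 < D0)%N -> (0 < L)%N -> 0 <= lu ->
  ((D0 * L - D0) ^ 2 <= 2 * D1 * V)%N ->
  L%:R * (1 + 2 * a0 + L%:R / 2 * (5 * lam + 1) + e * (L%:R / 8) * (3 * lam + 1))
     + 4 / 3 * lu * L%:R * K%:R < 5 / 8 * K%:R * (L%:R - 1) ^+ 2 ->
  (D0 * L)%:R * (1 + 2 * a0 + L%:R / 2 * (5 * lam + 1) + e * (L%:R / 8) * (3 * lam + 1))
     + 2 * lu * L%:R * E%:R < 5 / 2 * V%:R.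
Proof.
move=> h1 h2 d0 l0 u0 h3 num.
have h4 : K%:R * D0%:R * (L%:R - 1) ^+ 2 <= 4 * V%:R :> F.
  have : (K * (D0 * L - D0) ^ 2 <= 4 * D0 * V)%N.
    apply: (@leq_trans (K * (2 * D1 * V))%N); first by rewrite leq_mul2l h3 orbT.
    by have : (K * D1 * (2 * V) <= 2 * D0 * (2 * V))%N by [rewrite leq_mul2r h1 orbT]; lia.
  have -> : (D0 * L - D0 = D0 * (L - 1))%N by rewrite mulnBr muln1.
  rewrite -(ler_nat F) natrM natrX !natrM natrB // => h.
  have d0' : 0 < D0%:R :> F by rewrite ltr0n.
  rewrite -(ler_pM2l d0'); move: h; rewrite !expr2; lra.
have h5 : 3 * E%:R <= 2 * K%:R * D0%:R :> F by rewrite -!natrM ler_nat.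
have h6 : lu * L%:R * (3 * E%:R) <= lu * L%:R * (2 * K%:R * D0%:R) by rewrite ler_wpM2l // mulr_ge0.
have d0' : 0 < D0%:R :> F by rewrite ltr0n.
move: num; rewrite -(ltr_pM2l d0') natrM; move: h4 h6.
set x := 1 + _ + _ + _; rewrite !expr2; lra.
Qed.

Lemma sum_ord_le m : (3 * \sum_(i < m) i <= 2 * m * m)%N.
Proof. by elim: m => [|m IH]; [rewrite big_ord0|rewrite big_ord_recr /= mulnDr (leq_trans (leq_add IH (leqnn _))) //; nia]. Qed.

Lemma box_arith a b c r : (a < r -> b < r -> a + (b + (r - c)) < 4 * r)%N.
Proof. lia. Qed.

Lemma box_arith2 a b c d : (a < b -> d < c * b -> d + a < c.+1 * b)%N.
Proof. by move=> h1 h2; rewrite mulSn addnC -addSn leq_add // ltnW. Qed.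

Lemma box_arith3 d r s t : (d ^ 2 < r * s * t -> 2 * d * d < 2 * r * (3 * s) * (3 * t))%N.
Proof. rewrite expnS expn1; nia. Qed.

Lemma K_arith1 m : (0 < m -> m * m.+1 <= 2 * m ^ 2)%N.
Proof. rewrite expnS expn1; nia. Qed.

Lemma K_arith2 m l c : (0 < m -> 2 * c = m * m.+1 -> c * l <= c + m * (m * l))%N.
Proof. nia. Qed.

Lemma sum_succ m : (2 * \sum_(d < m) d.+1 = m * m.+1)%N.
Proof. by elim: m => [|m IH]; rewrite ?big_ord0 // big_ord_recr /= mulnDr IH; lia. Qed.

Lemma sum_mul_succ m : (3 * (\sum_(d < m) d * d.+1) + m.+1 * m = m * m.+1 * m)%N.
Proof.
elim: m => [|m IH]; first by rewrite big_ord0.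
by rewrite big_ord_recr /= mulnDr; move: IH; set S := (\sum_(i < m) _)%N; nia.
Qed.

Lemma ev_lin (F : realFieldType) (a b x z : F) : ev x z ((a *: 'X)%:P - (b%:P)%:P * 'X) = a * z - b * x.
Proof. by rewrite /ev /= /horner_eval !(hornerD, hornerN, hornerM, hornerX, hornerC, hornerZ). Qed.

(** * Linear independence of the functions on a box *)

Section Params.
Variables (R : realType) (g p q k N K L R0 S0 T0 : nat) (lam lu a0 H : R).
Hypotheses (g1 : (1 < g)%N) (p0 : (0 < p)%N) (q0 : (0 < q)%N).
Local Notation u1 := (u1 k).
Local Notation u2 := (u2 N).
Local Notation y0 := (y0 R g k N).
Local Notation Yv := (Yv R g p q).

Lemma u1D a b : u1 (padd a b) = u1 a + u1 b.
Proof. by rewrite /u1 /=; lia. Qed.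
Lemma u2D a b : u2 (padd a b) = u2 a + u2 b.
Proof. by rewrite /u2 /=; lia. Qed.
Lemma y0D a b : y0 (padd a b) = y0 a + y0 b.
Proof. by rewrite /y0 u1D u2D !intrD; ring. Qed.
Lemma YvD a b : Yv (padd a b) = Yv a * Yv b.
Proof. by rewrite /Yv /= !exprD; ring. Qed.

Lemma Yv_gt0 a : 0 < Yv a.
Proof. by rewrite (YvE R k N (ltnW g1) p0 q0) expR_gt0. Qed.

(** Independence of [phi] and [g] makes [u1] and [u2] agree. As r < k, the number r + k t determines
    r and t as remainder and quotient by k. *)
Lemma y0_inj a b : (a.1.1 < k)%N -> (b.1.1 < k)%N -> y0 a = y0 b -> a = b.
Proof.
move=> ha hb /eqP; rewrite -subr_eq0 /LucasRepdigits.y0 => /eqP h.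
have [] := @phi_g_indep R g (u1 a - u1 b) (u2 a - u2 b) g1; first by rewrite (rmorphB _ (u1 a)) (rmorphB _ (u2 a)); apply: etrans h; ring.
rewrite /u1 /u2 => h1 h2.
have ht : a.2 = b.2.
  case: (ltngtP a.2 b.2) => // lt; exfalso.
    have : (k * a.2.+1 <= k * b.2)%N by rewrite leq_mul2l lt orbT.
    by rewrite mulnS; lia.
  have : (k * b.2.+1 <= k * a.2)%N by rewrite leq_mul2l lt orbT.
  by rewrite mulnS; lia.
have hr : a.1.1 = b.1.1 by rewrite ht in h1; lia.
have hs : a.1.2 = b.1.2 by rewrite ht in h2; lia.
by case: a b hr hs ht {ha hb h h1 h2} => [[? ?] ?] [[? ?] ?] /= -> -> ->.
Qed.

(** The third coordinates must agree beforehand, since [p / q] may well be dependent on [phi] and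
    [g]. *)
Lemma Yv_inj a b : a.2 = b.2 -> Yv a = Yv b -> a = b.
Proof.
move=> ht; rewrite /Yv ht => /mulIf h.
have {}h := h (expf_neq0 _ (_ : p%:R / q%:R != 0)); rewrite gt_eqF ?divr_gt0 ?ltr0n // in h.
have {}h := h isT.
have G0 : 0 < g%:R :> R by rewrite ltr0n ltnW.
have [] := @phi_g_indep R g (a.1.1%:Z - b.1.1%:Z) (a.1.2%:Z - b.1.2%:Z) g1.
  have E m n : ln (phi R ^+ m * g%:R ^+ n) = m%:R * ln (phi R) + n%:R * ln g%:R :> R.
    rewrite lnM ?posrE ?exprn_gt0 ?phi_gt0 // lnXn ?phi_gt0 // (lnXn n G0).
    by rewrite -[ln (phi R) *+ _]mulr_natl -[ln g%:R *+ _]mulr_natl.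
  by have := congr1 (@ln R) h; rewrite !E !intrB -!pmulrn; lra.
move=> h1 h2; have hr : a.1.1 = b.1.1 by lia.
have hs : a.1.2 = b.1.2 by lia.
by case: a b hr hs ht {h h1 h2} => [[? ?] ?] [[? ?] ?] /= -> -> ->.
Qed.

Hypotheses (hR : (4 * R0)%:R * ln (phi R) <= lam) (hS : (4 * S0)%:R * ln g%:R <= lam) (hT : (4 * T0)%:R * H <= lam).
Hypotheses (hp : ln p%:R <= H) (hq : ln q%:R <= H) (hk : (4 * R0 <= k)%N).
Hypotheses (hu1 : (4 * R0 + k * (4 * T0))%:R <= expR lu) (hu2 : (4 * S0 + N * (4 * T0))%:R <= expR lu).
Hypotheses (ha0 : (K ^ 2 * L)%:R <= expR a0) (lu0 : 0 <= lu).
Hypotheses (hL : (0 < L)%N) (hLR : (L <= R0)%N) (hTK : (T0 < K)%N) (hbox : (((K - 1) * L) ^ 2 < R0 * S0 * T0)%N).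
Hypothesis hLam : 2 * L%:R * (4 * T0)%:R * `|Lam R g p q k N| <= expR (5 / 2) ^- (K * L).
Hypothesis numK : L%:R * (1 + 2 * a0 + L%:R / 2 * (5 * lam + 1) + expR (5 / 2) * (L%:R / 8) * (3 * lam + 1))
     + 4 / 3 * lu * L%:R * K%:R < 5 / 8 * K%:R * (L%:R - 1) ^+ 2.

Lemma hu_box a : inbox (4 * R0) (4 * S0) (4 * T0) a ->
  `|(u1 a)%:~R| <= expR lu /\ `|(u2 a)%:~R| <= expR lu.
Proof.
case/and3P => h1 h2 h3; split.
  apply: le_trans hu1; rewrite u1E ger0_norm ?addr_ge0 ?mulr_ge0 // natrD (natrM _ k).
  by rewrite lerD ?ler_nat 1?ltnW // ler_wpM2l // ler_nat ltnW.
apply: le_trans hu2; rewrite u2E natrD (natrM _ N).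
apply: le_trans (ler_normB _ _) _; rewrite normrM !normr_nat.
by rewrite lerD ?ler_nat 1?ltnW // ler_wpM2l // ler_nat ltnW.
Qed.

Lemma affine_span (x : point -> R) (pts : seq point) m (mu nu : R) (kap i : nat) :
  (kap + i < m)%N -> (forall a, a \in pts -> y0 a = mu * x a + nu) -> forall yc,
  exists c : 'I_m -> R, forall a, a \in pts ->
    x a ^+ kap * (y0 a - yc) ^+ i = \sum_j c j * x a ^+ j.
Proof.
move=> hm haff yc; pose P : {poly R} := 'X^kap * (mu *: 'X + (nu - yc)%:P) ^+ i.
exists (fun j => P`_j) => a /haff ->.
have -> : x a ^+ kap * (mu * x a + nu - yc) ^+ i = P.[x a].
  by rewrite /P hornerM hornerXn horner_exp hornerD hornerZ hornerX hornerC addrA.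
apply: horner_coef_wide; rewrite /P; apply: leq_trans hm.
set Q := _ + _; have sQ : (size Q <= 2)%N.
  apply: leq_trans (size_polyD _ _) _; rewrite geq_max (leq_trans (size_scale_leq _ _)) ?size_polyX //=.
  by rewrite size_polyC; case: (_ == _).
apply: leq_trans (size_polyMleq _ _) _; rewrite size_polyXn addSn /= -addnS leq_add2l.
apply: leq_trans (size_poly_exp_leq _ _) _; rewrite ltnS -[leqRHS]mul1n leq_mul2r.
by rewrite -subn1 leq_subLR addn1 sQ orbT.
Qed.

(** By [Yv_inj], points with the same value of Y differ in the third coordinate, so no value is
    taken more than [T0] times. *)
Lemma distinct_values (E : seq point) : uniq E -> (forall a, a \in E -> (a.2 < T0)%N) ->
  (T0 * L < size E)%N -> exists s : seq point, [/\ {subset s <= E}, size s = L & uniq (map Yv s)].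
Proof.
move=> uE hE hs.
have [e0 e0E] : exists e0, e0 \in E by case: E {uE hE} hs => // e E _; exists e; rewrite mem_head.
have L1 : (L <= size (undup (map Yv E)))%N.
  rewrite leqNgt; apply/negP => lt.
  have Enil : E != [::] by apply: contraTneq e0E => ->.
  have [] := @pigeonhole_class _ (fun a b => Yv a == Yv b) (size (undup (map Yv E))) E _ _ _ Enil.
  - by move=> a b c /eqP -> .
  - by move=> a.
  - move=> s sE ps; rewrite -(size_map Yv); apply: uniq_leq_size.
      by rewrite uniq_pairwise pairwise_map.
    by move=> y /mapP[a /(mem_subseq sE) aE ->]; rewrite mem_undup map_f.
  move=> a aE; set c := count _ _ => hc.
  have c1 : (c <= T0)%N.
    rewrite /c -size_filter -(size_map (fun b : point => b.2)) -[leqRHS](size_iota 0).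
    apply: uniq_leq_size.
      rewrite map_inj_in_uniq ?filter_uniq // => b d; rewrite !mem_filter => /andP[/eqP hb _] /andP[/eqP hd _] e.
      by apply: Yv_inj => //; rewrite -hb -hd.
    by move=> t /mapP[b]; rewrite mem_filter mem_iota => /andP[_ /hE lt'] ->.
  have := leq_trans hs (leq_trans hc (leq_mul (ltnW lt) c1)).
  by rewrite mulnC ltnn.
pose pre y := nth e0 E (index y (map Yv E)).
have preE y : y \in map Yv E -> Yv (pre y) = y.
  by move=> yE; rewrite /pre -(nth_map e0 (Yv e0) Yv) ?nth_index // -(size_map Yv) index_mem.
exists (map pre (take L (undup (map Yv E)))); split.
- move=> a /mapP[y /mem_take]; rewrite mem_undup => yE ->.
  by rewrite mem_nth // -(size_map Yv) index_mem.
- by rewrite size_map size_takel.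
rewrite -map_comp (eq_in_map _ id _).1 ?map_id ?take_uniq ?undup_uniq // => y /mem_take.
by rewrite mem_undup => /preE.
Qed.

Lemma no_good_box (T : finType) (e1 e2 : T -> nat) (D1 : nat) (pts : seq point) :
  (0 < #|T|)%N -> (#|T| <= K ^ 2)%N -> (0 < D1)%N -> (K * D1 <= 2 * #|T|)%N ->
  (#|T| * L <= #|T| + D1 * (K * L))%N -> (3 * \sum_x (e1 x + e2 x) <= 2 * K * #|T|)%N ->
  (forall a, a \in pts -> inbox (4 * R0) (4 * S0) (4 * T0) a) ->
  (forall (yc : R) m, exists h : 'I_(#|T| + D1 * m) -> point -> R,
    forall x i, (i <= m)%N -> exists c : 'I_(#|T| + D1 * m) -> R,
    forall a, a \in pts -> mono R k N e1 e2 x a * (y0 a - yc) ^+ i = \sum_j c j * h j a) ->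
  (forall v : T * 'I_L -> R,
    (forall a, a \in pts -> \sum_x v x * (mono R k N e1 e2 x.1 a * Yv a ^+ x.2) = 0) ->
    forall x, v x = 0) -> False.
Proof.
move=> T1 TK D10 h1 h2 h3 hpts dims free.
have bx a : a \in pts -> [/\ a.1.1 <= 4 * R0, a.1.2 <= 4 * S0 & a.2 <= 4 * T0]%N.
  by move=> /hpts/and3P[? ? ?]; split; apply: ltnW.
apply: (no_interpolation_system (ltnW g1) p0 q0 bx dims free hR hS hT hp hq (fun a ha => hu_box (hpts a ha)) _ hL h2 hLam).
  by apply: le_trans ha0; rewrite ler_nat leq_mul2r TK orbT.
exact: vanish_order_balance h1 h3 T1 hL lu0 (vanish_order_ge _ T1 D10) numK.
Qed.

(* On a set where [y0] is affine in [x], powers of [x] suffice: the same argument runs on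
   sums of two points of [E], and the Casoratian is then a polynomial in one variable with
   a root at each point of [E]. *)
Lemma no_affine_box_points (E : seq point) (b : bool) (mu nu : R) :
  uniq E -> (forall a, a \in E -> inbox R0 S0 T0 a) -> ((K - 1) * L < size E)%N ->
  (forall a, a \in E -> y0 a = mu * (if b then u1 a else u2 a)%:~R + nu) -> False.
Proof.
move=> uE hE hs haff.
pose x (a : point) : R := (if b then u1 a else u2 a)%:~R.
have xD a a' : x (padd a a') = x a + x a' by rewrite /x u1D u2D; case: (b); rewrite intrD.
have K0 : (0 < K)%N by apply: leq_ltn_trans hTK.
have [p0' p0E] : exists e0, e0 \in E by case: E {uE hE haff} hs => // e E _; exists e; rewrite mem_head.
pose c : point := ((R0 - p0'.1.1, S0 - p0'.1.2), T0 - p0'.2)%N.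
pose pts := [seq padd a (padd a' c) | a <- E, a' <- E].
have y0_aff a : a \in pts -> y0 a = mu * x a + (nu + nu + y0 c - mu * x c).
  case/allpairsP => -[a1 a2] /= [h1 h2 ->]; rewrite !y0D !xD (haff _ h1) (haff _ h2).
  by rewrite -/(x a1) -/(x a2); ring.
have x_inj : {in E &, injective x}.
  move=> u w uE' wE e; apply: y0_inj.
  - by have /and3P[h _ _] := hE _ uE'; apply: leq_trans h (leq_trans (leq_pmull _ _) hk).
  - by have /and3P[h _ _] := hE _ wE; apply: leq_trans h (leq_trans (leq_pmull _ _) hk).
  by rewrite !haff // -/(x u) -/(x w) e.
have [s [sE sL us]] : exists s : seq point, [/\ {subset s <= E}, size s = L & uniq (map Yv s)].
  apply: distinct_values => //; first by move=> a /hE/and3P[].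
  by apply: leq_ltn_trans hs; rewrite leq_mul2r -ltnS subn1 prednK // hTK orbT.
pose e1 (i : 'I_K) : nat := if b then nat_of_ord i else 0%N.
pose e2 (i : 'I_K) : nat := if b then 0%N else nat_of_ord i.
have monoE i a : mono R k N e1 e2 i a = x a ^+ i.
  by rewrite /mono /e1 /e2 /x; case: (b); rewrite expr0 ?mulr1 ?mul1r.
refine (@no_good_box _ e1 e2 1%N pts _ _ _ _ _ _ _ _ _); rewrite ?card_ord //.
- by rewrite expnS expn1 leq_pmulr.
- by rewrite mulnC leq_mul2r orbT.
- by rewrite mul1n leq_addl.
- rewrite (eq_bigr (fun i : 'I_K => i : nat)) => [|i _]; last by rewrite /e1 /e2; case: (b); rewrite ?addn0.
  exact: sum_ord_le.
- move=> a /allpairsP[[a1 a2] /= [/hE/and3P[h1 h2 h3] /hE/and3P[h4 h5 h6] ->]].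
  by rewrite /inbox /padd /c /=; apply/and3P; split; apply: box_arith.
- move=> yc m; exists (fun j a => x a ^+ j) => i j jm.
  have ij : (i + j < K + 1 * m)%N by rewrite mul1n -addSn leq_add.
  have [d hd] := affine_span ij y0_aff yc; exists d => a /hd <-.
  by rewrite monoE.
move=> v hv; apply: contrapT => /existsNP[[i0 l0] hnv].
pose P (l : 'I_L) : {poly {poly R}} := \sum_(i < K) (v (i, l))%:P%:P * 'X^i.
have PE l : P l = \poly_(i < K) (if insub i is Some j then (v (j, l))%:P else 0).
  rewrite poly_def; apply: eq_bigr => i _.
  by rewrite valK mul_polyC.
have evP l y z : ev y z (P l) = \sum_(i < K) v (i, l) * y ^+ i.
  rewrite rmorph_sum; apply: eq_bigr => i _.
  by rewrite rmorphM rmorphXn /= evC evX hornerC.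
pose tn (i : 'I_L) : point := tnth (in_tuple s) (cast_ord (esym sL) i).
(* Here the translations are the points of [s] themselves: Y is multiplicative, and its values on
   [s] are distinct. The shift of the second variable is 0 because no [P l] involves it. *)
have [||||D nzD [szD _ vanD]] := @casoratian R (K - 1) L P (fun i => Yv (tn i)) (fun i => (x (tn i), 0)).
- move=> i j e; apply/(@cast_ord_inj _ _ (esym sL))/eqP.
  have sz : size s = size (map Yv s) by rewrite size_map.
  have h (r : 'I_(size s)) : (r < size (map Yv s))%N by rewrite size_map.
  have nn (r : 'I_(size s)) : nth 0 (map Yv s) r = Yv (tnth (in_tuple s) r).
    by rewrite (nth_map p0') // (tnth_nth p0').
  have := nth_uniq 0 (h (cast_ord (esym sL) i)) (h (cast_ord (esym sL) j)) us.
  by rewrite !nn -/(tn i) -/(tn j) e eqxx -val_eqE => <-.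
- by move=> l; rewrite PE subn1 prednK // size_poly.
- move=> l; apply: bz_sum => i _; rewrite -[(K - 1)%N]addn0 -[X in bz X]addn0; apply: bzM.
    by apply: bzC; rewrite size_polyC; case: (_ == _).
  by rewrite -[X in bz X](mul0n i); apply: bzXn; apply: bzX.
- exists l0; apply/negP => /eqP h; apply: hnv; have := congr1 (fun p : {poly {poly R}} => p`_i0) h.
  by rewrite PE coef_poly ltn_ord valK coef0 => /eqP; rewrite polyC_eq0 => /eqP.
have rootD a : a \in E -> D.[(x (padd a c))%:P] = 0.
  move=> aE; apply: poly_nat_eq0 => j; rewrite -[LHS]/(ev (x (padd a c)) j%:R D).
  apply: vanD (Yv (padd a c)) _ _; first by rewrite gt_eqF ?Yv_gt0.
  move=> i /=; have := hv (padd (tn i) (padd a c)).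
  have -> : padd (tn i) (padd a c) \in pts.
    by apply/allpairsP; exists (tn i, a); split=> //; apply: sE; apply: mem_tnth.
  move=> /(_ isT) h; rewrite -[RHS]h addr0.
  set pt := padd (tn i) _.
  rewrite [RHS](eq_bigr (fun xx : 'I_K * 'I_L => v (xx.1, xx.2) * (mono R k N e1 e2 xx.1 pt * Yv pt ^+ xx.2))); last by case.
  rewrite -(pair_bigA _ (fun i l => v (i, l) * (mono R k N e1 e2 i pt * Yv pt ^+ l))) /= /pt.
  rewrite exchange_big /=; apply: eq_bigr => l _; rewrite evP mulr_suml; apply: eq_bigr => i' _.
  by rewrite monoE (xD (tn i)) (YvD (tn i)) [x (tn i) + _]addrC -mulrA.
(* [D] has degree at most (K - 1) L in its outer variable, which is fewer than the points of [E]. *)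
have := max_poly_roots nzD (rs := [seq (x (padd a c))%:P | a <- E]).
rewrite size_map => hroots; have /hroots : all (root D) [seq (x (padd a c))%:P | a <- E].
  by apply/allP => _ /mapP[a aE ->]; apply/rootP/rootD.
have -> : uniq [seq (x (padd a c))%:P | a <- E].
  by rewrite map_inj_in_uniq // => a a' aE a'E /polyC_inj; rewrite !xD => /addIr; apply: x_inj.
by move=> /(_ isT) lt; have := leq_trans lt szD; rewrite ltnS leqNgt hs.
Qed.
(** The tag is the total degree and the tagged value the exponent of [u1]; sums over the exponent
    pairs thus become sums over the degree. *)
Let T2 := {d : 'I_K & 'I_d.+1}.
Let f1 (x : T2) : nat := tagged x.
Let f2 (x : T2) : nat := tag x - tagged x.

Lemma f12 x : (f1 x + f2 x = tag x)%N.
Proof. by rewrite /f1 /f2 subnKC // -ltnS. Qed.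

Lemma f12_inj x x' : f1 x = f1 x' -> f2 x = f2 x' -> x = x'.
Proof.
move=> h1 h2; have ht : tag x = tag x' by apply: val_inj; rewrite -[LHS]f12 -[RHS]f12 h1 h2.
case: x x' h1 h2 ht => [d i] [d' i'] h1 _ /= e; move: i i' h1; rewrite e /f1 /= => i i' h.
by congr existT; apply: val_inj.
Qed.

Lemma T2_intro a b : (a + b < K)%N -> exists x : T2, f1 x = a /\ f2 x = b.
Proof.
move=> h; have h' : (a < (Ordinal h).+1)%N by rewrite ltnS leq_addr.
by exists (Tagged (fun d : 'I_K => 'I_d.+1) (Ordinal h')); rewrite /f1 /f2 /= addKn.
Qed.

Lemma sum_T2 (F : nat -> nat) : (\sum_(x : T2) F (tag x) = \sum_(d < K) F d * d.+1)%N.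
Proof.
rewrite -(sig_big_dep xpredT (fun _ _ => true) (fun (d : 'I_K) (_ : 'I_d.+1) => F d)) /=.
by apply: eq_bigr => d _; rewrite sum_nat_const card_ord mulnC.
Qed.

Lemma card_T2 : (2 * #|{: T2}| = K * K.+1)%N.
Proof.
rewrite -sum1_card (sum_T2 (fun=> 1%N)) -sum_succ; congr (_ * _)%N.
by apply: eq_bigr => d _; rewrite mul1n.
Qed.

Lemma sum_deg_T2 : (3 * \sum_x (f1 x + f2 x) <= 2 * K * #|{: T2}|)%N.
Proof.
rewrite (eq_bigr (fun x : T2 => (tag x : nat))) => [|x _]; last exact: f12.
rewrite (sum_T2 id) -mulnA mulnCA card_T2.
by rewrite [leqRHS]mulnC -sum_mul_succ leq_addr.
Qed.

Let G : R := ln g%:R.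
Let A : R := ln (phi R).

Lemma G_gt0 : 0 < G. Proof. by rewrite /G ln_gt0 // ltr1n. Qed.

Lemma y0_eq a : y0 a = (u1 a)%:~R * A + (u2 a)%:~R * G.
Proof. by []. Qed.

(* [u2] is a combination of [u1] and [y0], so the functions
   [u1 ^ a * u2 ^ b * (y0 - yc) ^ i] with [a + b < K] and [i <= m] span a space of
   dimension at most [#|T2| + K * m]. *)
Definition basis2 yc m (b : T2 + 'I_K * 'I_m) (a : point) : R :=
  match b with
  | inl x => (u1 a)%:~R ^+ f1 x * (y0 a - yc) ^+ f2 x
  | inr ij => (u1 a)%:~R ^+ ij.1 * (y0 a - yc) ^+ (K - ij.1 + ij.2)
  end.

Lemma basis2_span yc m al be i : (al + be < K)%N -> (al + be + i < K + m)%N ->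
  exists c : T2 + 'I_K * 'I_m -> R, forall a,
    (u1 a)%:~R ^+ al * (u2 a)%:~R ^+ be * (y0 a - yc) ^+ i = \sum_b c b * basis2 yc b a.
Proof.
elim: be al i => [|be IH] al i h1 h2.
  have [b hb] : exists b : T2 + 'I_K * 'I_m, forall a,
      basis2 yc b a = (u1 a)%:~R ^+ al * (y0 a - yc) ^+ i.
    have [lt|ge] := ltnP (al + i) K.
      by have [x [x1 x2]] := T2_intro lt; exists (inl x) => a; rewrite /= x1 x2.
    have alK : (al < K)%N by apply: leq_ltn_trans h1; exact: leq_addr.
    have im : (i - (K - al) < m)%N.
      by rewrite ltn_subLR ?leq_subLR // -(ltn_add2l al) addnA subnKC ?(ltnW alK) //; move: h2; rewrite addn0.
    exists (inr (Ordinal alK, Ordinal im)) => a /=; congr (_ * _ ^+ _).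
    by rewrite subnKC // leq_subLR.
  exists (fun b' => (b' == b)%:R) => a; rewrite (bigD1 b) //= eqxx mul1r hb big1 ?addr0.
    by rewrite expr0 mulr1.
  by move=> b' /negPf ->; rewrite mul0r.
have h1' : (al + be < K)%N by apply: leq_ltn_trans h1; rewrite leq_add2l.
have h2' : (al + be + i < K + m)%N by apply: leq_ltn_trans h2; rewrite leq_add2r leq_add2l.
have h3 : (al + be + i.+1 < K + m)%N by move: h2; rewrite !addnS !addSn.
have h4 : (al.+1 + be < K)%N by move: h1; rewrite !addnS !addSn.
have h5 : (al.+1 + be + i < K + m)%N by move: h2; rewrite !addnS !addSn.
have [c1 e1] := IH al i.+1 h1' h3.
have [c2 e2] := IH al i h1' h2'.
have [c3 e3] := IH al.+1 i h4 h5.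
exists (fun b => G^-1 * (c1 b + yc * c2 b - A * c3 b)) => a.
have Gn := gt_eqF G_gt0.
transitivity (G^-1 * (((u1 a)%:~R ^+ al * (u2 a)%:~R ^+ be * (y0 a - yc) ^+ i.+1) +
   yc * ((u1 a)%:~R ^+ al * (u2 a)%:~R ^+ be * (y0 a - yc) ^+ i) -
   A * ((u1 a)%:~R ^+ al.+1 * (u2 a)%:~R ^+ be * (y0 a - yc) ^+ i))).
  have e : (u2 a)%:~R = G^-1 * ((y0 a - yc) + yc - A * (u1 a)%:~R) :> R.
    by rewrite subrK y0_eq; field; rewrite Gn.
  rewrite (exprS _ be); set V := (u2 a)%:~R ^+ be; set Y := y0 a - yc in e *.
  by rewrite e !exprS; ring.
rewrite e1 e2 e3 !mulr_sumr -big_split -sumrB mulr_sumr; apply: eq_bigr => b _ /=; ring.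
Qed.

Definition shift1 (i : nat) (a : point) : point := ((a.1.1 + i, a.1.2), a.2)%N.

Lemma u1_shift1 i a : u1 (shift1 i a) = u1 a + i%:Z.
Proof. by rewrite /LucasRepdigits.u1 /= addnAC PoszD. Qed.
Lemma u2_shift1 i a : u2 (shift1 i a) = u2 a. Proof. by []. Qed.
Lemma y0_shift1 i a : y0 (shift1 i a) = y0 a + i%:R * A.
Proof. by rewrite !y0_eq u1_shift1 u2_shift1 intrD -!pmulrn; ring. Qed.
Lemma Yv_shift1 i a : Yv (shift1 i a) = phi R ^+ i * Yv a.
Proof. by rewrite /Yv /= exprD; ring. Qed.

Let e1 (x : T2) : nat := f1 x.
Let e2 (x : T2) : nat := f2 x.
Let pts := boxl (4 * R0) (4 * S0) (4 * T0).
Let Zp : {poly {poly R}} := (G^-1 *: 'X)%:P - ((A / G)%:P)%:P * 'X.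

Lemma ev_Zp x z : ev x z Zp = (z - A * x) / G.
Proof. by rewrite /Zp ev_lin mulrBl [A * x / G]mulrAC mulrC. Qed.

Lemma size_Zp : (size Zp <= 2)%N.
Proof.
apply: leq_trans (size_polyD _ _) _; rewrite geq_max size_polyN mul_polyC.
rewrite (leq_trans (size_scale_leq _ _)) ?size_polyX // andbT.
by rewrite size_polyC; case: (_ == _).
Qed.

Lemma bz_Zp : bz 1 Zp.
Proof.
apply: bzD; first by apply: bzC; apply: leq_trans (size_scale_leq _ _) _; rewrite size_polyX.
rewrite -mulNr -polyCN; apply: (bzM (n := 1) (m := 0)); last exact: bzX.
by apply: bzC; rewrite -polyCN size_polyC; case: (_ == _).
Qed.

Lemma poly2_size (v : T2 -> R) :
  let P := \sum_x (v x)%:P%:P * ('X^(f1 x) * Zp ^+ f2 x) in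
  (size P <= (K - 1).+1)%N /\ bz (K - 1) P.
Proof.
move=> P; have K0 : (0 < K)%N by apply: leq_ltn_trans hTK.
have xK x : (f1 x + f2 x <= K - 1)%N by rewrite f12 subn1 -ltnS prednK.
split.
  apply: leq_trans (size_sum _ _ _) _; apply/bigmax_leqP => x _.
  rewrite mul_polyC; apply: leq_trans (size_scale_leq _ _) _.
  apply: leq_trans (size_polyMleq _ _) _; rewrite size_polyXn addSn /=.
  have : (size (Zp ^+ f2 x) <= (f2 x).+1)%N.
    apply: leq_trans (size_poly_exp_leq _ _) _; rewrite ltnS -[leqRHS]mul1n leq_mul2r.
    by rewrite -subn1 leq_subLR addn1 size_Zp orbT.
  by move=> h; apply: leq_trans (leq_add (leqnn _) h) _; rewrite addnS ltnS.
apply: bz_sum => x _; rewrite -[(K - 1)%N]add0n; apply: bzM.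
  by apply: bzC; rewrite size_polyC; case: (_ == _).
apply: bzW (xK x) _; apply: (bzM (n := f1 x)); last by rewrite -[X in bz X](mul1n (f2 x)); apply: bzXn bz_Zp.
by apply: (@bzW _ 0) => //; rewrite -[X in bz X](mul0n (f1 x)); apply: bzXn; apply: bzX.
Qed.

(** The substitution of G z + A x for z turns [Zp] into z, and the sum into one over distinct
    monomials. *)
Lemma poly2_neq0 (v : T2 -> R) x0 : v x0 != 0 ->
  \sum_x (v x)%:P%:P * ('X^(f1 x) * Zp ^+ f2 x) != 0.
Proof.
apply: contra_neq => P0.
pose Q : {poly {poly R}} := \sum_x (v x)%:P%:P * ('X^(f1 x) * ('X^(f2 x))%:P).
have Q0 : Q = 0.
  apply: ev_eq0 => x z; have := congr1 (ev x (G * z + A * x)) P0.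
  rewrite rmorph0 => <-; rewrite !rmorph_sum; apply: eq_bigr => t _.
  rewrite !rmorphM !rmorphXn /= !evC evX ev_Zp !hornerC hornerX addrK; congr (_ * (_ * _ ^+ _)).
    by rewrite evX.
  by rewrite [G * z]mulrC mulfK ?gt_eqF ?G_gt0.
have cE x : (((v x)%:P%:P * ('X^(f1 x) * ('X^(f2 x))%:P) : {poly {poly R}})`_(f1 x0))`_(f2 x0)
    = v x * ((f2 x0 == f2 x)%:R *+ (f1 x0 == f1 x)).
  by rewrite coefCM coefCM coefMC coefXn mulr_natl coefMn coefXn.
have := congr1 (fun p : {poly {poly R}} => (p`_(f1 x0))`_(f2 x0)) Q0.
rewrite !coef0 coef_sum coef_sum (bigD1 x0) //= big1 ?addr0 => [|x nx]; rewrite cE.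
  by rewrite !eqxx mulr1.
have [h1|] := eqVneq (f1 x0) (f1 x); last by rewrite mulr0.
have [h2|] := eqVneq (f2 x0) (f2 x); last by rewrite mulr0.
by rewrite (f12_inj h1 h2) eqxx in nx.
Qed.

Lemma functions_dim (yc : R) m : exists h : 'I_(#|{: T2}| + K * m) -> point -> R,
    forall x i, (i <= m)%N -> exists c : 'I_(#|{: T2}| + K * m) -> R,
    forall a, a \in pts -> mono R k N e1 e2 x a * (y0 a - yc) ^+ i = \sum_j c j * h j a.
Proof.
pose B := (T2 + 'I_K * 'I_m)%type.
have E : #|{: B}| = (#|{: T2}| + K * m)%N by rewrite card_sum card_prod !card_ord.
exists (fun j => basis2 yc (enum_val (cast_ord (esym E) j) : B)) => x i im.
have [|| c hc] := @basis2_span yc m (f1 x) (f2 x) i.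
- by rewrite f12.
- by rewrite f12 -addSn leq_add.
exists (fun j => c (enum_val (cast_ord (esym E) j) : B)) => a _.
rewrite /mono hc (reindex (fun j => enum_val (cast_ord (esym E) j) : B)) //=.
apply: onW_bij; apply: (bij_comp (@enum_val_bij _)); exists (cast_ord E); [exact: cast_ordKV|exact: cast_ordK].
Qed.

Lemma functions_free (v : T2 * 'I_L -> R) :
  (forall a, a \in pts -> \sum_x v x * (mono R k N e1 e2 x.1 a * Yv a ^+ x.2) = 0) ->
    forall x, v x = 0.
Proof.
move=> hv; apply: contrapT => /existsNP[[x0 l0] /eqP hnv].
pose P (l : 'I_L) : {poly {poly R}} := \sum_x (v (x, l))%:P%:P * ('X^(f1 x) * Zp ^+ f2 x).
have evP l a : ev (u1 a)%:~R (y0 a) (P l) = \sum_x v (x, l) * mono R k N e1 e2 x a.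
  rewrite rmorph_sum; apply: eq_bigr => x _.
  rewrite !rmorphM !rmorphXn /= !evC evX ev_Zp !hornerC; congr (_ * (_ * _ ^+ _)).
  by rewrite y0_eq; have Gn := gt_eqF G_gt0; field; rewrite Gn.
have phi1 := phi_gt1 R.
(* Raising the first coordinate of a point by i multiplies Y by [phi ^+ i] and moves [(u1, y0)] by
   [(i, i A)]. The powers of [phi] are distinct, which is all the Casoratian asks for. *)
have [||||D nzD [szD bzD' vanD]] := @casoratian R (K - 1) L P (fun i => phi R ^+ i) (fun i => (i%:R, i%:R * A)).
- move=> i j e; apply: val_inj => /=; case: (ltngtP i j) => // lt; exfalso.
    by have := ltr_eXn2l phi1 i j; rewrite lt e ltxx.
  by have := ltr_eXn2l phi1 j i; rewrite lt e ltxx.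
- by move=> l; have [] := poly2_size (fun x => v (x, l)).
- by move=> l; have [] := poly2_size (fun x => v (x, l)).
- by exists l0; apply: (poly2_neq0 hnv).
pose f (a : point) : R * R := ((u1 a)%:~R, y0 a).
(* One quarter of the first side is spent on the shifts by i < L <= [R0]. *)
have rootD a : inbox (3 * R0) (4 * S0) (4 * T0) a -> ev (u1 a)%:~R (y0 a) D = 0.
  move=> /and3P[b1 b2 b3]; apply: vanD (Yv a) _ _; first by rewrite gt_eqF ?Yv_gt0.
  move=> i /=; have := hv (shift1 i a).
  have -> : shift1 i a \in pts.
    rewrite mem_boxl /inbox /= b2 b3 !andbT (mulSn 3) addnC -addSn leq_add ?(ltnW b1) //.
    by apply: leq_trans hLR; apply: ltn_ord.
  move=> /(_ isT) h; rewrite -[RHS]h.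
  set pt := shift1 i a.
  rewrite [RHS](eq_bigr (fun xx : T2 * 'I_L => v (xx.1, xx.2) * (mono R k N e1 e2 xx.1 pt * Yv pt ^+ xx.2))); last by case.
  rewrite -(pair_bigA _ (fun x l => v (x, l) * (mono R k N e1 e2 x pt * Yv pt ^+ l))) /=.
  rewrite exchange_big /=; apply: eq_bigr => l _.
  rewrite -Yv_shift1 -y0_shift1 -/pt.
  have -> : (u1 a)%:~R + i%:R = (u1 pt)%:~R :> R by rewrite /pt u1_shift1 intrD.
  by rewrite evP mulr_suml; apply: eq_bigr => x _; rewrite mulrA.
have bk r s t a : (r <= 4 * R0)%N -> inbox r s t a -> (a.1.1 < k)%N.
  by move=> hr /and3P[h _ _]; apply: leq_trans h (leq_trans hr hk).
have y0i r s t : (r <= 4 * R0)%N -> {in boxl r s t &, injective y0}.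
  move=> hr a b; rewrite !mem_boxl => ha hb; apply: y0_inj; [exact: bk hr ha|exact: bk hr hb].
have R04 : (R0 <= 4 * R0)%N by apply: leq_pmull.
(* The remaining box contains all sums of a point of the box [R0], [S0], [T0] and a point of the box
   [2 R0], [3 S0], [3 T0]. Values of [y0] serve as second coordinates, and [y0_inj] makes them
   distinct. *)
have [|||||||E [sE hE [ab [nzab col]]]] := @zero_estimate R ((K - 1) * L) D (map f (boxl R0 S0 T0)) (map f (boxl (2 * R0) (3 * S0) (3 * T0))).
- by [].
- by [].
- by [].
- by rewrite map_inj_in_uniq ?uniq_boxl // => a b ha hb [_]; apply: y0i ha hb.
- rewrite -map_comp map_inj_in_uniq ?uniq_boxl // => a b ha hb /=; apply: y0i ha hb.
  by rewrite leq_mul2r orbT.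
- move=> w u /mapP[a ha ->] /mapP[b hb ->] /=.
  rewrite -intrD -u1D -y0D; apply: rootD.
  move: ha hb; rewrite !mem_boxl => /and3P[a1 a2 a3] /and3P[c1 c2 c3].
  by rewrite /inbox /=; apply/and3P; split; apply: box_arith2.
- rewrite size_map size_boxl; apply: box_arith3 hbox.
(* With d = (K - 1) L, the zero estimate gives |W| <= d |E|, while d^2 < |W| by [hbox]. *)
have hE2 : ((K - 1) * L < size E)%N.
  rewrite ltnNge; apply/negP => le; move: hE; rewrite size_map size_boxl leqNgt => /negP; apply.
  by apply: leq_ltn_trans hbox; rewrite expnS expn1 leq_mul2l le orbT.
pose E' := [seq a <- boxl R0 S0 T0 | f a \in E].
have uE : uniq E.
  by apply: subseq_uniq sE _; rewrite map_inj_in_uniq ?uniq_boxl // => a b ha hb [_]; apply: y0i ha hb.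
have uE' : uniq E' by rewrite filter_uniq ?uniq_boxl.
have szE' : (size E <= size E')%N.
  rewrite -(size_map f E'); apply: uniq_leq_size => // e eE.
  have /mapP[a ha ea] := mem_subseq sE eE.
  by apply/mapP; exists a; rewrite // mem_filter -ea eE.
have hE' := leq_trans hE2 szE'.
have bE' a : a \in E' -> inbox R0 S0 T0 a by rewrite mem_filter mem_boxl => /andP[].
have [e0 e0E] : exists e0, e0 \in E'.
  by case: E' hE' {uE' szE' bE'} => // e s _; exists e; rewrite mem_head.
have aff a : a \in E' -> ab.1 * ((u1 a)%:~R - (u1 e0)%:~R) + ab.2 * (y0 a - y0 e0) = 0.
  move: e0E; rewrite !mem_filter => /andP[h0 _] /andP[h _]; exact: col h h0.
(* On a vertical line [u1] is constant and [y0] is affine in [u2]; on any other line [y0] is affine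
   in [u1]. *)
have [ab0|ab1] := eqVneq ab.2 0.
  have ab2 : ab.1 != 0.
    by apply: contraNneq nzab => h; apply/eqP; case: (ab) h ab0 => ? ? /= -> ->.
  apply: (@no_affine_box_points E' false G ((u1 e0)%:~R * A)) => // a aE.
  have /eqP := aff a aE; rewrite ab0 mul0r addr0 mulf_eq0 (negPf ab2) subr_eq0 /= => /eqP h.
  by rewrite y0_eq h addrC [G * _]mulrC.
apply: (@no_affine_box_points E' true (- (ab.1 / ab.2)) (y0 e0 + ab.1 / ab.2 * (u1 e0)%:~R)) => // a aE.
by have h := aff a aE; apply: (mulfI ab1); apply/eqP; rewrite -subr_eq0 -[X in _ == X]h; apply/eqP; field.
Qed.

Theorem no_good_parameters : False.
Proof.
have K0 : (0 < K)%N by apply: leq_ltn_trans hTK.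
have c2 := card_T2.
refine (@no_good_box _ e1 e2 K pts _ _ _ _ _ _ _ functions_dim functions_free) => //.
- by rewrite -(ltn_pmul2l (ltn0Sn 1)) muln0 c2 muln_gt0 K0.
- by rewrite -(leq_pmul2l (ltn0Sn 1)) c2; apply: K_arith1.
- by rewrite c2 leq_mul2l leqnSn orbT.
- exact: K_arith2 K0 c2.
- exact: sum_deg_T2.
- by move=> a; rewrite mem_boxl.
Qed.
End Params.

(** * Lower bound for the linear form *)

Lemma expR_ge_pow (R : realType) (x : R) m : 0 <= x -> (0 < m)%N -> (1 + x / m%:R) ^+ m <= expR x.
Proof.
move=> x0 m0; have -> : expR x = expR (x / m%:R) ^+ m.
  by rewrite -expRM_natr divfK // pnatr_eq0 -lt0n.
by rewrite lerXn2r ?nnegrE ?expR_ge0 ?expR_ge1Dx // addr_ge0 // divr_ge0.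
Qed.

Lemma expR_le_inv (R : realType) (x : R) : x < 1 -> expR x <= (1 - x)^-1.
Proof.
move=> x1; rewrite -[x in expR x]opprK expRN lef_pV2 ?posrE ?expR_gt0 ?subr_gt0 //.
exact: expR_ge1Dx.
Qed.

Lemma sqr_ub (F : realFieldType) (a x b : F) : 0 <= x -> x <= a -> a * a <= b -> x ^+ 2 <= b.
Proof. by move=> x0 xa; apply: le_trans; rewrite expr2 ler_pM. Qed.

Lemma sqr_lb (F : realFieldType) (a x b : F) : 0 <= a -> a <= x -> b <= a * a -> b <= x ^+ 2.
Proof. by move=> x0 xa h; apply: le_trans h _; rewrite expr2 ler_pM. Qed.

Lemma pow80_ub (F : realFieldType) (x : F) : 0 <= x -> x <= 32 / 31 -> (x ^+ 16) ^+ 5 <= 13.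
Proof.
move=> x0 h.
have x2 := @sqr_ub _ _ _ (341 / 320) x0 h ltac:(clear; lra).
have x4 := @sqr_ub _ _ _ (142 / 125) (sqr_ge0 _) x2 ltac:(clear; lra).
have x8 := @sqr_ub _ _ _ (1291 / 10 ^+ 3) (sqr_ge0 _) x4 ltac:(clear; lra).
have x16 := @sqr_ub _ _ _ (1667 / 10 ^+ 3) (sqr_ge0 _) x8 ltac:(clear; lra).
rewrite -!exprM in x16.
have := exprn_ge0 16 x0; move: (x ^+ 16) x16 => y hy y0.
have y2 := @sqr_ub _ _ _ (278 / 10 ^+ 2) y0 hy ltac:(clear; lra).
have y4 := @sqr_ub _ _ _ (773 / 10 ^+ 2) (sqr_ge0 _) y2 ltac:(clear; lra).
rewrite (_ : y ^+ 5 = (y ^+ 2) ^+ 2 * y); last by rewrite -exprM -exprSr.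
by apply: le_trans (ler_pM (sqr_ge0 _) y0 y4 hy) _; clear; lra.
Qed.

(** 5/2 is 80 times 1/32, exp (1/32) is at most 32/31, and the 80th power of 32/31 is about 12.7. *)
Lemma expR_5half (R : realType) : expR (5 / 2 : R) <= 13.
Proof.
have h : expR (1 / 32 : R) <= 32 / 31.
  by apply: le_trans (expR_le_inv _) _; [lra|rewrite -(invrK (32 / 31)) lef_pV2 ?posrE; lra].
have -> : expR (5 / 2 : R) = (expR (1 / 32 : R) ^+ 16) ^+ 5.
  by rewrite -!expRM_natr; congr expR; field.
exact: pow80_ub (expR_ge0 _) h.
Qed.

Lemma ln_phi_bounds (R : realType) : 3 / 10 < ln (phi R) <= 1 / 2.
Proof.
have [h1 h2] : 16 / 10 < phi R /\ phi R <= 1619 / 10 ^+ 3 by have := phi_bounds R; lra.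
apply/andP; split.
  rewrite -ltr_expR lnK ?posrE; last lra.
  by apply: le_lt_trans (expR_le_inv _) _; [lra|apply: le_lt_trans h1; rewrite -(invrK (16 / 10)) lef_pV2 ?posrE; lra].
rewrite -ler_expR lnK ?posrE; last lra.
apply: le_trans (expR_ge_pow (m := 16) _ _) => //; last lra.
apply: le_trans h2 _.
rewrite [leRHS](_ : _ = ((((1 + 1 / 2 / 16) ^+ 2) ^+ 2) ^+ 2) ^+ 2); last by rewrite -!exprM.
apply: (@sqr_lb _ (1274 / 10 ^+ 3)); [lra| |lra].
apply: (@sqr_lb _ (1129 / 10 ^+ 3)); [lra| |lra].
by apply: (@sqr_lb _ (1063 / 10 ^+ 3)); [lra| |lra]; apply: (@sqr_lb _ (33 / 32)); lra.
Qed.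

Lemma ln_nat_ge12 (R : realType) g : (1 < g)%N -> 1 / 2 <= ln g%:R :> R.
Proof.
move=> g1; have g2 : 2 <= g%:R :> R by rewrite ler_nat.
rewrite -ler_expR lnK ?posrE; last lra.
by apply: le_trans (expR_le_inv _) _; [lra|apply: le_trans g2; rewrite -(invrK 2) lef_pV2 ?posrE; lra].
Qed.

(** Without rounding, s = r / (2 G) and t = r / (2 H), and the claim reads 96^2 G H l^2 < r. Since
    96^2 = 9216, the constant 9300 leaves room for the loss of at most 8 G H by rounding down. *)
Lemma box_volume (F : realFieldType) (G H l r s t : F) : 1 / 2 <= G -> 1 / 2 <= H -> 1 <= l ->
  93 * 10 ^+ 2 * l ^+ 2 * (G * H) <= r -> r < 2 * G * (s + 1) -> r < 2 * H * (t + 1) ->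
  (48 * r * l) ^+ 2 < r * s * t.
Proof.
move=> hG hH hl hr hs ht.
have l2 : 1 <= l ^+ 2 by rewrite expr_ge1 //; lra.
have GH : 1 / 4 <= G * H by nra.
have hr' : 93 * 10 ^+ 2 * (G * H) <= r.
  by apply: le_trans hr; rewrite [leRHS]mulrAC ler_peMr //; lra.
have r2G : 0 < r - 2 * G.
  have : G * (1 / 2) <= G * H by rewrite ler_wpM2l //; lra.
  by lra.
have r2H : 0 < r - 2 * H.
  have : (1 / 2) * H <= G * H by rewrite ler_wpM2r //; lra.
  by lra.
have r0 : 0 < r by lra.
have h1 : (r - 2 * G) * (r - 2 * H) < 4 * (G * H) * (s * t).
  have -> : 4 * (G * H) * (s * t) = (2 * G * s) * (2 * H * t) by ring.
  by rewrite ltr_pM ?ltW //; lra.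
have h2 : r * (r - 8 * (G * H)) <= (r - 2 * G) * (r - 2 * H).
  have : r * (2 * (G + H)) <= r * (8 * (G * H)) by rewrite ler_pM2l //; nra.
  have : 0 <= G * H by lra.
  by lra.
have h3 : 96 ^+ 2 * (G * H) * l ^+ 2 < r - 8 * (G * H).
  apply: (@lt_le_trans _ _ (93 * 10 ^+ 2 * l ^+ 2 * (G * H) - 8 * (G * H))); last by lra.
  have : G * H <= G * H * l ^+ 2 by rewrite ler_peMr //; lra.
  by lra.
have h4 : 4 * (G * H) * (48 * r * l) ^+ 2 < 4 * (G * H) * (r * s * t).
  apply: (@lt_trans _ _ (r * (r * (r - 8 * (G * H))))).
    have -> : 4 * (G * H) * (48 * r * l) ^+ 2 = r * (r * (96 ^+ 2 * (G * H) * l ^+ 2)) by ring.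
    by rewrite !ltr_pM2l.
  have -> : 4 * (G * H) * (r * s * t) = r * (4 * (G * H) * (s * t)) by ring.
  by rewrite ltr_pM2l // (le_lt_trans h2 h1).
by rewrite ltr_pM2l in h4 => //; lra.
Qed.

(** After division by l r, the vanishing order is worth about 30 l, the height terms cost 59/4 l
    because e <= 13, and the size of [u1] and [u2] costs 64 Q. Hence l must exceed 64 Q / (30 -
    59/4), about 4.2 Q, whence 43/10. *)
Lemma exponent_balance (F : realFieldType) (l r Q e : F) : 100 <= Q -> 43 / 10 * Q <= l -> l ^+ 2 <= r -> e <= 13 ->
  l * (1 + 2 * r + l / 2 * (5 * (2 * r) + 1) + e * (l / 8) * (3 * (2 * r) + 1))
     + 4 / 3 * Q * l * (48 * r) < 5 / 8 * (48 * r) * (l - 1) ^+ 2.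
Proof.
move=> hQ hl hr he.
have l0 : 430 <= l by lra.
have r0 : 0 < r by apply: lt_le_trans hr; rewrite exprn_gt0 //; lra.
have lr : 430 * l <= r by apply: le_trans hr; rewrite expr2 ler_pM2r //; lra.
have h1 : e * (l / 8) * (3 * (2 * r) + 1) <= 13 * (l / 8) * (3 * (2 * r) + 1).
  by rewrite -[leLHS]mulrA -[leRHS]mulrA ler_wpM2r // mulr_ge0 //; lra.
have h2 : (1 + 2 * r + l / 2 * (5 * (2 * r) + 1) + 13 * (l / 8) * (3 * (2 * r) + 1))
     + 4 / 3 * Q * (48 * r) <= r * (15 * l + 15 * l - 61).
  have : r * (64 * Q) <= r * (30 * l - 61 - 59 / 4 * l - 3) by rewrite ler_pM2l //; lra.
  lra.
have h3 : l * (r * (15 * l + 15 * l - 61)) < 5 / 8 * (48 * r) * (l - 1) ^+ 2.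
  have : 0 < l * r by rewrite mulr_gt0 //; lra.
  by rewrite expr2; lra.
apply: le_lt_trans h3; have l0' : 0 < l by lra.
apply: (@le_trans _ _ (l * ((1 + 2 * r + l / 2 * (5 * (2 * r) + 1) + 13 * (l / 8) * (3 * (2 * r) + 1))
     + 4 / 3 * Q * (48 * r)))); last by rewrite ler_pM2l.
set B := 4 / 3 * Q * l * _.
rewrite [X in _ <= X]mulrDr (_ : l * (4 / 3 * Q * _) = B); last by rewrite /B; ring.
by rewrite lerD2r ler_pM2l // lerD2l.
Qed.

Lemma nat_ceil (R : realType) (x : R) : 0 <= x -> exists n : nat, x <= n%:R <= x + 1.
Proof.
move=> x0; exists (Num.truncn x).+1; have /andP[h1 h2] := truncn_itv x0.
by rewrite (ltW h2) -natr1 lerD2r h1.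
Qed.

Lemma nat_floor (R : realType) (x : R) : 0 <= x -> exists n : nat, n%:R <= x < n%:R + 1.
Proof. by move=> x0; exists (Num.truncn x); have := truncn_itv x0; rewrite natr1. Qed.

Lemma sqr_mul_le_expR (R : realType) (r l : R) : 100 <= l -> l ^+ 2 <= r -> (48 * r) ^+ 2 * l <= expR r.
Proof.
move=> hl hr; have l0 : 0 <= l by lra.
have r0 : 0 <= r by apply: le_trans hr; apply: sqr_ge0.
apply: le_trans (expR_ge_pow (m := 8) r0 _) => //.
apply: (@le_trans _ _ ((r / 8) ^+ 8)); last by rewrite lerXn2r ?nnegrE ?addr_ge0 ?divr_ge0 //; lra.
have lr : l <= r by apply: le_trans hr; rewrite expr2 ler_peMl //; lra.
have r1 : 100 * 100 <= r by apply: le_trans hr; rewrite expr2 ler_pM.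
apply: (@le_trans _ _ ((48 * r) ^+ 2 * r)); first by rewrite ler_wpM2l // sqr_ge0.
have -> : (r / 8) ^+ 8 = (r ^+ 2 * r) * ((r / 8 ^+ 2) ^+ 4 * (r / 1)).
  by field.
have -> : (48 * r) ^+ 2 * r = (r ^+ 2 * r) * 48 ^+ 2 by ring.
apply: ler_wpM2l; first by rewrite mulr_ge0 // sqr_ge0.
apply: (@le_trans _ _ (1 ^+ 4 * r)); first by lra.
rewrite divr1 ler_wpM2r // expr1n exprn_ege1 //.
by rewrite ler_pdivlMr ?exprn_gt0 //; lra.
Qed.

Lemma mul8_le_expR (R : realType) (x : R) : 32 <= x -> 8 * x <= expR x.
Proof.
move=> hx; apply: le_trans (expR_ge_pow (m := 2) _ _) => //; last by lra.
by rewrite expr2; nra.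
Qed.

(** The constants 94 and 431/100 absorb the rounding of r and l; the others come from 9400 * 4.31^2
    < 175000 and 9400 * 4.31^3 < 755000. *)
Lemma rQ_bounds (F : realFieldType) (Q l r w : F) : 1 / 4 <= w -> 100 <= Q ->
  43 / 10 * Q <= l -> l <= 43 / 10 * Q + 1 ->
  93 * 10 ^+ 2 * l ^+ 2 * w <= r -> r <= 93 * 10 ^+ 2 * l ^+ 2 * w + 1 ->
  [/\ l ^+ 2 <= r, r <= 175 * 10 ^+ 3 * (Q ^+ 2 * w) & r * l <= 755 * 10 ^+ 3 * (Q ^+ 3 * w)].
Proof.
move=> hw hQ l1 l2 r1 r2; have hl : 430 <= l by lra.
have lQ : l <= 431 / 100 * Q by lra.
have hl2 : 1 <= l ^+ 2 by rewrite expr_ge1 //; lra.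
have lw : 1 / 4 * l ^+ 2 <= l ^+ 2 * w by rewrite mulrC ler_wpM2l ?sqr_ge0.
have w0 : 0 <= w by lra.
have Q0 : 0 <= Q by lra.
have r3 : r <= 94 * 10 ^+ 2 * (l ^+ 2 * w) by move: r2 lw hl2; clear; lra.
have h (n : nat) : l ^+ n * w <= (431 / 100) ^+ n * (Q ^+ n * w).
  by rewrite mulrA ler_wpM2r // -exprMn lerXn2r ?nnegrE ?mulr_ge0 //; lra.
have q (n : nat) : 0 <= Q ^+ n * w by rewrite mulr_ge0 ?exprn_ge0.
split.
- by move: r1 lw hl2; clear; lra.
- by move: r3 (h 2) (q 2); clear; lra.
apply: (@le_trans _ _ (94 * 10 ^+ 2 * (l ^+ 2 * w) * l)); first by rewrite ler_wpM2r //; lra.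
have -> : 94 * 10 ^+ 2 * (l ^+ 2 * w) * l = 94 * 10 ^+ 2 * (l ^+ 3 * w) by ring.
by move: (h 3) (q 3); clear; lra.
Qed.

Lemma st_bounds (F : realFieldType) (Q G H r s t : F) : 1 / 2 <= G -> 1 / 2 <= H ->
  s * (2 * G) <= r -> t * (2 * H) <= r -> 0 <= s -> 0 <= t ->
  r <= 175 * 10 ^+ 3 * (Q ^+ 2 * (G * H)) ->
  [/\ s <= r, t <= r & 4 * t <= 4 * 10 ^+ 5 * Q ^+ 2 * G].
Proof.
move=> hG hH s1 t1 s0 t0 rG; split.
- by apply: le_trans s1; rewrite ler_peMr //; lra.
- by apply: le_trans t1; rewrite ler_peMr //; lra.
have : t * (2 * H) <= 175 * 10 ^+ 3 * (Q ^+ 2 * G) * H by apply: le_trans t1 _; move: rG; clear; lra.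
rewrite mulrA ler_pM2r; last lra.
have : 0 <= Q ^+ 2 * G by rewrite mulr_ge0 ?sqr_ge0 //; lra.
by clear; lra.
Qed.

Lemma side_le_exponent (F : realFieldType) (L r k q w : F) : 430 <= L -> 0 <= r -> 0 <= q * w -> r * L <= 755 * 10 ^+ 3 * (q * w) ->
  92 * 10 ^+ 6 * (q * w) < k -> 4 * r <= k.
Proof.
move=> hL r0 qw rL hk; have : 430 * r <= r * L by rewrite mulrC ler_wpM2l.
by move: r0 rL hk qw; clear; lra.
Qed.

(* The box has sides [r], [r / (2 ln g)] and [r / (2 H)], where [r] is about
   [9300 * L ^ 2 * ln g * H]; the degrees are [K = 48 r] and [L], about [43/10 * Q]. *)
Theorem three_log (R : realType) (g p q k N : nat) (Q H M : R) :
  (1 < g)%N -> (0 < p)%N -> (0 < q)%N -> ln g%:R <= H -> ln p%:R <= H -> ln q%:R <= H ->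
  100 <= Q -> k%:R <= M -> N%:R <= M -> M * (4 * 10 ^+ 5 * Q ^+ 2 * ln g%:R + 3) <= expR Q ->
  k%:R <= 92 * 10 ^+ 6 * (Q ^+ 3 * (ln g%:R * H)) \/
  expR (- (92 * 10 ^+ 6 * (Q ^+ 3 * (ln g%:R * H)))) < `|Lam R g p q k N|.
Proof.
move=> g1 p0 q0 hg hp hq hQ hkM hNM hM.
have hG := ln_nat_ge12 R g1; move: (ln g%:R) hG hg hM (@no_good_parameters R g p q k N) => G hG hg hM T.
have hH : 1 / 2 <= H by apply: le_trans hg.
have w0 : 1 / 4 <= G * H by move: hG hH; clear; nra.
have q0' : 0 <= Q ^+ 3 * (G * H).
  by rewrite mulr_ge0 ?exprn_ge0 //; [move: hQ|move: w0]; clear; lra.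
set C := 92 * _ * _.
case: (leP k%:R C) => [|hk]; first by left.
case: (ltP (expR (- C)) `|Lam R g p q k N|) => [|hLam]; first by right.
exfalso.
have [L /andP[L1 L2]] := @nat_ceil R (43 / 10 * Q) ltac:(move: hQ; clear; lra).
have hL : 430 <= L%:R :> R by move: hQ L1; clear; lra.
have [r /andP[r1 r2]] := @nat_ceil R (93 * 10 ^+ 2 * L%:R ^+ 2 * (G * H)) ltac:(move: w0; clear; nra).
have [hLr rQ rL] := rQ_bounds w0 hQ L1 L2 r1 r2.
have r0 : 0 <= r%:R :> R by [].
have [s /andP[s1 s2]] := @nat_floor R (r%:R / (2 * G)) ltac:(apply: divr_ge0; move: hG r0; clear; lra).
have [t /andP[t1 t2]] := @nat_floor R (r%:R / (2 * H)) ltac:(apply: divr_ge0; move: hH r0; clear; lra).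
have G2 : 0 < 2 * G by move: hG; clear; lra.
have H2 : 0 < 2 * H by move: hH; clear; lra.
rewrite ler_pdivlMr // in s1; rewrite ltr_pdivrMr // in s2.
rewrite ler_pdivlMr // in t1; rewrite ltr_pdivrMr // in t2.
have [sr tr tG] := st_bounds hG hH s1 t1 (ler0n _ _) (ler0n _ _) rQ.
have kr := side_le_exponent hL r0 q0' rL hk.
have M0 : 0 <= M by apply: le_trans hkM.
have hu (x y : R) : 0 <= x -> x <= M -> y <= M -> y + x * (4 * t%:R) <= expR Q.
  move=> x0 xM yM; apply: le_trans hM.
  have : x * (4 * t%:R) <= M * (4 * 10 ^+ 5 * Q ^+ 2 * G) by rewrite ler_pM ?mulr_ge0.
  by move: yM M0; clear; lra.
have /andP[_ A1] := ln_phi_bounds R.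
have l1 : 1 <= L%:R :> R by move: hL; clear; lra.
have lr : L%:R <= r%:R :> R by apply: le_trans hLr; rewrite expr2 ler_peMl.
have r1' : 0 < r%:R :> R by apply: lt_le_trans lr; move: l1; clear; lra.
have kM4 : 4 * r%:R <= M by apply: le_trans kr hkM.
(* 121 is 1 + 48 * 5/2: the required smallness costs 120 r L, and the factor in front of |[Lam]| is
   at most exp (r L). *)
have rL' : 121 * (r%:R * L%:R) <= C by rewrite /C; move: rL q0'; clear; lra.
(* [lam = 2 r] suits all four-fold sides because ln phi <= 1/2 and s, t are at most r / (2 ln g) and
   r / (2 H). The next two values bound the logarithms of [u1], [u2] and of the number of
   functions. *)
apply: (T (48 * r)%N L r s t (2 * r%:R) Q r%:R H) => //.
- by rewrite natrM; have := ler_wpM2l r0 A1; clear; lra.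
- by rewrite natrM; move: s1; clear; lra.
- by rewrite natrM; move: t1; clear; lra.
- by rewrite -(ler_nat R) natrM.
- by rewrite natrD !natrM; apply: hu.
- rewrite natrD !natrM; apply: hu => //.
  by apply: le_trans kM4; move: sr; clear; lra.
- by rewrite natrM natrX natrM; apply: sqr_mul_le_expR => //; move: hL; clear; lra.
- by move: hQ; clear; lra.
- by rewrite -(ltr_nat R); move: l1; clear; lra.
- by rewrite -(ler_nat R).
- by rewrite -(ltr_nat R) natrM; move: tr r1'; clear; lra.
- rewrite -(ltr_nat R); apply: (@le_lt_trans _ _ ((48 * r%:R * L%:R) ^+ 2)).
    by rewrite natrX lerXn2r ?nnegrE ?mulr_ge0 // -!natrM ler_nat leq_mul2r leq_subr orbT.
  by rewrite !natrM; apply: box_volume hG hH l1 r1 _ _; rewrite mulrC.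
- apply: (@le_trans _ _ (expR (r%:R * L%:R) * expR (- C))).
    rewrite ler_pM ?normr_ge0 ?mulr_ge0 //.
    apply: le_trans (mul8_le_expR _); last first.
      have : 430 * 1 <= L%:R * r%:R :> R by rewrite ler_pM // (le_trans l1 lr).
      by clear; lra.
    have : L%:R * t%:R <= L%:R * r%:R :> R by rewrite ler_wpM2l.
    by rewrite natrM; clear; lra.
  rewrite -expRD -expRM_natr -expRN ler_expR !natrM.
  by move: rL'; clear; lra.
have := @exponent_balance R L%:R r%:R Q _ hQ L1 hLr (expR_5half R).
by rewrite natrM.
Qed.

(** * Lucas numbers that are products of repdigits *)

Lemma ln1Dx_abs (R : realType) (x : R) : `|x| <= 1 / 2 -> `|ln (1 + x)| <= 2 * `|x|.
Proof.
rewrite ler_norml => /andP[h1 h2].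
have x0 : 0 < 1 + x by move: h1; clear; lra.
have up : ln (1 + x) <= x by apply: le_ln1Dx; move: h1; clear; lra.
have lo : x / (1 + x) <= ln (1 + x).
  have E : 1 + (- (x / (1 + x))) = (1 + x)^-1 by field; rewrite gt_eqF.
  have := @le_ln1Dx R (- (x / (1 + x))); rewrite E lnV ?posrE // => h.
  have {}h := h ltac:(rewrite -subr_gt0 opprK addrC E invr_gt0 //).
  by rewrite -lerN2.
rewrite ler_norml.
have ab : - `|x| <= x <= `|x| by rewrite -ler_norml.
have lo' : - (2 * `|x|) <= x / (1 + x).
  rewrite -mulNr ler_pdivlMr //.
  have [xp|xn] := leP 0 x; first by rewrite ger0_norm //; move: xp; clear; nra.
  by rewrite ltr0_norm //; move: h1 xn; clear; nra.
by have := normr_ge0 x; move: up lo lo' ab; clear; lra.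
Qed.

(** After extraction of a 21st root, 294 = 21 * 14 allows exp 14 >= 2^14 to be split off; a linear
    bound suffices for the remaining exponential. *)
Lemma expR_ge21 (R : realType) (Q : R) : 294 <= Q -> (30 * Q) ^+ 21 <= expR Q.
Proof.
move=> hQ; have -> : expR Q = expR (Q / 21) ^+ 21 by rewrite -expRM_natr divfK // pnatr_eq0.
have Q0 : 0 <= Q by move: hQ; clear; lra.
rewrite lerXn2r ?nnegrE ?expR_ge0 ?mulr_ge0 //.
have e1 : 2 <= expR (1 : R) by apply: le_trans (expR_ge1Dx _); rewrite -natr1.
have -> : expR (Q / 21) = expR 1 ^+ 14 * expR (Q / 21 - 14).
  by rewrite -expRM_natr mul1r -expRD addrC subrK.
apply: (@le_trans _ _ (2 ^+ 14 * (1 + (Q / 21 - 14)))); first by move: hQ; clear; lra.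
rewrite ler_pM ?expR_ge1Dx ?exprn_ge0 //; first by move: hQ; clear; lra.
by rewrite lerXn2r ?nnegrE ?expR_ge0.
Qed.

Lemma ln_nat_ge (R : realType) g : (1 < g)%N -> 13 / 20 <= ln g%:R :> R.
Proof.
move=> g1; have g2 : 2 <= g%:R :> R by rewrite ler_nat.
rewrite -ler_expR lnK ?posrE; last by move: g2; clear; lra.
apply: le_trans g2; rewrite (_ : 13 / 20 = 13 / 160 * 8%:R); last by field.
rewrite expRM_natr; have h : expR (13 / 160 : R) <= 160 / 147.
  by apply: le_trans (expR_le_inv _) _; [lra|rewrite -(invrK (160 / 147)) lef_pV2 ?posrE; lra].
rewrite (_ : _ ^+ 8 = ((expR (13 / 160) ^+ 2) ^+ 2) ^+ 2); last by rewrite -!exprM.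
have x2 := @sqr_ub _ _ _ (1185 / 10 ^+ 3) (expR_ge0 _) h ltac:(clear; lra).
have x4 := @sqr_ub _ _ _ (1405 / 10 ^+ 3) (sqr_ge0 _) x2 ltac:(clear; lra).
by apply: (@sqr_ub _ _ _ 2) (sqr_ge0 _) x4 _; clear; lra.
Qed.

Lemma lucas_ge0 (R : realType) k : 0 < phi R ^+ k + psi R ^+ k.
Proof.
have h1 := phi_bounds R; have h2 := psi_bounds R.
rewrite -[phi R ^+ k]ger0_norm ?exprn_ge0 ?ltW ?phi_gt0 //.
have : `|psi R ^+ k| < phi R ^+ k \/ k = 0%N.
  case: k => [|k]; [by right|left]; rewrite normrX ltrXn2r //.
  by rewrite ltr0_norm; move: h1 h2; clear; lra.
case=> [h|->]; last by rewrite !expr0 normr1 addr_gt0.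
have : - psi R ^+ k <= `|psi R ^+ k| by rewrite -normrN ler_norm.
have := ler_norm (phi R ^+ k).
by move: h; clear; lra.
Qed.

Lemma ln_lucas (R : realType) g k n : (1 < g)%N -> (0 < n)%N -> g%:R ^+ n <= phi R ^+ (2 * k) ->
  `|k%:R * ln (phi R) - ln (phi R ^+ k + psi R ^+ k)| * g%:R ^+ n <= 2.
Proof.
move=> g1 n0 h; have f0 := phi_gt0 R; have fk : 0 < phi R ^+ k by rewrite exprn_gt0.
have fk2 : 0 < phi R ^+ (2 * k) by rewrite exprn_gt0.
have g2 : 2 <= g%:R :> R by rewrite ler_nat.
have gn : 2 <= g%:R ^+ n :> R.
  by case: n n0 {h} => // n _; apply: (le_trans g2 _); rewrite ler_eXnr //; move: g2; clear; lra.
(* [e] is the k-th power of [psi / phi], rewritten with [phi * psi = -1]. *)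
pose e : R := (-1) ^+ k / phi R ^+ (2 * k).
have ne : `|e| = (phi R ^+ (2 * k))^-1.
  by rewrite normrM normrX normrN1 expr1n mul1r normfV gtr0_norm.
have E : phi R ^+ k + psi R ^+ k = phi R ^+ k * (1 + e).
  rewrite mulrDr mulr1; congr (_ + _); rewrite /e -(phiMpsi R) [(phi R * psi R) ^+ k]exprMn mul2n -addnn exprD.
  move: fk; move: (phi R ^+ k) (psi R ^+ k) => a b a0.
  by field; rewrite gt_eqF.
have ne2 : `|e| <= 1 / 2.
  by rewrite ne div1r lef_pV2 ?posrE //; apply: le_trans h.
have e1 : 0 < 1 + e by move: ne2; rewrite ler_norml; clear; lra.
rewrite E lnM ?posrE // (lnXn k f0) -[ln (phi R) *+ _]mulr_natl opprD addrA subrr sub0r normrN.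
apply: (@le_trans _ _ (2 * `|e| * g%:R ^+ n)).
  by rewrite ler_wpM2r ?ln1Dx_abs // (le_trans _ gn).
rewrite -mulrA -[leRHS]mulr1 ler_pM2l // ne mulrC.
by rewrite ler_pdivrMr // mul1r.
Qed.

(** Replacing each [g ^ i - 1] by [g ^ i] changes the logarithm by at most 2 g^-n, and so does
    replacing [ln L] by k ln phi. With at most three factors this gives the constant 8. *)
Lemma Lam_le (R : realType) g p q k n (L : R) (s : seq nat) : (1 < g)%N -> (0 < p)%N -> (0 < q)%N -> (0 < n)%N ->
  all (leq n) s -> 0 < L -> `|k%:R * ln (phi R) - ln L| * g%:R ^+ n <= 2 ->
  q%:R * L = p%:R * \prod_(i <- s) (g%:R ^+ i - 1) ->
  `|Lam R g p q k (sumn s)| * g%:R ^+ n <= 2 * (size s).+1%:R.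
Proof.
move=> g1 p0 q0 n0 hs L0 hL eqL.
have g2 : 2 <= g%:R :> R by rewrite ler_nat.
have g0 : 0 < g%:R :> R by rewrite ltr0n ltnW.
have -> : Lam R g p q k (sumn s) = (k%:R * ln (phi R) - ln L) + (ln (q%:R * L) - ln p%:R - (sumn s)%:R * ln g%:R).
  by rewrite /Lam ln_pq // lnM ?posrE ?ltr0n //; ring.
have -> : ln (q%:R * L) - ln p%:R = ln (\prod_(i <- s) (g%:R ^+ i - 1)).
  have P0 : 0 < p%:R * \prod_(i <- s) (g%:R ^+ i - 1) :> R by rewrite -eqL mulr_gt0 ?ltr0n.
  rewrite eqL lnM ?posrE ?ltr0n //; first by rewrite addrC addKr.
  by rewrite pmulr_rgt0 ?ltr0n in P0.
rewrite -[(size s).+1%:R]natr1 mulrDr mulr1 [leRHS]addrC; apply: le_trans (lerD hL (_ : `|ln (\prod_(i <- s) (g%:R ^+ i - 1)) - (sumn s)%:R * ln g%:R| * g%:R ^+ n <= 2 * (size s)%:R)).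
  by rewrite -mulrDl ler_wpM2r ?exprn_ge0 ?ler_normD // ltW.
have gi i : (n <= i)%N -> 2 <= g%:R ^+ n :> R /\ g%:R ^+ n <= g%:R ^+ i :> R.
  move=> ni; split; last by rewrite ler_weXn2l //; move: g2; clear; lra.
  by case: n n0 {ni hs hL} => // n _; apply: (le_trans g2 _); rewrite ler_eXnr //; move: g2; clear; lra.
elim: s hs {eqL} => [|i s IH] /=; first by rewrite big_nil ln1 mul0r subrr normr0 mul0r mulr0.
case/andP => ni hs; have {IH} := IH hs; rewrite big_cons.
have P0 : 0 < \prod_(i <- s) (g%:R ^+ i - 1) :> R.
  rewrite big_seq prodr_gt0 // => j /(allP hs) /gi[h1 h2].
  by move: h1 h2; clear; lra.
have [h1 h2] := gi i ni.
rewrite lnM ?posrE //; last by move: h1 h2; clear; lra.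
have -> : ln (g%:R ^+ i - 1) = i%:R * ln g%:R + ln (1 + - g%:R ^- i) :> R.
  have gi0 : 0 < g%:R ^+ i :> R by rewrite exprn_gt0.
  have -> : g%:R ^+ i - 1 = g%:R ^+ i * (1 + - g%:R ^- i) :> R by field; rewrite gt_eqF.
  rewrite lnM ?posrE //; first by rewrite (lnXn i g0) -[ln g%:R *+ _]mulr_natl.
  by rewrite subr_gt0 invf_lt1 //; move: h1 h2; clear; lra.
set S := ln (\prod_(_ <- _) _); rewrite natrD => IH.
have hi : `|ln (1 + - g%:R ^- i)| * g%:R ^+ n <= 2 :> R.
  have gi0 : 0 < g%:R ^+ i :> R by rewrite exprn_gt0.
  have E : `|- g%:R ^- i| = g%:R ^- i :> R by rewrite normrN gtr0_norm ?invr_gt0.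
  apply: (@le_trans _ _ (2 * `|- g%:R ^- i| * g%:R ^+ n)).
    rewrite ler_wpM2r ?ln1Dx_abs //; first by move: h1; clear; lra.
    by rewrite E div1r lef_pV2 ?posrE //; move: h1 h2; clear; lra.
  by rewrite E -mulrA -[leRHS]mulr1 ler_pM2l // mulrC ler_pdivrMr // mul1r.
rewrite -[(size s).+1%:R]natr1 mulrDr mulr1 [leRHS]addrC; apply: le_trans (lerD hi IH).
rewrite -mulrDl ler_wpM2r ?exprn_ge0 ?(ltW g0) //; apply: le_trans (ler_normD _ _).
by rewrite le_eqVlt; apply/orP; left; apply/eqP; congr `|_|; ring.
Qed.

(** Both alternatives of [three_log] bound n: a large form is compared with 8 g^-n, where 8 <= g^3
    accounts for the 3, and a small k with the hypothesis 2 (n - 2) ln g <= k. *)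
Lemma stage (R : realType) g p q k N n (Q H M : R) :
  (1 < g)%N -> (0 < p)%N -> (0 < q)%N -> ln g%:R <= H -> ln p%:R <= H -> ln q%:R <= H ->
  100 <= Q -> k%:R <= M -> N%:R <= M -> M * (4 * 10 ^+ 5 * Q ^+ 2 * ln g%:R + 3) <= expR Q ->
  `|Lam R g p q k N| * g%:R ^+ n <= 8 -> 2 * (n%:R - 2) * ln g%:R <= k%:R :> R ->
  n%:R <= 92 * 10 ^+ 6 * Q ^+ 3 * H + 3.
Proof.
move=> g1 p0 q0 hg hp hq hQ kM NM hM hL hn.
have G0 := ln_nat_ge12 R g1; have G0' : 0 < ln g%:R :> R by move: G0; clear; lra.
have B0 : 0 <= 92 * 10 ^+ 6 * Q ^+ 3 * H.
  have Q0 : 0 <= Q by move: hQ; clear; lra.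
  have H0 : 0 <= H by apply: le_trans hg; apply: ltW.
  by rewrite !mulr_ge0 ?exprn_ge0.
have [h|h] := three_log g1 p0 q0 hg hp hq hQ kM NM hM.
  have : 2 * (n%:R - 2) * ln g%:R <= 92 * 10 ^+ 6 * Q ^+ 3 * H * ln g%:R.
    by apply: le_trans hn _; apply: le_trans h _; rewrite le_eqVlt; apply/orP; left; apply/eqP; ring.
  by rewrite ler_pM2r //; move: B0; clear; lra.
rewrite -(ler_pM2r G0'); apply: ltW.
have g0 : 0 < g%:R :> R by rewrite ltr0n ltnW.
have gn0 : 0 < g%:R ^+ n :> R by rewrite exprn_gt0.
have h8 : ln (8 : R) <= 3 * ln g%:R.
  rewrite mulr_natl -(lnXn 3 g0) ler_ln ?posrE ?exprn_gt0 //.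
  have -> : 8 = 2 ^+ 3 :> R by ring.
  by rewrite lerXn2r ?nnegrE ?ler_nat.
have {}h : g%:R ^+ n < expR (92 * 10 ^+ 6 * (Q ^+ 3 * (ln g%:R * H))) * 8 :> R.
  have := lt_le_trans _ hL; rewrite -(ltr_pM2r gn0) in h.
  move/(_ _ h); rewrite expRN mulrC ltr_pdivrMr ?expR_gt0 // mulrC; by rewrite mulrC [8 * _]mulrC.
move: h; rewrite -ltr_ln ?posrE ?mulr_gt0 ?expR_gt0 // lnM ?posrE ?expR_gt0 // expRK.
rewrite (lnXn n g0) -[ln g%:R *+ _]mulr_natl => h; apply: lt_le_trans h _.
by move: h8; clear; lra.
Qed.

Lemma ln_nat_le (R : realType) g x e : (0 < g)%N -> (0 < x)%N -> (x <= g ^ e)%N -> ln x%:R <= e%:R * ln g%:R :> R.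
Proof.
move=> g0 x0 h; have g0' : 0 < g%:R :> R by rewrite ltr0n.
rewrite mulr_natl -(lnXn e g0') ler_ln ?posrE ?exprn_gt0 ?ltr0n //.
by rewrite -natrX ler_nat.
Qed.

(** [Q] is chosen so that n just exceeds the outcome of the three stages: 236 * 10^22 is larger than
    3.01 * (92 * 10^6)^3. The assumed size of n makes Q^9 a large multiple of G^6, which yields both
    inequalities; the cruder G >= 1/2 would not give 294. *)
Lemma Q_choice (R : realType) (n G : R) : 13 / 20 <= G -> 773 * 10 ^+ 45 * G ^+ 9 <= n ->
  exists Q : R, [/\ n = 236 * 10 ^+ 22 * Q ^+ 9 * G ^+ 3, 294 <= Q & G <= Q ^+ 2].
Proof.
move=> hG hn; have G0 : 0 < G by move: hG; clear; lra.
have n0 : 0 < n by apply: lt_le_trans hn; rewrite !mulr_gt0 ?exprn_gt0.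
have d0 : 0 < 236 * 10 ^+ 22 * G ^+ 3 by rewrite !mulr_gt0 ?exprn_gt0.
pose x := n / (236 * 10 ^+ 22 * G ^+ 3); have x0 : 0 < x by rewrite divr_gt0.
pose Q := expR (ln x / 9); have Q0 : 0 < Q by apply: expR_gt0.
have Q9 : Q ^+ 9 = x by rewrite /Q -expRM_natr divfK ?pnatr_eq0 // lnK.
have nE : n = 236 * 10 ^+ 22 * Q ^+ 9 * G ^+ 3.
  by rewrite Q9 mulrAC /x mulrC divfK // gt_eqF.
have hQ9 : 773 * 10 ^+ 45 * G ^+ 6 <= 236 * 10 ^+ 22 * Q ^+ 9.
  have e : 773 * 10 ^+ 45 * G ^+ 6 * G ^+ 3 = 773 * 10 ^+ 45 * G ^+ 9 by rewrite -mulrA -exprD.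
  by rewrite -(ler_pM2r (exprn_gt0 3 G0)) e -nE.
have hQ : 294 <= Q.
  rewrite leNgt; apply/negP => lt.
  have h1 : Q ^+ 9 <= 294 ^+ 9 by rewrite lerXn2r ?nnegrE // ltW.
  have h2 : (13 / 20) ^+ 6 <= G ^+ 6.
    by rewrite lerXn2r ?nnegrE ?divr_ge0 // ltW.
  by move: h1 h2 hQ9; clear; lra.
exists Q; split=> //; rewrite leNgt; apply/negP => lt.
have h1 : (Q ^+ 2) ^+ 6 <= G ^+ 6 by rewrite lerXn2r ?nnegrE ?sqr_ge0 // ltW.
have h2 : Q ^+ 9 <= (Q ^+ 2) ^+ 6.
  by rewrite -exprM ler_weXn2l //; move: hQ; clear; lra.
have h3 : 0 < Q ^+ 9 by rewrite exprn_gt0.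
by move: h1 h2 h3 hQ9; clear; lra.
Qed.

(** The left side is at most 9.676 * 10^30 Q^11 G^5. Since G <= Q^2 this becomes a multiple of Q^21,
    and 30^21 exceeds 10^31. *)
Lemma M_bound (R : realType) (n G Q : R) : 13 / 20 <= G -> n = 236 * 10 ^+ 22 * Q ^+ 9 * G ^+ 3 ->
  294 <= Q -> G <= Q ^+ 2 -> 10 * n * G * (4 * 10 ^+ 5 * Q ^+ 2 * G + 3) <= expR Q.
Proof.
move=> hG -> hQ GQ; apply: le_trans (expR_ge21 hQ).
have G0 : 0 < G by move: hG; clear; lra.
have Q0 : 0 < Q by move: hQ; clear; lra.
have h1 : 3 <= 10 ^+ 4 * (Q ^+ 2 * G).
  have : 1 * (13 / 20) <= Q ^+ 2 * G by rewrite ler_pM // ?expr_ge1 //; move: hQ; clear; lra.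
  by clear; lra.
have h2 : Q ^+ 11 * G ^+ 5 <= Q ^+ 21.
  rewrite (exprD Q 11 10) ler_pM2l ?exprn_gt0 // (exprM Q 2 5).
  by rewrite lerXn2r ?nnegrE ?sqr_ge0 // ltW.
apply: (@le_trans _ _ (10 * (236 * 10 ^+ 22 * Q ^+ 9 * G ^+ 3) * G * (41 * 10 ^+ 4 * (Q ^+ 2 * G)))).
  rewrite ler_pM2l ?mulr_gt0 ?exprn_gt0 //.
  by move: h1; clear; lra.
have -> : 10 * (236 * 10 ^+ 22 * Q ^+ 9 * G ^+ 3) * G * (41 * 10 ^+ 4 * (Q ^+ 2 * G)) = 9676 * 10 ^+ 27 * (Q ^+ 11 * G ^+ 5) by ring.
have : 0 < Q ^+ 21 by rewrite exprn_gt0.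
by rewrite exprMn; move: h2; clear; lra.
Qed.

(** The leading terms are 3 b, 3 b^2 and 3 b^3; all others are absorbed in the last 1/100 because b
    is at least 10^9. *)
Lemma three_stages (F : realFieldType) (l m n b : F) : 10 ^+ 9 <= b ->
  l <= b * 3 + 3 -> m <= b * (l + 3) + 3 -> n <= b * (l + m + 3) + 3 -> n <= 301 / 100 * b ^+ 3.
Proof.
move=> hb hl hm hn; have b0 : 0 <= b by move: hb; clear; lra.
have h1 := ler_wpM2l b0 hl; have b2 : 0 <= b ^+ 2 by apply: sqr_ge0.
have m2 : m <= 3 * b ^+ 2 + 6 * b + 3 by rewrite expr2; move: hm h1; clear; lra.
have := ler_wpM2l b0 m2.
have b1 : 10 ^+ 9 * b <= b ^+ 2 by rewrite expr2 ler_wpM2r.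
have b3 : 10 ^+ 9 * b ^+ 2 <= b ^+ 3 by rewrite [b ^+ 3]exprS ler_wpM2r.
by move: hn h1 b1 b3 hb; clear; lra.
Qed.

Lemma size_facts (R : realType) g k l m n c : (1 < g)%N -> (0 < k)%N -> (0 < n)%N -> (l <= n)%N -> (m <= n)%N ->
  c%:R = phi R ^+ k + psi R ^+ k -> (g ^ n.-1 <= c)%N -> (c < g ^ (l + m + n))%N ->
  [/\ k%:R < 10 * n%:R * ln g%:R :> R, 2 * (n%:R - 2) * ln g%:R <= k%:R :> R &
      (4 <= n)%N -> g%:R ^+ n <= phi R ^+ (2 * k)].
Proof.
move=> g1 k0 n0 l_n m_n hc lo up.
have G0 := ln_nat_ge12 R g1; have g0 : 0 < g%:R :> R by rewrite ltr0n ltnW.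
have /andP[A0 A1] := ln_phi_bounds R; have f0 := phi_gt0 R.
have fk0 : 0 < phi R ^+ k by rewrite exprn_gt0.
have lnf (i : nat) : ln (phi R ^+ i) = i%:R * ln (phi R) by rewrite (lnXn i f0) -[_ *+ i]mulr_natl.
have lng (i : nat) : ln (g%:R ^+ i) = i%:R * ln g%:R :> R by rewrite (lnXn i g0) -[_ *+ i]mulr_natl.
have psi1 : `|psi R ^+ k| <= 1.
  by rewrite normrX exprn_ile1 //; have := psi_bounds R; rewrite ler_norml; clear; lra.
have fk1 : 1 <= phi R ^+ k by apply: exprn_ege1; have := phi_bounds R; clear; lra.
have kN : k%:R * ln (phi R) <= 3 * n%:R * ln g%:R.
  rewrite -lnf; apply: (@le_trans _ _ (ln (g%:R ^+ (l + m + n)))).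
    rewrite ler_ln ?posrE ?exprn_gt0 // -natrX.
    apply: (@le_trans _ _ (c.+1%:R)); last by rewrite ler_nat.
    rewrite -natr1 hc; move: psi1; rewrite ler_norml; clear; lra.
  rewrite lng ler_wpM2r //; first by move: G0; clear; lra.
  by rewrite -natrM ler_nat !mulSn mul0n addn0 addnA !leq_add.
have kA : (n%:R - 2) * ln g%:R <= k%:R * ln (phi R).
  have h : g%:R ^+ n.-1 <= g%:R * phi R ^+ k :> R.
    rewrite -natrX; apply: (@le_trans _ _ c%:R); first by rewrite ler_nat.
    have g2 : 2 <= g%:R :> R by rewrite ler_nat.
    apply: (@le_trans _ _ (2 * phi R ^+ k)); last by rewrite ler_pM2r.
    by rewrite hc; move: psi1 fk1; rewrite ler_norml; clear; lra.
  have : n.-1%:R * ln g%:R <= ln g%:R + k%:R * ln (phi R).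
    rewrite -lnf -lng -lnM ?posrE // ler_ln ?posrE ?exprn_gt0 // mulr_gt0 //.
  by rewrite -subn1 natrB //; clear; lra.
have k1 : 0 < k%:R :> R by rewrite ltr0n.
(* The factor 10 comes from ln phi > 3/10 and the factor 2 from ln phi <= 1/2; [4 <= n] serves for n
   <= 2 (n - 2). *)
split=> [||n4].
  by have := ltr_pM2l k1 (3 / 10) (ln (phi R)); rewrite A0; move: kN; clear; lra.
  by have := ler_wpM2l (ltW k1) A1; move: kA; clear; lra.
rewrite -ler_ln ?posrE ?exprn_gt0 // lnf lng natrM.
have : 4 <= n%:R :> R by rewrite ler_nat.
by move: G0 kA; clear; nra.
Qed.

Lemma repunit_facts g a i : (1 < g)%N -> (0 < i)%N -> ((g - 1) * a = g ^ i - 1)%N -> (g ^ i.-1 <= a)%N.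
Proof.
move=> g1; case: i => // i _ /= h.
have g0 : (0 < g - 1)%N by rewrite subn_gt0.
have gi : (0 < g ^ i)%N by rewrite expn_gt0 ltnW.
by rewrite -(leq_pmul2l g0) h mulnBl mul1n expnS leq_sub2l.
Qed.

Lemma repdigit_lt g a d i : (1 < g)%N -> (d < g)%N -> ((g - 1) * a = g ^ i - 1)%N -> (d * a < g ^ i)%N.
Proof.
move=> g1 dg h; apply: (@leq_ltn_trans ((g - 1) * a)); first by rewrite leq_mul2r leq_subRL ?(ltnW g1) // add1n dg orbT.
by rewrite h ltn_subLR ?expn_gt0 ?(ltnW g1) // add1n.
Qed.

Theorem lucas_repdigits_bound (R : realType) g k d1 d2 d3 l m n a1 a2 a3 c : (1 < g)%N -> (0 < k)%N ->
  (0 < l)%N -> (l <= m)%N -> (m <= n)%N -> (0 < d1 < g)%N -> (0 < d2 < g)%N -> (0 < d3 < g)%N ->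
  ((g - 1) * a1 = g ^ l - 1)%N -> ((g - 1) * a2 = g ^ m - 1)%N -> ((g - 1) * a3 = g ^ n - 1)%N ->
  c = (d1 * a1 * (d2 * a2) * (d3 * a3))%N -> c%:R = phi R ^+ k + psi R ^+ k ->
  n%:R < 773 * 10 ^+ 45 * ln g%:R ^+ 9 :> R /\ k%:R < 773 * 10 ^+ 46 * ln g%:R ^+ 10 :> R.
Proof.
move=> g1 k0 l0 lm mn /andP[d10 d1g] /andP[d20 d2g] /andP[d30 d3g] e1 e2 e3 hc cR.
have m0 : (0 < m)%N by apply: leq_trans lm. have n0 : (0 < n)%N by apply: leq_trans mn.
have ln_ : (l <= n)%N by apply: leq_trans mn.
have gi1 i : (0 < g ^ i)%N by rewrite expn_gt0 ltnW.
have a10 : (0 < a1)%N by apply: leq_trans (repunit_facts g1 l0 e1).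
have a20 : (0 < a2)%N by apply: leq_trans (repunit_facts g1 m0 e2).
have a3g := repunit_facts g1 n0 e3.
have clo : (g ^ n.-1 <= c)%N.
  apply: leq_trans a3g _; rewrite hc -[leqLHS]mul1n leq_mul ?muln_gt0 ?d10 ?a10 ?d20 //.
  by rewrite leq_pmull.
have cup : (c < g ^ (l + m + n))%N.
  by rewrite hc !expnD !ltn_mul ?repdigit_lt.
have [kn nk hphi] := size_facts g1 k0 n0 ln_ mn cR clo cup.
have G0 := ln_nat_ge R g1; have G0' : 0 < ln g%:R :> R by move: G0; clear; lra.
suff hn : n%:R < 773 * 10 ^+ 45 * ln g%:R ^+ 9 :> R.
  split=> //; apply: lt_trans kn _; rewrite [X in _ < X](_ : _ = 10 * (773 * 10 ^+ 45 * ln g%:R ^+ 9) * ln g%:R); last by ring.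
  by rewrite ltr_pM2r // ltr_pM2l.
rewrite ltNge; apply/negP => nbig.
have [Q [nE Q294 GQ]] := Q_choice G0 nbig.
have hM := M_bound G0 nE Q294 GQ; set M := 10 * _ * _ in hM.
have Q100 : 100 <= Q by move: Q294; clear; lra.
pose D := (d1 * d2 * d3)%N.
have D0 : (0 < D)%N by rewrite !muln_gt0 d10 d20.
have Dg : (D <= g ^ 3)%N by rewrite /D (expnD _ 2 1) (expnD _ 1 1) expn1 !leq_mul // ltnW.
have eqN : ((g - 1) ^ 3 * c = D * (g ^ l - 1) * (g ^ m - 1) * (g ^ n - 1))%N.
  by rewrite -e1 -e2 -e3 hc /D !expnS expn0; ring.
have q0 : (0 < (g - 1) ^ 3)%N by rewrite expn_gt0 subn_gt0 g1.
have qg : ((g - 1) ^ 3 <= g ^ 3)%N by rewrite leq_exp2r // leq_subr.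
have eqR : ((g - 1) ^ 3)%N%:R * c%:R = D%:R * (g%:R ^+ l - 1) * (g%:R ^+ m - 1) * (g%:R ^+ n - 1) :> R.
  by rewrite -natrM eqN !natrM !natrB // !natrX.
have L0 := lucas_ge0 R k.
have n4 : (4 <= n)%N.
  rewrite -(ler_nat R); apply: le_trans nbig.
  have : (13 / 20) ^+ 9 <= ln g%:R ^+ 9 :> R.
    by rewrite lerXn2r ?nnegrE ?divr_ge0 // ltW.
  by clear; lra.
have g2 : 1 <= g%:R :> R by rewrite ler1n ltnW.
have lnl i : (0 < i)%N -> (i <= n)%N -> `|k%:R * ln (phi R) - ln (phi R ^+ k + psi R ^+ k)| * g%:R ^+ i <= 2 :> R.
  by move=> i0 i_n; apply: ln_lucas => //; apply: le_trans (hphi n4); rewrite ler_weXn2l.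
have kM : k%:R <= M by apply: ltW.
have NM i : (i <= 3 * n)%N -> i%:R <= M.
  move=> hi; apply: (@le_trans _ _ (3 * n%:R)); first by rewrite -natrM ler_nat.
  have n0' : 0 <= n%:R :> R by [].
  by rewrite /M; have := ler_wpM2l n0' G0; move: n0'; clear; lra.
have nkl i : (i <= n)%N -> 2 * (i%:R - 2) * ln g%:R <= k%:R :> R.
  move=> i_n; apply: le_trans nk; rewrite ler_wpM2r ?(ltW G0') // ler_wpM2l //.
  by rewrite lerD2r ler_nat.
have gl (i : nat) : (0 < i)%N -> (0 < g ^ i - 1)%N.
  by case: i => // i _; rewrite subn_gt0 expnS (leq_trans g1) // leq_pmulr.
(* The three stages at once: [s] lists the exponents still unknown, the known ones go into [p], and
   [p <= g ^ e] provides the height e ln g, with e equal to 3, l + 3 and l + m + 3 in turn. *)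
have st p N s e i : (0 < p)%N -> (p <= g ^ e)%N -> (3 <= e)%N -> (0 < i)%N -> (i <= n)%N -> (size s <= 3)%N ->
    all (leq i) s -> N = sumn s -> (N <= 3 * n)%N ->
    ((g - 1) ^ 3)%N%:R * c%:R = p%:R * \prod_(j <- s) (g%:R ^+ j - 1) :> R ->
    i%:R <= 92 * 10 ^+ 6 * Q ^+ 3 * (e%:R * ln g%:R) + 3.
  move=> p0 pg e3' i0 i_n ss alls NE N3 eqp.
  apply: (stage g1 p0 q0 _ _ _ Q100 kM (NM _ N3) hM _ (nkl _ i_n)).
  - by rewrite -{1}[ln _]mul1r ler_wpM2r ?(ltW G0') // ler1n (leq_trans _ e3').
  - exact: ln_nat_le (ltnW g1) p0 pg.
  - by apply: ln_nat_le (ltnW g1) q0 _; apply: leq_trans qg _; rewrite leq_pexp2l // ltnW.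
  rewrite cR in eqp; rewrite NE; apply: le_trans (Lam_le g1 p0 q0 i0 alls L0 (lnl _ i0 i_n) eqp) _.
  have -> : 8 = 2 * 4 :> R by rewrite -natrM.
  by rewrite ler_pM2l // ler_nat.
set b := 92 * 10 ^+ 6 * Q ^+ 3 * ln g%:R.
have bE e x : (e%:R : R) = x -> 92 * 10 ^+ 6 * Q ^+ 3 * (e%:R * ln g%:R) = b * x.
  by move=> ->; rewrite /b; ring.
have s1 : l%:R <= b * 3 + 3.
  rewrite -(bE 3%N) //; apply: (st D (l + m + n)%N [:: l; m; n]) => //=; rewrite ?leqnn ?lm ?ln_ //.
  - by rewrite addn0 addnA.
  - by rewrite !mulSn mul0n addn0 addnA !leq_add.
  by rewrite eqR !big_cons big_nil mulr1 !mulrA.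
have s2 : m%:R <= b * (l%:R + 3) + 3.
  rewrite -(bE (l + 3)%N); last by rewrite natrD.
   apply: (st (D * (g ^ l - 1))%N (m + n)%N [:: m; n]) => //=; rewrite ?leqnn ?mn //.
  - by rewrite muln_gt0 D0 gl.
  - by rewrite addnC expnD leq_mul // leq_subr.
  - by rewrite leq_addl.
  - by rewrite addn0.
  - by rewrite !mulSn mul0n addn0 leq_add // leq_addr.
  by rewrite eqR !big_cons big_nil mulr1 !natrM natrB // natrX !mulrA.
have s3 : n%:R <= b * (l%:R + m%:R + 3) + 3.
  rewrite -(bE (l + m + 3)%N); last by rewrite !natrD.
   apply: (st (D * (g ^ l - 1) * (g ^ m - 1))%N n [:: n]) => //=; rewrite ?leqnn //.
  - by rewrite muln_gt0 muln_gt0 D0 !gl.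
  - by rewrite addnC addnA !expnD; apply: leq_mul; [apply: leq_mul|]; rewrite ?leq_subr.
  - by rewrite leq_addl.
  - by rewrite addn0.
  - by rewrite leq_pmull.
  by rewrite eqR !big_cons big_nil mulr1 !natrM !natrB // !natrX.
have hb : 10 ^+ 9 <= b.
  have : 294 ^+ 3 * (13 / 20) <= Q ^+ 3 * ln g%:R.
    by rewrite ler_pM ?exprn_ge0 ?divr_ge0 // lerXn2r ?nnegrE // (le_trans _ Q294).
  by rewrite /b; clear; lra.
have := three_stages hb s1 s2 s3; rewrite leNgt => /negP; apply.
rewrite nE /b; have : 0 < Q ^+ 9 * ln g%:R ^+ 3.
  by rewrite mulr_gt0 ?exprn_gt0 //; apply: lt_le_trans Q294.
have -> : (92 * 10 ^+ 6 * Q ^+ 3 * ln g%:R) ^+ 3 = 92 ^+ 3 * 10 ^+ 18 * (Q ^+ 9 * ln g%:R ^+ 3) by ring.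
by clear; lra.
Qed.

(** * Transfer to the natural and real numbers of the standard library *)

Section Stdlib_reals.
Import Rstruct Rstruct_topology.

Lemma lucasE (R : realType) k : (lucas k)%:R = phi R ^+ k + psi R ^+ k.
Proof.
suff [] : (lucas k)%:R = phi R ^+ k + psi R ^+ k /\ (lucas k.+1)%:R = phi R ^+ k.+1 + psi R ^+ k.+1 by [].
elim: k => [|k [IH1 IH2]]; first by rewrite !expr0 !expr1 phiDpsi.
split=> //; rewrite [lucas _](_ : _ = lucas k.+1 + lucas k)%N // natrD IH1 IH2.
rewrite -addn2 (exprD (phi R)) (exprD (psi R)) phi_sqr psi_sqr !mulrDr !mulr1 -!exprSr.
by rewrite addrACA.
Qed.

Lemma repunitE g i : (1 < g)%N -> ((g - 1) * Nat.div (Nat.sub (Nat.pow g i) 1) (Nat.sub g 1) = g ^ i - 1)%N.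
Proof.
move=> g1; have -> : Nat.pow g i = (g ^ i)%N by elim: i => // i IH; rewrite expnS -IH.
have g0 : (g - 1)%N <> 0%N by apply/eqP; rewrite -lt0n subn_gt0.
have E : (g ^ i - 1 = (\sum_(j < i) g ^ j) * (g - 1))%N by rewrite !subn1 predn_exp mulnC.
rewrite -[Nat.sub _ _]/(g ^ i - 1)%N -[Nat.sub g 1]/(g - 1)%N E.
by rewrite -[X in Nat.div X _]/(Nat.mul _ _) PeanoNat.Nat.div_mul // mulnC.
Qed.

Theorem lucas_repdigits_Rbound (g k d1 d2 d3 l m n : nat) :
  (2 <= g)%coq_nat -> (1 <= k)%coq_nat -> (1 <= l)%coq_nat ->
  (1 <= d1)%coq_nat /\ (d1 <= Nat.sub g 1)%coq_nat -> (1 <= d2)%coq_nat /\ (d2 <= Nat.sub g 1)%coq_nat -> (1 <= d3)%coq_nat /\ (d3 <= Nat.sub g 1)%coq_nat ->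
  (l <= m)%coq_nat -> (m <= n)%coq_nat ->
  lucas k = Nat.mul (Nat.mul (repdigit g d1 l) (repdigit g d2 m)) (repdigit g d3 n) ->
  Rdefinitions.Rlt (Raxioms.INR n) (Rdefinitions.Rmult (Rdefinitions.Rmult (Raxioms.INR 773) (Rpow_def.pow (Raxioms.INR 10) 45)) (Rpow_def.pow (Rpower.ln (Raxioms.INR g)) 9)) /\
  Rdefinitions.Rlt (Raxioms.INR k) (Rdefinitions.Rmult (Rdefinitions.Rmult (Raxioms.INR 773) (Rpow_def.pow (Raxioms.INR 10) 46)) (Rpow_def.pow (Rpower.ln (Raxioms.INR g)) 10)).
Proof.
move=> /ssrnat.leP g1 /ssrnat.leP k0 /ssrnat.leP l0 [/ssrnat.leP d10 /ssrnat.leP d1g] [/ssrnat.leP d20 /ssrnat.leP d2g] [/ssrnat.leP d30 /ssrnat.leP d3g] /ssrnat.leP lm /ssrnat.leP mn eqL.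
have dg d : (0 < d)%N -> (d <= g - 1)%N -> (0 < d < g)%N.
  by move=> -> h /=; apply: leq_ltn_trans h _; rewrite subn1 ltn_predL ltnW.
have [h1 h2] := @lucas_repdigits_bound Rdefinitions.R g k d1 d2 d3 l m n _ _ _ _ g1 k0 l0 lm mn (dg _ d10 d1g) (dg _ d20 d2g) (dg _ d30 d3g)
  (repunitE l g1) (repunitE m g1) (repunitE n g1) eqL (lucasE _ k).
by split; apply/RltP; rewrite !RealsE.
Qed.
End Stdlib_reals.
End LucasRepdigits.

From Stdlib Require Import Reals Arith Lra.
Open Scope R_scope.

Theorem theorem1p2 (g : nat) (Hg : (2 <= g)%nat) :
  forall k d1 d2 d3 l m n : nat,
    (1 <= k)%nat -> (1 <= l)%nat ->
    (1 <= d1 <= g - 1)%nat -> (1 <= d2 <= g - 1)%nat -> (1 <= d3 <= g - 1)%nat ->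
    (l <= m)%nat -> (m <= n)%nat ->
    lucas k = (repdigit g d1 l * repdigit g d2 m * repdigit g d3 n)%nat ->
    INR n < 7.73 * 10 ^ 47 * (ln (INR g)) ^ 9 /\
    INR k < 7.73 * 10 ^ 48 * (ln (INR g)) ^ 10.
Proof.
intros k d1 d2 d3 l m n Hk Hl H1 H2 H3 Hlm Hmn HL.
destruct (LucasRepdigits.lucas_repdigits_Rbound Hg Hk Hl H1 H2 H3 Hlm Hmn HL) as [Hn Hk'].
rewrite (INR_IZR_INZ 773), (INR_IZR_INZ 10) in Hn, Hk'; simpl Z.of_nat in Hn, Hk'.
split; [replace (7.73 * 10 ^ 47) with (773 * 10 ^ 45) by lra
  | replace (7.73 * 10 ^ 48) with (773 * 10 ^ 46) by lra]; assumption.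
Qed.
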